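(* Let $\Lambda\subset\mathbb{R}^n$ be a full-rank lattice and let $K\subset\mathbb{R}^n$ be a convex fundamental domain of $\Lambda$ with barycenter at the origin. Suppose that there exists a linear hyperplane $H=\nu^\perp\subset\mathbb{R}^n$, with $\nu\in\mathbb{S}^{n-1}$, such that: (i) $K\cap H$ tiles $H$ by the translations $\Lambda\cap H$; (ii) for some $\delta\in(0,1]$, $\langle\operatorname{Cov}_K\nu,\nu\rangle\ge\delta\,\|\operatorname{Cov}_K\|_{op}$. Then $$\frac1{12}\ \le\ \|\operatorname{Cov}_K\|_{op}\,\lambda_1(\Lambda^* )^2\ =\ \frac1{4\pi^2}\|\operatorname{Cov}_K\|_{op}\,\lambda_{SG}(\mathbb{T}_\Lambda)\ \le\ \frac1{2\delta}.$$
   Context: $\mathbb{T}_\Lambda:=\mathbb{R}^n/\Lambda$ is the flat torus associated to $\Lambda$. The dual lattice is $\Lambda^*:=\{\xi\in\mathbb{R}^n:\langle\xi,\lambda\rangle\in\mathbb{Z}\ \text{for all }\lambda\in\Lambda\}$, and $\lambda_1(\Lambda^* ):=\min\{|\xi|:0\neq\xi\in\Lambda^*\}$, where $|\cdot|$ is the Euclidean norm. $\lambda_{SG}(\mathbb{T}_\Lambda)$ is the first nonzero eigenvalue of the nonnegative Laplacian $-\Delta$ on $\mathbb{T}_\Lambda$. A measurable set $K\subset\mathbb{R}^n$ is a fundamental domain for $\Lambda$ if its translates by $\Lambda$ tile $\mathbb{R}^n$ up to Lebesgue-null sets. Condition (i) means that $K\cap H$ is a fundamental domain of $\Lambda\cap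 H$ in $H$, i.e. the translates of $K\cap H$ by the elements of $\Lambda\cap H$ tile $H$ up to null sets for the $(n-1)$-dimensional Lebesgue measure on $H$. $|K|$ denotes the Lebesgue measure of $K$, $b_K$ its barycenter, and $\operatorname{Cov}_K:=\frac1{|K|}\int_K(x-b_K)\otimes(x-b_K)\,dx$. $\|\cdot\|_{op}$ is the operator norm. *)

(* Defs.v *)
From HB Require Import structures.
From mathcomp Require Import all_boot all_order all_algebra.
From mathcomp Require Import all_classical all_reals all_analysis.
Set Implicit Arguments.
Unset Strict Implicit.
Unset Printing Implicit Defensive.
Import Order.TTheory GRing.Theory Num.Theory numFieldNormedType.Exports.
Local Open Scope classical_set_scope.
Local Open Scope ring_scope.

Section Euclidean.
Context {R : realType} {n : nat}.
Implicit Types x y : 'rV[R]_n.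

Definition dotv x y : R := \sum_(i < n) x 0 i * y 0 i.

(* The library norm on matrices is the max norm, hence this Euclidean one. *)
Definition enorm x : R := Num.sqrt (dotv x x).

Definition opnorm (A : 'M[R]_n) : R :=
  sup [set enorm (v *m A) | v in [set v | enorm v <= 1]].

Definition hyperplane (nu : 'rV[R]_n) : set 'rV[R]_n := [set x | dotv x nu = 0].

End Euclidean.

Fact row_display : measure_display. Proof. exact: default_measure_display. Qed.

Section measurable_row.
Context {R : realType} (n : nat).

Let coord (i : 'I_n) (x : 'rV[R]_n) : measurableTypeR R := x 0 i.

Let row_set0 : g_sigma_preimage coord set0.
Proof. exact: sigma_algebra0. Qed.

Let row_setC A : g_sigma_preimage coord A -> g_sigma_preimage coord (~` A).
Proof. exact: sigma_algebraC. Qed.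

Let row_bigcup (F : (set 'rV[R]_n)^nat) :
  (forall i, g_sigma_preimage coord (F i)) ->
  g_sigma_preimage coord (\bigcup_i F i).
Proof. exact: sigma_algebra_bigcup. Qed.

HB.instance Definition _ := @isMeasurable.Build row_display
  'rV[R]_n (g_sigma_preimage coord) row_set0 row_setC row_bigcup.

Lemma measurable_coord (i : 'I_n) :
  measurable_fun setT (fun x : 'rV[R]_n => x 0 i : measurableTypeR R).
Proof.
move=> _ Y mY; rewrite setTI; apply: sub_sigma_algebra => /=.
rewrite -bigcup_seq/=; exists i => /=; first by rewrite mem_index_enum.
by exists Y => //; rewrite setTI.
Qed.

Lemma measurable_rowP d (T : measurableType d) (f : T -> 'rV[R]_n) :
  (forall i, measurable_fun setT (fun t => f t 0 i : measurableTypeR R)) ->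
  measurable_fun setT f.
Proof.
move=> mf _ A mA; rewrite setTI.
pose G := [set B | measurable (f @^-1` B)].
suff /(_ _ mA) : g_sigma_preimage coord `<=` G by [].
apply: smallest_sub.
  split; first by rewrite /G/= preimage_set0.
  - by move=> B mB; rewrite /G/= setTD -preimage_setC; exact: measurableC.
  - by move=> F mF; rewrite /G/= preimage_bigcup; exact: bigcupT_measurable.
rewrite -bigcup_seq => B [i _ [C mC <-]] /=.
by rewrite /G/= setTI -[X in measurable X]setTI; exact: mf.
Qed.

End measurable_row.

Section borel_lebesgue.
Context {R : realType}.

Definition row_cons n (p : measurableTypeR R * 'rV[R]_n) : 'rV[R]_n.+1 :=
  \row_j (if unlift ord0 j is Some k then p.2 0 k else p.1).

Definition row_uncons n (x : 'rV[R]_n.+1) : measurableTypeR R * 'rV[R]_n :=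
  (x 0 ord0, \row_k x 0 (lift ord0 k)).

Lemma row_consK n : cancel (@row_cons n) (@row_uncons n).
Proof.
case=> a y; congr pair; first by rewrite mxE unlift_none.
by apply/rowP => k; rewrite !mxE liftK.
Qed.

Lemma measurable_row_cons n : measurable_fun setT (@row_cons n).
Proof.
apply: measurable_rowP => i; under eq_fun do rewrite mxE.
case: (unliftP ord0 i) => [k _|_]; last exact: measurable_fst.
exact: (measurableT_comp (@measurable_coord R n k) measurable_snd).
Qed.

Lemma measurable_row_uncons n : measurable_fun setT (@row_uncons n).
Proof.
apply: measurable_fun_pair; first exact: measurable_coord.
apply: measurable_rowP => k; under eq_fun do rewrite mxE.
exact: measurable_coord.
Qed.

Section step.
Context n (m : {sigma_finite_measure set 'rV[R]_n -> \bar R}).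

Definition lebesgue_cons : set 'rV[R]_n.+1 -> \bar R :=
  pushforward (lebesgue_measure \x m)%E (@row_cons n).

Let lebesgue_cons0 : lebesgue_cons set0 = 0%E.
Proof. by rewrite /lebesgue_cons /pushforward preimage_set0 measure0. Qed.

Let lebesgue_cons_ge0 A : (0 <= lebesgue_cons A)%E.
Proof. by rewrite /lebesgue_cons /pushforward; exact: measure_ge0. Qed.

Let lebesgue_cons_sigma_additive : semi_sigma_additive lebesgue_cons.
Proof.
have mc (A : set 'rV[R]_n.+1) : measurable A -> measurable (@row_cons n @^-1` A).
  by move=> mA; rewrite -[X in measurable X]setTI; exact: measurable_row_cons.
move=> F mF tF mUF; rewrite /lebesgue_cons /pushforward preimage_bigcup.
apply: measure_semi_sigma_additive.
- by move=> i; exact: mc.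
- apply/trivIsetP => /= i j _ _ ij; rewrite -preimage_setI.
  by move/trivIsetP : tF => /(_ _ _ _ _ ij) ->//; rewrite preimage_set0.
- by rewrite -preimage_bigcup; exact: mc.
Qed.

HB.instance Definition _ := isMeasure.Build _ _ _ lebesgue_cons
  lebesgue_cons0 lebesgue_cons_ge0 lebesgue_cons_sigma_additive.

Let lebesgue_cons_sigma_finite : sigma_finite setT lebesgue_cons.
Proof.
have /sigma_finiteP[F [TF ndF Foo]] := sigma_finiteT (@lebesgue_measure R).
have /sigma_finiteP[G [TG ndG Goo]] := sigma_finiteT m.
exists (fun k => @row_uncons n @^-1` (F k `*` G k)).
  rewrite -preimage_bigcup (_ : \bigcup_k _ = setT) ?preimage_setT//.
  apply/seteqP; split => // -[x y] _.
  have [i _ Fx] : (\bigcup_k F k) x by rewrite -TF.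
  have [j _ Gy] : (\bigcup_k G k) y by rewrite -TG.
  exists (maxn i j) => //; split => /=.
  - by move: x Fx; exact/subsetPset/ndF/leq_maxl.
  - by move: y Gy; exact/subsetPset/ndG/leq_maxr.
move=> k; have [mF Fk] := Foo k; have [mG Gk] := Goo k; split.
  rewrite -[X in measurable X]setTI; apply: measurable_row_uncons => //.
  exact: measurableX.
rewrite /lebesgue_cons /pushforward -comp_preimage.
rewrite (_ : _ \o _ = id) ?preimage_id; last exact/funext/row_consK.
by rewrite product_measure1E// lte_mul_pinfty// ge0_fin_numE.
Qed.

HB.instance Definition _ := @Measure_isSigmaFinite.Build _ _ _ lebesgue_cons
  lebesgue_cons_sigma_finite.

End step.

Fixpoint borel_lebesgue n : {sigma_finite_measure set 'rV[R]_n -> \bar R} :=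
  if n is k.+1 then lebesgue_cons (borel_lebesgue k)
  else dirac (0 : 'rV[R]_0).

End borel_lebesgue.

(* Lebesgue measure on R^n as the completion of its restriction to the Borel
   sets.  As a set function it is the outer measure, defined on every set; its
   sigma-algebra is the one of the Lebesgue (i.e. Caratheodory) measurable
   sets, to which a convex set always belongs. *)
Definition lebesgue {R : realType} (n : nat) : set _ -> \bar R :=
  @completed_measure_extension _ _ _ (@borel_lebesgue R n).
HB.instance Definition _ (R : realType) (n : nat) :=
  Measure.on (@lebesgue R n).
Arguments lebesgue {R} n _.

Definition lebesgue_measurable {R : realType} {n : nat} (A : set 'rV[R]_n) :
    Prop :=
  ((borel_lebesgue n)^*)%mu.-cara.-measurable A.

(* An orthonormal basis of the hyperplane nu^\perp, as the rows of a matrix;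
   y |-> y *m hyperplane_frame nu is then an isometry from R^(n-1) onto the
   hyperplane, along which Lebesgue measure is transported. *)
Definition hyperplane_frame {R : realType} {n : nat} (nu : 'rV[R]_n) :
    'M[R]_(n.-1, n) :=
  get [set Q | Q *m Q^T = 1%:M /\ Q *m nu^T = 0].

Definition hyperplane_pull {R : realType} {n : nat} (nu : 'rV[R]_n)
    (A : set 'rV[R]_n) : set 'rV[R]_n.-1 :=
  (fun y => y *m hyperplane_frame nu) @^-1` A.

Definition hyperplane_lebesgue {R : realType} {n : nat} (nu : 'rV[R]_n)
    (A : set 'rV[R]_n) : \bar R :=
  lebesgue n.-1 (hyperplane_pull nu A).

Section Lattice.
Context {R : realType} {n : nat}.
Implicit Types L K W : set 'rV[R]_n.

Definition full_rank_lattice L : Prop :=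
  exists2 B : 'M[R]_n, B \in unitmx
    & L = range (fun z : 'rV[int]_n => map_mx intr z *m B).

Definition dual_lattice L : set 'rV[R]_n :=
  [set xi | forall l, L l -> dotv xi l \is a Num.int].

Definition translate (l : 'rV[R]_n) K : set 'rV[R]_n := [set x + l | x in K].

(* W is the ambient subspace and mu its Lebesgue measure. *)
Definition tiles (mu : set 'rV[R]_n -> \bar R) W L K : Prop :=
  mu (W `\` \bigcup_(l in L) translate l K) = 0%E /\
  forall l l', L l -> L l' -> l != l' ->
    mu (translate l K `&` translate l' K) = 0%E.

Definition fundamental_domain L K : Prop :=
  lebesgue_measurable K /\ tiles (lebesgue n) setT L K.

Definition hyperplane_fundamental_domain (nu : 'rV[R]_n) L K : Prop :=
  lebesgue_measurable (hyperplane_pull nu K) /\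
  tiles (hyperplane_lebesgue nu) (hyperplane nu) L K.

Definition volume K : R := fine (lebesgue n K).

Definition barycenter K : 'rV[R]_n :=
  \row_i ((volume K)^-1 * \int[lebesgue n]_(x in K) (x : 'rV[R]_n) 0 i).

Definition Cov K : 'M[R]_n :=
  \matrix_(i, j) ((volume K)^-1 *
    \int[lebesgue n]_(x in K)
      (((x : 'rV[R]_n) - barycenter K) 0 i * (x - barycenter K) 0 j)).

End Lattice.

Definition set_min {R : realType} (A : set R) : R :=
  xget 0 [set m | A m /\ lbound A m].

Definition lambda1 {R : realType} {n : nat} (L : set 'rV[R]_n) : R :=
  set_min [set enorm x | x in L `\ 0].

Section Laplacian.
Context {R : realType} {n : nat}.
Implicit Types (f : 'rV[R]_n -> R) (L : set 'rV[R]_n).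

Definition partial (i : 'I_n) f : 'rV[R]_n -> R := 'D_(delta_mx 0 i) f.

Definition C1 f : Prop :=
  continuous f /\
  forall i, (forall x, derivable f x (delta_mx 0 i)) /\ continuous (partial i f).

Definition C2 f : Prop := C1 f /\ forall i, C1 (partial i f).

Definition laplacian f : 'rV[R]_n -> R :=
  fun x => \sum_(i < n) partial i (partial i f) x.

(* Functions on the torus R^n / L are the L-periodic functions on R^n. *)
Definition periodic L f : Prop := forall l x, L l -> f (x + l) = f x.

Definition torus_eigenvalue L (a : R) : Prop :=
  exists f, [/\ periodic L f, C2 f, exists x, f x != 0
    & forall x, - laplacian f x = a * f x].

Definition lambdaSG L : R := set_min [set a | torus_eigenvalue L a /\ a != 0].

End Laplacian.

(* Main.v *)
(* Let U be the interior of K; up to null sets it tiles as K does.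

   Lower bound.  For xi dual and nonzero, <x, xi> mod 1 is uniformly distributed
   for x in U, so its mean squared distance to the integers is 1/12; hence
   <Cov xi, xi> >= 1/12, and it is at most ||Cov|| |xi|^2.

   Equality.  The functions cos(2 pi <x, xi> + th), xi dual, are eigenfunctions
   for 4 pi^2 |xi|^2; an eigenfunction for any other value would be orthogonal to
   all of them, hence zero.

   Upper bound.  Let f t be the (n-1)-volume of the section of U by H + t nu.
   The section by H tiles H under the lattice of H, which forces the section at
   height <l, nu> <> 0 to be empty for l in the lattice; thus these heights are
   the multiples of some h > 0, nu / h is dual, and |<x, nu>| < h on U.  By
   Brunn-Minkowski f decreases away from 0 (every section packs H, so f t <= f 0),
   and Chebyshev's inequality yields <Cov nu, nu> <= h^2 / 2, while
   lambda1 <= 1 / h. *)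

Require Import Defs.
From HB Require Import structures.
From mathcomp Require Import all_boot all_order all_algebra.
From mathcomp Require Import all_classical all_reals all_analysis.
From mathcomp Require Import measurable_realfun.
From mathcomp Require Import ring lra.
Set Implicit Arguments.
Unset Strict Implicit.
Unset Printing Implicit Defensive.
Import Order.TTheory GRing.Theory Num.Theory numFieldNormedType.Exports.
Local Open Scope classical_set_scope.
Local Open Scope ring_scope.

(** * Lebesgue measure on row vectors *)

(** [K] is Lebesgue measurable but perhaps not Borel, while slicing and Fubini work on Borel sets.
    This is why everything moves to the interior, the rest of [K] being enclosed in a Borel null set
    by means of dilations. Hypothesis (i) speaks of [K] and not of its interior. It is transferred
    inside [H] by dilations about a point of the interior on [H]; the barycenter provides that
    point, since [<x, nu>] has mean zero. Linear changes of variables come from the uniqueness of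
    Haar measure, with an unspecified constant; it cancels between the second moment and the volume.
    The uniform distribution modulo 1 is not computed either. Shifting the phase by 1/2 gives the
    relation [m = m / 4 + 1 / 16] for the mean squared distance to the integers, and 1/12 is its
    solution. Completeness of the characters uses powers of a trigonometric polynomial with one peak
    modulo the lattice: they would detect a point where an orthogonal function is positive. *)

Section borel_row.
Context {R : realType}.

(** Balls are open cubes, as the norm on rows is the maximum of the coordinates. The conjunct
    [0 < e] has to be stated apart for [n = 0], where there are no coordinates. *)
Lemma row_ballE n (x y : 'rV[R]_n) e :
  ball x e y <-> 0 < e /\ forall i, `|x 0 i - y 0 i| < e.
Proof.
split=> -[e0 xy]; split => //.
  by move=> i; have := xy 0 i.
by move=> i j; rewrite ord1; exact: xy.
Qed.

Lemma measurable_row_ball n (x : 'rV[R]_n) e : measurable (ball x e).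
Proof.
have [e0|e0] := ltP 0 e; last first.
  rewrite (_ : ball x e = set0) //; apply/seteqP; split => // y /row_ballE[].
  by rewrite ltNge e0.
rewrite (_ : ball x e = \bigcap_(i : 'I_n) ((fun y : 'rV[R]_n => y 0 i) @^-1` ball (x 0 i) e)).
  apply: fin_bigcap_measurable => // i _.
  rewrite -[X in measurable X]setTI; by apply: (@measurable_coord R n i) => //; exact: measurable_ball.
apply/seteqP; split => y.
  by move=> /row_ballE[_ xy] i _; exact: xy.
by move=> xy; apply/row_ballE; split => // i; exact: xy.
Qed.

(** The sigma-algebra is generated by the coordinates, not by the open sets. An open set is the
    countable union of the cubes inside it with rational centre and radius [1 / (k + 1)]. *)
Lemma open_measurable_row n (A : set 'rV[R]_n) : open A -> measurable A.
Proof.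
move=> oA.
pose c (p : 'rV[rat]_n * nat) : 'rV[R]_n := map_mx ratr p.1.
pose S := [set p : 'rV[rat]_n * nat | ball (c p) (p.2.+1%:R^-1) `<=` A].
have -> : A = \bigcup_(p in S) ball (c p) (p.2.+1%:R^-1).
  apply/seteqP; split => [x Ax|x [p] /=]; last by move=> /[apply].
  have /nbhs_ballP[e /= e0 xeA] : nbhs x A by exact: open_nbhs_nbhs.
  have [k ke] : exists k, k.+1%:R^-1 < e / 2.
    have [k _ /(_ k (leqnn k)) ke] := near_infty_natSinv_lt (PosNum (divr_gt0 e0 (ltr0Sn _ 1))).
    by exists k.
  have qP i : exists q : rat, `|ratr q - x 0 i| < (k.+1%:R^-1 : R).
    have ki : x 0 i - k.+1%:R^-1 < x 0 i + k.+1%:R^-1.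
      by rewrite ltrD2l (@lt_trans _ _ 0) ?oppr_lt0 ?invr_gt0.
    have [q] := rat_in_itvoo ki.
    by rewrite in_itv/= => qi; exists q; rewrite ltr_distl.
  have [q qE] := choice qP.
  exists (\row_i q i, k).
    move=> y /= /row_ballE[_ cy]; apply: xeA; apply/row_ballE; split => // i.
    rewrite -(subrK (ratr (q i)) (x 0 i)) -addrA.
    rewrite (le_lt_trans (ler_normD _ _))// [e]splitr ltrD//.
      by rewrite distrC (lt_trans (qE i)).
    by have := cy i; rewrite !mxE => /lt_trans; apply.
  apply/row_ballE; split => [|i]; first by rewrite invr_gt0.
  by rewrite !mxE.
rewrite bigcup_mkcond; apply: countable_bigcupT_measurable => // p.
case: ifP => // _; exact: measurable_row_ball.
Qed.

Lemma continuous_measurable_row n (f : 'rV[R]_n -> R) :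
  continuous f -> measurable_fun setT (f : 'rV[R]_n -> measurableTypeR R).
Proof.
move=> cf; apply: (measurability _ (RGenOpens.measurableE R)).
move=> _ [_ [a [b ->]] <-]; rewrite setTI.
by apply: open_measurable_row; move/continuousP : cf; apply; exact: interval_open.
Qed.

Lemma measurable_row_add n (v : 'rV[R]_n) :
  measurable_fun setT (fun x : 'rV[R]_n => x + v).
Proof.
apply: measurable_rowP => i; under eq_fun do rewrite mxE.
apply: (@measurable_funD _ _ _ _ (fun x : 'rV[R]_n => x 0 i) (cst (v 0 i))) => //.
exact: measurable_coord.
Qed.

Lemma lebesgue_measure_translate (a : R) (A : set (measurableTypeR R)) :
  measurable A -> lebesgue_measure ((fun x => x + a) @^-1` A) = lebesgue_measure A.
Proof.
move=> mA; have mf : measurable_fun setT (fun x : measurableTypeR R => x + a : measurableTypeR R).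
  exact: measurable_funD.
apply/esym; apply: (@lebesgue_measure_unique R (pushforward (@lebesgue_measure R) (fun x : measurableTypeR R => x + a : measurableTypeR R))) => //.
move=> _ [[b c]] _ <- /=; rewrite /pushforward.
rewrite (_ : _ @^-1` _ = `]b - a, c - a]%classic); last first.
  by apply/seteqP; split => x /=; rewrite !in_itv/= ltrBlDr lerBrDr.
by rewrite !lebesgue_measure_itv/= !lte_fin ltrD2r -!EFinB; congr (if _ then _%:E else _); ring.
Qed.

Lemma ge0_integral_comp_preserving d (T : measurableType d)
    (m : {measure set T -> \bar R}) (phi : T -> T) (f : T -> \bar R) :
  measurable_fun setT phi ->
  (forall A, measurable A -> m (phi @^-1` A) = m A) ->
  measurable_fun setT f -> (forall x, 0 <= f x)%E ->
  (\int[m]_x f (phi x) = \int[m]_x f x)%E.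
Proof.
move=> mphi phiE mf f0.
rewrite [RHS](eq_measure_integral (pushforward m phi)).
  by rewrite [RHS]ge0_integral_pushforward.
by move=> A mA _; rewrite -[LHS]phiE.
Qed.

Lemma ge0_integral_borel_lebesgueS n (g : 'rV[R]_n.+1 -> \bar R) :
  measurable_fun setT g -> (forall x, 0 <= g x)%E ->
  (\int[borel_lebesgue n.+1]_x g x =
   \int[lebesgue_measure]_t \int[borel_lebesgue n]_y g (row_cons (t, y)))%E.
Proof.
move=> mg g0.
rewrite [LHS](eq_measure_integral
  (pushforward (lebesgue_measure \x borel_lebesgue n)%E (@row_cons R n))) //.
  exact: measurable_row_cons.
move=> mc; rewrite [LHS]ge0_integral_pushforward ?preimage_setT ?fubini_tonelli1//.
  exact: measurableT_comp.
by move=> x; exact: g0.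
Qed.

Definition slice n (A : set 'rV[R]_n.+1) (t : R) : set 'rV[R]_n :=
  [set y | A (row_cons (t, y))].

Lemma borel_lebesgueS n (A : set 'rV[R]_n.+1) :
  borel_lebesgue n.+1 A = (\int[lebesgue_measure]_t borel_lebesgue n (slice A t))%E.
Proof.
rewrite /= /lebesgue_cons /pushforward /= /product_measure1.
apply: eq_integral => t _ /=; congr (borel_lebesgue n _).
by apply/seteqP; split => y; rewrite /xsection /slice /= inE.
Qed.

Lemma measurable_preimage_row_cons n (A : set 'rV[R]_n.+1) :
  measurable A -> measurable (@row_cons R n @^-1` A).
Proof.
by move=> mA; rewrite -[X in measurable X]setTI; exact: measurable_row_cons.
Qed.

Lemma measurable_slice n (A : set 'rV[R]_n.+1) t :
  measurable A -> measurable (slice A t).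
Proof.
move=> /measurable_preimage_row_cons mA.
have := measurable_xsection t mA.
by congr measurable; apply/seteqP; split => y; rewrite /xsection /slice /= inE.
Qed.

Lemma measurable_fun_slice n (A : set 'rV[R]_n.+1) : measurable A ->
  measurable_fun setT (fun t : measurableTypeR R => borel_lebesgue n (slice A t)).
Proof.
move=> /measurable_preimage_row_cons mA.
have := measurable_fun_xsection (borel_lebesgue n) mA.
apply: eq_measurable_fun => t _ /=; congr (borel_lebesgue n _).
by apply/seteqP; split => y; rewrite /xsection /slice /= inE.
Qed.

Lemma borel_lebesgue_translate n (v : 'rV[R]_n) (A : set 'rV[R]_n) :
  measurable A -> borel_lebesgue n ((fun x => x + v) @^-1` A) = borel_lebesgue n A.
Proof.
elim: n v A => [|n IHn] v A mA.
  have -> : (fun x => x + v) = id by apply/funext => x; apply/rowP => -[].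
  by rewrite preimage_id.
pose w : 'rV[R]_n := \row_k v 0 (lift ord0 k).
have vE t y : row_cons (t, y) + v = row_cons (t + v 0 ord0, y + w).
  by apply/rowP => j; rewrite !mxE; case: unliftP => [k|] ->; rewrite ?mxE.
rewrite !borel_lebesgueS.
rewrite -[RHS](ge0_integral_comp_preserving (phi := fun t : measurableTypeR R => t + v 0 ord0 : measurableTypeR R)) //.
- apply: eq_integral => t _; rewrite -[RHS](IHn w); last exact: measurable_slice.
  by congr (borel_lebesgue n _); apply/seteqP; split => y; rewrite /slice/= vE.
- exact: measurable_funD.
- by move=> B mB; exact: lebesgue_measure_translate.
- exact: measurable_fun_slice.
Qed.

Lemma ge0_integral_translate n (v : 'rV[R]_n) (g : 'rV[R]_n -> \bar R) :
  measurable_fun setT g -> (forall x, 0 <= g x)%E ->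
  (\int[borel_lebesgue n]_x g (x + v)%R = \int[borel_lebesgue n]_x g x)%E.
Proof.
move=> mg g0; apply: ge0_integral_comp_preserving => //.
  exact: measurable_row_add.
by move=> A mA; exact: borel_lebesgue_translate.
Qed.

Lemma borel_lebesgue_ball n (x : 'rV[R]_n) r : 0 < r ->
  borel_lebesgue n (ball x r) = ((r *+ 2) ^+ n)%:E.
Proof.
move=> r0; elim: n x => [|n IHn] x.
  by rewrite /= diracE mem_set//; apply/row_ballE; split => // -[].
have -> : borel_lebesgue n.+1 (ball x r) =
    (lebesgue_measure \x borel_lebesgue n)%E (ball (x 0 ord0 : R) r `*` ball (\row_k x 0 (lift ord0 k)) r).
  rewrite /= /lebesgue_cons /pushforward; congr (_ _).
  apply/seteqP; split => -[t y] /=.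
    move=> /row_ballE[_ xy]; split.
      by have := xy ord0; rewrite mxE unlift_none.
    by apply/row_ballE; split => // i; have := xy (lift ord0 i); rewrite !mxE liftK.
  move=> [xt /row_ballE[_ xy]]; apply/row_ballE; split => // i; rewrite mxE.
  by case: unliftP => [k|] -> //=; have := xy k; rewrite mxE.
rewrite product_measure1E; [|exact: measurable_ball|exact: measurable_row_ball].
rewrite exprS EFinM; congr (_ * _)%E; last exact: IHn.
exact: lebesgue_measure_ball (ltW r0).
Qed.

End borel_row.

(** * Linear changes of variables *)

Section linear_change.
Context {R : realType}.

(* The summand [1] makes the bound positive for the zero matrix. *)
Definition mx_l1 m n (M : 'M[R]_(m, n)) : R := 1 + \sum_i \sum_j `|M i j|.

Lemma mx_l1_gt0 m n (M : 'M[R]_(m, n)) : 0 < mx_l1 M.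
Proof.
rewrite (@lt_le_trans _ _ 1)// lerDl sumr_ge0// => i _.
by rewrite sumr_ge0.
Qed.

Lemma mulmx_coord_le m n (M : 'M[R]_(m, n)) (x : 'rV[R]_m) r :
  (forall i, `|x 0 i| <= r) -> 0 <= r ->
  forall j, `|(x *m M) 0 j| <= mx_l1 M * r.
Proof.
move=> xr r0 j; rewrite mxE (le_trans (ler_norm_sum _ _ _))//.
rewrite mulrDl mul1r (@le_trans _ _ ((\sum_i \sum_j `|M i j|) * r))//; last first.
  by rewrite lerDr.
rewrite mulr_suml ler_sum// => i _; rewrite normrM mulrC ler_pM//.
by rewrite (bigD1 j)//= lerDl sumr_ge0.
Qed.

Lemma continuous_mulmxr m n (M : 'M[R]_(m, n)) :
  continuous (fun x : 'rV[R]_m => x *m M).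
Proof.
move=> x A /nbhs_ballP[e /= e0 xeA]; apply/nbhs_ballP.
exists (e / (2 * mx_l1 M)); first by rewrite /= divr_gt0// mulr_gt0// mx_l1_gt0.
move=> y /row_ballE[c0 xy]; apply: xeA; apply/row_ballE; split => // j.
have -> : (x *m M) 0 j - (y *m M) 0 j = ((x - y) *m M) 0 j.
  by rewrite mulmxBl !mxE.
have xyr i : `|(x - y) 0 i| <= e / (2 * mx_l1 M) by rewrite !mxE ltW.
apply: (le_lt_trans (mulmx_coord_le M xyr (ltW c0) j)).
have := mx_l1_gt0 M; move: (mx_l1 M) => c cp.
rewrite (_ : c * _ = e / 2) ?gtr_pMr ?invf_lt1 ?ltr1n//.
by field; rewrite gt_eqF.
Qed.

Lemma measurable_mulmxr m n (M : 'M[R]_(m, n)) :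
  measurable_fun setT (fun x : 'rV[R]_m => x *m M).
Proof.
apply: measurable_rowP => i; under eq_fun do rewrite mxE.
apply: measurable_sum => k; apply: measurable_funM => //.
exact: measurable_coord.
Qed.

Definition bounded_row n (A : set 'rV[R]_n) : Prop := exists r, A `<=` ball 0 r.

Lemma borel_lebesgue_bounded n (A : set 'rV[R]_n) :
  measurable A -> bounded_row A -> (borel_lebesgue n A < +oo)%E.
Proof.
move=> mA [r Ar].
apply: (@le_lt_trans _ _ (borel_lebesgue n (ball 0 (Num.max r 1)))).
  apply: le_measure; rewrite ?inE//; first exact: measurable_row_ball.
  by apply: (subset_trans Ar); apply: le_ball; rewrite le_max lexx.
by rewrite borel_lebesgue_ball ?ltry// lt_max ltr01 orbT.
Qed.

Lemma borel_lebesgue_open_gt0 n (A : set 'rV[R]_n) :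
  open A -> A !=set0 -> (0 < borel_lebesgue n A)%E.
Proof.
move=> oA [x Ax].
have /nbhs_ballP[e /= e0 xeA] : nbhs x A by exact: open_nbhs_nbhs.
apply: (@lt_le_trans _ _ (borel_lebesgue n (ball x e))).
  by rewrite borel_lebesgue_ball// lte_fin exprn_gt0// pmulrn_lgt0.
apply: le_measure => //; rewrite inE; last exact: open_measurable_row.
exact: measurable_row_ball.
Qed.

(* Uniqueness of Haar measure: both sides are rewritings, by translations, of
   the double integral of [\1_B x * g (y *m M)]. *)
Lemma haar_mulmx n (m : {sigma_finite_measure set 'rV[R]_n -> \bar R})
    (M : 'M[R]_n) (B : set 'rV[R]_n) (g : 'rV[R]_n -> \bar R) :
  (forall v (h : 'rV[R]_n -> \bar R), measurable_fun setT h ->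
    (forall x, 0 <= h x)%E -> (\int[m]_x h (x + v)%R = \int[m]_x h x)%E) ->
  M \in unitmx -> measurable B ->
  measurable_fun setT g -> (forall x, 0 <= g x)%E ->
  (m B * \int[m]_x g (x *m M) = m [set y | B (- (y *m M))%R] * \int[m]_x g x)%E.
Proof.
move=> tm uM mB mg g0.
have mlin (a b : 'M[R]_n) :
    measurable_fun setT (fun p : 'rV[R]_n * 'rV[R]_n => p.1 *m a + p.2 *m b).
  apply: measurable_rowP => i; under eq_fun do rewrite mxE.
  apply: (@measurable_funD _ _ _ _ (fun p : 'rV[R]_n * 'rV[R]_n => (p.1 *m a) 0 i)
     (fun p : 'rV[R]_n * 'rV[R]_n => (p.2 *m b) 0 i)).
    apply: (measurableT_comp (@measurable_coord R n i)).
    exact: (measurableT_comp (@measurable_mulmxr _ _ a)).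
  apply: (measurableT_comp (@measurable_coord R n i)).
  exact: (measurableT_comp (@measurable_mulmxr _ _ b)).
pose C : set 'rV[R]_n := [set y | B (- (y *m M))].
have mC : measurable C.
  rewrite (_ : C = (fun y => y *m - M) @^-1` B).
    by rewrite -[X in measurable X]setTI; exact: measurable_mulmxr.
  by apply/seteqP; split => y; rewrite /C/= mulmxN.
have m1B : measurable_fun setT (\1_B : 'rV[R]_n -> R) by exact: measurable_indic.
have mf d (T : measurableType d) (phi psi : T -> 'rV[R]_n) :
   measurable_fun setT phi -> measurable_fun setT psi ->
   measurable_fun setT (fun p => (\1_B (phi p))%:E * g (psi p))%E.
  move=> mphi mpsi; apply: emeasurable_funM; last exact: measurableT_comp.
  apply/measurable_EFinP; exact: (measurableT_comp m1B).
have f0 (x y : 'rV[R]_n) : (0 <= (\1_B x)%:E * g y)%E.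
  by rewrite mule_ge0// lee_fin.
have mBE : (\int[m]_x (\1_B x)%:E = m B)%E.
  by rewrite -[in RHS](setIT B); exact: integral_indic.
have mCE : (\int[m]_x (\1_C x)%:E = m C)%E.
  by rewrite -[in RHS](setIT C); exact: integral_indic.
have mgM : measurable_fun setT (fun x => g (x *m M)).
  by apply: (measurableT_comp mg); exact: measurable_mulmxr.
(* [I2] shifts [y] by [x M^-1], [I4] shifts [x] by [- y M], and [I6] shifts [y] by [x M^-1] again,
   after which the inner integral is the constant [m C]; [I3] and [I5] exchange the integrals. *)
have I1 : (m B * \int[m]_y g (y *m M) =
    \int[m]_x \int[m]_y ((\1_B x)%:E * g (y *m M)))%E.
  transitivity (\int[m]_x ((\1_B x)%:E * \int[m]_y g (y *m M)))%E.
    rewrite -mBE ge0_integralZr ?integral_ge0//.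
    by apply/measurable_EFinP.
  by apply: eq_integral => x _; rewrite ge0_integralZl_EFin.
have I2 : (\int[m]_x \int[m]_y ((\1_B x)%:E * g (y *m M)) =
           \int[m]_x \int[m]_y ((\1_B x)%:E * g (y *m M + x)%R))%E.
  apply: eq_integral => x _.
  pose h y := ((\1_B x)%:E * g (y *m M))%E.
  have mh : measurable_fun setT h.
    by apply: (mf _ _ (cst x) (fun y => y *m M)) => //; exact: measurable_mulmxr.
  apply: (eq_trans (esym (tm (x *m invmx M) h mh (fun=> f0 _ _)))).
  by apply: eq_integral => y _; rewrite /h mulmxDl mulmxKV.
have I3 : (\int[m]_x \int[m]_y ((\1_B x)%:E * g (y *m M + x)%R) =
           \int[m]_y \int[m]_x ((\1_B x)%:E * g (y *m M + x)%R))%E.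
  pose F (p : 'rV[R]_n * 'rV[R]_n) := ((\1_B p.1)%:E * g (p.2 *m M + p.1)%R)%E.
  have mF : measurable_fun setT F.
    apply: (mf _ _ fst (fun p => p.2 *m M + p.1) measurable_fst); have := mlin 1%:M M.
    by apply: eq_measurable_fun => p _; rewrite mulmx1 addrC.
  exact: (fubini_tonelli (m1 := m) (m2 := m) F mF (fun p => f0 _ _)).
have I4 : (\int[m]_y \int[m]_x ((\1_B x)%:E * g (y *m M + x)%R) =
           \int[m]_y \int[m]_x ((\1_B (x - y *m M)%R)%:E * g x))%E.
  apply: eq_integral => y _.
  pose h x := ((\1_B x)%:E * g (y *m M + x)%R)%E.
  have mh : measurable_fun setT h.
    have mid : measurable_fun setT (fun x : 'rV[R]_n => x) by exact: measurable_id.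
    have madd : measurable_fun setT (fun x : 'rV[R]_n => y *m M + x).
      have := @measurable_row_add R n (y *m M).
      by apply: eq_measurable_fun => x _; rewrite addrC.
    exact: mf mid madd.
  apply: (eq_trans (esym (tm (- (y *m M)) h mh (fun=> f0 _ _)))).
  by apply: eq_integral => x _; rewrite /h subrKC.
have I5 : (\int[m]_y \int[m]_x ((\1_B (x - y *m M)%R)%:E * g x) =
           \int[m]_x \int[m]_y ((\1_B (x - y *m M)%R)%:E * g x))%E.
  pose F (p : 'rV[R]_n * 'rV[R]_n) := ((\1_B (p.1 - p.2 *m M)%R)%:E * g p.1)%E.
  have mF : measurable_fun setT F.
    apply: (mf _ _ (fun p : 'rV[R]_n * 'rV[R]_n => p.1 - p.2 *m M) fst _ measurable_fst); have := mlin 1%:M (- M).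
    by apply: eq_measurable_fun => p _; rewrite mulmx1 mulmxN.
  exact/esym/(fubini_tonelli (m1 := m) (m2 := m) F mF (fun p => f0 _ _)).
have I6 : (\int[m]_x \int[m]_y ((\1_B (x - y *m M)%R)%:E * g x) =
           \int[m]_x (m C * g x))%E.
  apply: eq_integral => x _.
  have mBx : measurable_fun setT (fun y : 'rV[R]_n => (\1_B (x - y *m M))%:E : \bar R).
    apply/measurable_EFinP; apply: (measurableT_comp m1B).
    have := measurableT_comp (@measurable_row_add R n x) (@measurable_mulmxr _ _ (- M)).
    by apply: eq_measurable_fun => y _ /=; rewrite mulmxN addrC.
  transitivity ((\int[m]_y (\1_B (x - y *m M)%R)%:E) * g x)%E.
    by rewrite ge0_integralZr// => y _; rewrite lee_fin.
  congr (_ * _)%E; rewrite -mCE.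
  pose h y : \bar R := (\1_B (x - y *m M))%:E.
  have h0 y : (0 <= h y)%E by rewrite lee_fin.
  apply: (eq_trans (esym (tm (x *m invmx M) h mBx h0))).
  have e y : x - (y + x *m invmx M) *m M = - (y *m M).
    by rewrite mulmxDl (mulmxKV uM) opprD addrCA subrr addr0.
  by apply: eq_integral => y _; rewrite /h e /indic.
rewrite I1 I2 I3 I4 I5 I6 ge0_integralZl//.
Qed.

(** Take the unit cube for the test set in [haar_mulmx]: its preimage [C] is open, nonempty and
    bounded, so [k], the measure of [C] over [2 ^+ n], is positive and finite. Its value, the
    inverse of the absolute determinant, is left implicit. *)
Lemma ge0_integral_mulmx n (M : 'M[R]_n) : M \in unitmx ->
  exists2 k : R, 0 < k & forall g : 'rV[R]_n -> \bar R,
    measurable_fun setT g -> (forall x, 0 <= g x)%E ->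
    (\int[borel_lebesgue n]_x g (x *m M) = k%:E * \int[borel_lebesgue n]_x g x)%E.
Proof.
move=> uM; pose B : set 'rV[R]_n := ball 0 1.
have mB : measurable B by exact: measurable_row_ball.
pose C : set 'rV[R]_n := [set y | B (- (y *m M))].
have CE : C = (fun y => y *m - M) @^-1` B.
  by apply/seteqP; split => y; rewrite /C/= mulmxN.
have mC : measurable C.
  by rewrite CE -[X in measurable X]setTI; exact: measurable_mulmxr.
have C0 : (0 < borel_lebesgue n C)%E.
  apply: borel_lebesgue_open_gt0; last first.
    by exists 0; rewrite /C/= mul0mx oppr0; apply: ballxx.
  rewrite CE; apply: open_comp; last exact: ball_open.
  by move=> x _; exact: continuous_mulmxr.
have Coo : (borel_lebesgue n C < +oo)%E.
  apply: borel_lebesgue_bounded => //.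
  exists (mx_l1 (invmx M) *+ 2) => y /row_ballE[_ By].
  have c0 := mx_l1_gt0 (invmx M).
  apply/row_ballE; split => [|i]; first by rewrite pmulrn_lgt0.
  have By1 k : `|(- (y *m M)) 0 k| <= 1.
    by have := By k; rewrite mxE sub0r normrN => /ltW.
  have := mulmx_coord_le (invmx M) By1 ler01 i.
  rewrite mulr1 mulNmx mulmxK// mxE normrN mxE sub0r normrN => /le_lt_trans; apply.
  by rewrite mulr2n ltrDl.
have muB : borel_lebesgue n B = (2 ^+ n)%:E by exact: borel_lebesgue_ball.
have B0 : (0 < 2 ^+ n :> R) by rewrite exprn_gt0.
pose c := fine (borel_lebesgue n C).
have cE : borel_lebesgue n C = c%:E by rewrite fineK// ge0_fin_numE// measure_ge0.
have c0 : 0 < c by rewrite -lte_fin -cE.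
exists (c / 2 ^+ n) => [|g mg g0]; first by rewrite divr_gt0.
have := haar_mulmx (@ge0_integral_translate R n) uM mB mg g0.
rewrite -/C cE muB => /(congr1 (fun z => ((2 ^+ n)^-1%:E * z)%E)).
by rewrite !muleA -!EFinM mulVf ?gt_eqF// mul1e mulrC.
Qed.

End linear_change.

(** * Comparison of packings with coverings *)

Section packing.
Context {R : realType}.

Lemma integral_indicT d (T : measurableType d) (m : {measure set T -> \bar R})
  (A : set T) : measurable A -> (\int[m]_x (\1_A x)%:E = m A)%E.
Proof. by move=> mA; rewrite integral_indic// setIT. Qed.

Lemma measurable_translate n (v : 'rV[R]_n) (A : set 'rV[R]_n) :
  measurable A -> measurable [set x | A (x + v)].
Proof.
by move=> mA; rewrite -[X in measurable X]setTI; exact: measurable_row_add.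
Qed.

Lemma ge0_integral_translate_set n (v : 'rV[R]_n) (A : set 'rV[R]_n)
    (g : 'rV[R]_n -> \bar R) :
  measurable A -> measurable_fun setT g -> (forall x, 0 <= g x)%E ->
  (\int[borel_lebesgue n]_(x in [set x | A (x + v)%R]) g (x + v)%R =
   \int[borel_lebesgue n]_(x in A) g x)%E.
Proof.
move=> mA mg g0.
rewrite integral_mkcond [RHS]integral_mkcond.
rewrite -[RHS](ge0_integral_translate v).
- by apply: eq_integral => x _; rewrite !patchE; congr (if _ then _ else _); rewrite !inE.
- by apply/(measurable_restrictT _ mA); apply: measurable_funTS.
- by move=> x; rewrite patchE; case: ifP.
Qed.

(* Cut both domains along the translates of the other one and move the pieces by
   the group of periods. *)
Lemma packing_le_covering n (L D1 D2 : set 'rV[R]_n) (g : 'rV[R]_n -> \bar R) :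
  countable L -> measurable D1 -> measurable D2 ->
  (forall x l l', L l -> L l' -> D1 (x + l) -> D1 (x + l') -> l = l') ->
  borel_lebesgue n [set x | forall l, L l -> ~ D2 (x - l)] = 0%E ->
  measurable_fun setT g -> (forall x, 0 <= g x)%E ->
  (forall x l, L l -> g (x + l) = g x) ->
  (\int[borel_lebesgue n]_(x in D1) g x <= \int[borel_lebesgue n]_(x in D2) g x)%E.
Proof.
move=> /countable_injP[f finj] mD1 mD2 pack cover mg g0 gper.
(* The pieces are indexed by the codes [f l] of the periods, and empty at a number that is no code,
   so that they form sequences and countable additivity applies. *)
pose A k := [set x | exists l, [/\ L l, f l = k & D2 (x - l)]].
pose B k := [set x | exists l, [/\ L l, f l = k & D1 (x + l)]].
have AE l : L l -> A (f l) = [set x | D2 (x - l)].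
  move=> Ll; apply/seteqP; split => x /=; last by exists l.
  by move=> [l' [Ll' /finj ->]] //; rewrite inE.
have BE l : L l -> B (f l) = [set x | D1 (x + l)].
  move=> Ll; apply/seteqP; split => x /=; last by exists l.
  by move=> [l' [Ll' /finj ->]] //; rewrite inE.
have AB0 k : ~ (exists2 l, L l & f l = k) -> A k = set0 /\ B k = set0.
  by move=> nk; split; apply/seteqP; split => // x [l [Ll flk _]]; apply: nk; exists l.
have mA k : measurable (A k).
  have [[l Ll <-]|/AB0[->]//] := pselect (exists2 l, L l & f l = k).
  by rewrite AE//; exact: measurable_translate.
have mB k : measurable (B k).
  have [[l Ll <-]|/AB0[_ ->]//] := pselect (exists2 l, L l & f l = k).
  by rewrite BE//; exact: measurable_translate.
have ABE k : (\int[borel_lebesgue n]_(x in D1 `&` A k) g x =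
              \int[borel_lebesgue n]_(x in D2 `&` B k) g x)%E.
  have [[l Ll <-]|/AB0[-> ->]] := pselect (exists2 l, L l & f l = k); last first.
    by rewrite !setI0.
  rewrite -(ge0_integral_translate_set l); [|exact: measurableI|by []|by []].
  rewrite AE// BE// (_ : [set x | _] = D2 `&` [set x | D1 (x + l)]).
    by apply: eq_integral => x _; rewrite gper.
  by apply/seteqP; split => x /=; rewrite addrK => -[].
set N := [set x | _] in cover.
have NE : N = ~` \bigcup_k A k.
  apply/seteqP; split => x /=.
    by move=> Nx [k _ [l [Ll _]]]; exact: Nx.
  by move=> nA l Ll D2x; apply: nA; exists (f l) => //; exists l.
have mN : measurable N by rewrite NE; apply/measurableC/bigcupT_measurable.
rewrite (ge0_negligible_integral mN)//; last exact: measurable_funTS.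
have -> : D1 `\` N = \bigcup_k (D1 `&` A k).
  by rewrite NE setDE setCK setI_bigcupr.
(* Translates of [D2] may overlap, hence so may the pieces of [D1], which are made disjoint first.
   The pieces of [D2] are disjoint because [D1] packs. *)
rewrite seqDU_bigcup_eq ge0_integral_bigcup//; last 2 first.
- by move=> k; apply: seqDU_measurable => i; exact: measurableI.
- exact: measurable_funTS.
apply: (@le_trans _ _ (\sum_(k <oo) \int[borel_lebesgue n]_(x in D1 `&` A k) g x)%E).
  apply: lee_nneseries => k _; first by move=> _; exact: integral_ge0.
  apply: ge0_subset_integral => //.
  - by apply: seqDU_measurable => i; exact: measurableI.
  - exact: measurableI.
  - exact: measurable_funTS.
  - exact: subset_seqDU.
rewrite (eq_eseriesr (fun k _ => ABE k)) -ge0_integral_bigcup//; last 3 first.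
- by move=> k; exact: measurableI.
- exact: measurable_funTS.
- apply/trivIsetP => i j _ _ ij; apply/seteqP; split => // x [] [_ [l [Ll li Dl]]].
  move=> [_ [l' [Ll' lj Dl']]]; move: ij; rewrite -li -lj.
  by rewrite (pack _ _ _ Ll Ll' Dl Dl') eqxx.
apply: ge0_subset_integral => //.
- by apply: bigcupT_measurable => k; exact: measurableI.
- exact: measurable_funTS.
- by move=> x [k _ []].
Qed.

Lemma packing_le_covering_measure n (L D1 D2 : set 'rV[R]_n) :
  countable L -> measurable D1 -> measurable D2 ->
  (forall x l l', L l -> L l' -> D1 (x + l) -> D1 (x + l') -> l = l') ->
  borel_lebesgue n [set x | forall l, L l -> ~ D2 (x - l)] = 0%E ->
  (borel_lebesgue n D1 <= borel_lebesgue n D2)%E.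
Proof.
move=> cL mD1 mD2 pack cover.
have := packing_le_covering (g := cst 1%E) cL mD1 mD2 pack cover.
by rewrite !integral_cst// !mul1e; apply.
Qed.

End packing.

(** * Dilations about a point *)

Section boundary.
Context {R : realType}.

(** It serves both as the dilation of ratio [s] about [p] and as the convex combination
    [(1 - s) p + s x]. *)
Definition homothety n (p : 'rV[R]_n) (s : R) (x : 'rV[R]_n) := p + s *: (x - p).

Lemma homothetyE n (p : 'rV[R]_n) s x : homothety p s x = x *m s%:M + (p - s *: p).
Proof. by rewrite /homothety mul_mx_scalar scalerBr addrCA. Qed.

Lemma measurable_homothety_preimage n (p : 'rV[R]_n) s (A : set 'rV[R]_n) :
  measurable A -> measurable (homothety p s @^-1` A).
Proof.
move=> mA; rewrite (_ : _ @^-1` A = (fun x => x *m s%:M) @^-1` [set x | A (x + (p - s *: p))]).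
  rewrite -[X in measurable X]setTI; apply: measurable_mulmxr => //.
  exact: measurable_translate.
by apply/seteqP; split => x /=; rewrite homothetyE.
Qed.

(** For a scalar matrix the constant of [ge0_integral_mulmx] is found by testing on the cube of
    radius [s], whose preimage is the cube of radius 1. *)
Lemma borel_lebesgue_homothety n (p : 'rV[R]_n) s (A : set 'rV[R]_n) : 0 < s ->
  measurable A ->
  borel_lebesgue n (homothety p s @^-1` A) = ((s ^+ n)^-1%:E * borel_lebesgue n A)%E.
Proof.
move=> s0 mA.
have us : (s%:M : 'M[R]_n) \in unitmx by rewrite unitmxE det_scalar unitfE expf_neq0// gt_eqF.
have [k k0 kE] := ge0_integral_mulmx us.
have muE B : measurable B ->
    borel_lebesgue n ((fun x => x *m s%:M) @^-1` B) = (k%:E * borel_lebesgue n B)%E.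
  move=> mB.
  have mB' : measurable ((fun x : 'rV[R]_n => x *m s%:M) @^-1` B).
    by rewrite -[X in measurable X]setTI; exact: measurable_mulmxr.
  have m1B : measurable_fun setT (fun x : 'rV[R]_n => (\1_B x)%:E : \bar R).
    by apply/measurable_EFinP; exact: measurable_indic.
  have := kE _ m1B (fun x => _ : (0 <= (\1_B x)%:E :> \bar R)%E).
  rewrite (integral_indicT _ mB) -(integral_indicT _ mB'); apply.
  by move=> x; rewrite lee_fin.
have kEs : k = (s ^+ n)^-1.
  have := muE (ball 0 s) (measurable_row_ball _ _).
  rewrite (_ : _ @^-1` _ = ball 0 1); last first.
    apply/seteqP; split => x /row_ballE[? xs]; apply/row_ballE; split => // i.
      have := xs i; rewrite mul_mx_scalar !mxE !sub0r !normrN normrM gtr0_norm//.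
      by rewrite gtr_pMr.
    have := xs i; rewrite mul_mx_scalar !mxE !sub0r !normrN normrM gtr0_norm//.
    by rewrite gtr_pMr.
  rewrite !borel_lebesgue_ball// -EFinM => -[].
  rewrite -[s *+ 2]mulr_natr exprMn => /esym/(canRL (mulfK _)) -> //.
    by rewrite invfM mulrCA mulfV ?mulr1// gt_eqF// exprn_gt0.
  by rewrite gt_eqF// mulr_gt0 ?exprn_gt0.
rewrite -kEs -(borel_lebesgue_translate (p - s *: p) mA) -muE; last first.
  exact: measurable_translate.
by congr (borel_lebesgue n _); apply/seteqP; split => x /=; rewrite homothetyE.
Qed.

End boundary.

(** * Convex sets *)

Section convex_row.
Context {R : realType}.
Implicit Types n : nat.

Definition convex_row n (A : set 'rV[R]_n) : Prop :=
  forall x y s, A x -> A y -> 0 <= s <= 1 -> A (homothety x s y).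

Lemma homothety_coord n (p x : 'rV[R]_n) s i :
  homothety p s x 0 i = p 0 i + s * (x 0 i - p 0 i).
Proof. by rewrite /homothety !mxE. Qed.

Lemma convex_setP n (A : set 'rV[R]_n) :
  convex_set (A : set (convex_lmodType 'rV[R]_n)) -> convex_row A.
Proof.
move=> cA x y s Ax Ay /andP[s0 s1].
(* The parameter of [conv] is the weight of the first point, that of [homothety] the weight of the
   second; hence [1 - s]. *)
have s1' : 0 <= 1 - s <= 1 by rewrite subr_ge0 s1 gerBl.
have := cA x y (Itv01 (andP s1').1 (andP s1').2); rewrite !inE => /(_ Ax Ay).
congr A; apply/rowP => i; rewrite homothety_coord /conv /= !mxE /unstable.onem /=.
ring.
Qed.

(** Solving [y = (1 - s) q + s x] for [q] maps the cube of radius [(1 - s) r] about the image point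
    onto the cube of radius [r] about [p], which lies in [A]. *)
Lemma homothety_interior n (A : set 'rV[R]_n) p x s :
  convex_row A -> A° p -> A x -> 0 <= s < 1 -> A° (homothety p s x).
Proof.
move=> cA /nbhs_ballP[r /= r0 prA] Ax /andP[s0 s1].
have s1' : 0 < 1 - s by rewrite subr_gt0.
apply/nbhs_ballP; exists ((1 - s) * r); first by rewrite /= mulr_gt0.
move=> y /row_ballE[_ yr].
pose q : 'rV[R]_n := \row_i ((y 0 i - s * x 0 i) / (1 - s)).
have qA : A q.
  apply: prA; apply/row_ballE; split => // i.
  have := yr i; rewrite homothety_coord mxE.
  have -> : p 0 i - (y 0 i - s * x 0 i) / (1 - s) =
      (p 0 i + s * (x 0 i - p 0 i) - y 0 i) / (1 - s).
    by field; rewrite gt_eqF.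
  by rewrite normrM normfV (gtr0_norm s1') ltr_pdivrMr// (mulrC r).
have -> : y = homothety q s x.
  apply/rowP => i; rewrite homothety_coord mxE.
  by field; rewrite gt_eqF.
by apply: cA => //; rewrite s0 ltW.
Qed.

Lemma convex_interior n (A : set 'rV[R]_n) : convex_row A -> convex_row A°.
Proof.
move=> cA x y s Ax Ay /andP[s0]; rewrite le_eqVlt => /orP[/eqP->|s1].
  by rewrite (_ : homothety _ _ _ = y)//; apply/rowP => i; rewrite homothety_coord; ring.
apply: homothety_interior; rewrite ?s0//; exact: interior_subset.
Qed.

(* It lies between [K] and every enlargement of [U] about [p], so it exceeds [U]
   by a null set; thus it controls [K `\` K°]. *)
Definition radial_hull n (p : 'rV[R]_n) (U : set 'rV[R]_n) : set 'rV[R]_n :=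
  \bigcap_(k : nat) (homothety p (1 - k.+1%:R^-1) @^-1` U).

Lemma measurable_radial_hull n (p : 'rV[R]_n) (U : set 'rV[R]_n) :
  measurable U -> measurable (radial_hull p U).
Proof.
by move=> mU; apply: bigcapT_measurable => k; exact: measurable_homothety_preimage.
Qed.

Lemma sub_radial_hull n (p : 'rV[R]_n) (K U : set 'rV[R]_n) :
  (forall x s, K x -> 0 <= s < 1 -> U (homothety p s x)) ->
  K `<=` radial_hull p U.
Proof.
move=> KU x Kx k _; apply: KU => //.
by rewrite subr_ge0 invf_le1// ler1n/= gtrBl invr_gt0.
Qed.

(** The hull is contained in enlargements of [U] whose ratios tend to 1, and the measure of each is
    that of [U] times the power [n] of the ratio. *)
Lemma radial_hull_null n (p : 'rV[R]_n) (U : set 'rV[R]_n) : measurable U -> U p -> convex_row U ->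
  (borel_lebesgue n U < +oo)%E -> borel_lebesgue n (radial_hull p U `\` U) = 0%E.
Proof.
move=> mU Up cU Uoo.
have mC := measurable_radial_hull p mU.
have UC : U `<=` radial_hull p U.
  by apply: sub_radial_hull => x s Ux /andP[s0 s1]; apply: cU => //; rewrite s0 ltW.
(* The index 0 of [radial_hull] has ratio 0 and bounds nothing; starting from [k.+2] keeps the ratio
   positive. *)
have CleU k : (borel_lebesgue n (radial_hull p U) <=
    ((1 - k.+2%:R^-1) ^+ n)^-1%:E * borel_lebesgue n U)%E.
  rewrite -(@borel_lebesgue_homothety R n p)//; last first.
    by rewrite subr_gt0 invf_lt1// ltr1n.
  apply: le_measure; rewrite ?inE//; first exact: measurable_homothety_preimage.
  by move=> x; exact.
have Coo : (borel_lebesgue n (radial_hull p U) < +oo)%E.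
  apply: le_lt_trans (CleU 0%N) _; rewrite lte_mul_pinfty// lee_fin.
  by rewrite invr_ge0 exprn_ge0// subr_ge0 invf_le1// ler1n.
rewrite measureD// setIidr//; apply/eqP; rewrite sube_eq; last 2 first.
- by rewrite ge0_fin_numE.
- by rewrite fin_num_adde_defr// ge0_fin_numE.
rewrite add0e eq_le [X in _ && X]le_measure ?inE// andbT.
have Cf : borel_lebesgue n (radial_hull p U) \is a fin_num by rewrite ge0_fin_numE.
have Uf : borel_lebesgue n U \is a fin_num by rewrite ge0_fin_numE.
pose c := fine (borel_lebesgue n (radial_hull p U)).
pose u := fine (borel_lebesgue n U).
suff : (c%:E <= u%:E)%E by rewrite !fineK.
rewrite lee_fin.
have cu k : (1 - k.+2%:R^-1) ^+ n * c <= u.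
  have := CleU k; rewrite -(fineK Cf) -(fineK Uf) -EFinM lee_fin -/c -/u.
  have s0 : 0 < (1 - k.+2%:R^-1 : R) by rewrite subr_gt0 invf_lt1// ltr1n.
  by rewrite mulrC ler_pdivlMr ?exprn_gt0// mulrC.
have h : (k.+2%:R^-1 : R) @[k --> \oo] --> (0 : R).
  by rewrite (cvg_shiftS (fun k => k.+1%:R^-1 : R)); exact: cvg_harmonic.
have h1 : (1 - k.+2%:R^-1 : R) @[k --> \oo] --> (1 - 0 : R).
  by apply: cvgB => //; exact: cvg_cst.
have h2 : (1 - k.+2%:R^-1) ^+ n * c @[k --> \oo] --> (1 - 0) ^+ n * c.
  apply: cvgMr_tmp; apply: (cvg_comp _ (fun x : R => x ^+ n) h1).
  exact: exprn_continuous.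
rewrite (_ : c = (1 - 0) ^+ n * c); last by rewrite subr0 expr1n mul1r.
rewrite -(cvg_lim _ h2)//; apply: limr_le; first by apply: cvgP h2.
exact: nearW.
Qed.

(** Let [U] contain the cube of radius [r] about [p], and a point [y] at distance at least [2 N r]
    from [p] in some coordinate. On the first half of the segment from [p] to [y], convexity leaves
    room for cubes of radius [r / 2]. The [N] of them centred at the parameters [j / (2 N)] are
    disjoint and have volume [r ^+ n] each, which is too much once [N] times [r ^+ n] exceeds the
    volume of [U]. *)
Lemma convex_row_bounded n (U : set 'rV[R]_n) : open U -> convex_row U ->
  (borel_lebesgue n U < +oo)%E -> bounded_row U.
Proof.
move=> oU cU Uoo.
have [->|/set0P[p Up]] := eqVneq U set0; first by exists 0 => x [].
have mU := open_measurable_row oU.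
have /nbhs_ballP[r /= r0 prU] : nbhs p U by exact: open_nbhs_nbhs.
pose u := fine (borel_lebesgue n U).
have Uf : borel_lebesgue n U \is a fin_num by rewrite ge0_fin_numE.
pose N := (Num.truncn (u / r ^+ n)).+1.
have NE : u < N%:R * r ^+ n.
  by rewrite -ltr_pdivrMr ?exprn_gt0// truncnS_gt.
have N0 : (0 < N%:R :> R) by rewrite ltr0n.
suff ybound y i : U y -> `|y 0 i - p 0 i| < 2 * N%:R * r.
  exists (2 * N%:R * r + mx_l1 p) => y Uy; apply/row_ballE; split.
    by rewrite addr_gt0 ?mx_l1_gt0// !mulr_gt0.
  move=> i; rewrite mxE sub0r normrN -(subrK (p 0 i) (y 0 i)).
  rewrite (le_lt_trans (ler_normD _ _))// ltr_leD ?ybound//.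
  rewrite /mx_l1 big_ord1 (bigD1 i)//= addrCA lerDl addr_ge0// sumr_ge0//.
move=> Uy; rewrite ltNge; apply/negP => big.
pose z (j : nat) := homothety p (j%:R / (2 * N%:R)) y.
pose A j : set 'rV[R]_n := ball (z j) (r / 2).
have sN j : (j < N)%N -> 0 <= (j%:R / (2 * N%:R) : R) <= 1 / 2.
  move=> jN; apply/andP; split; first by rewrite divr_ge0// mulr_ge0.
  have jN' : j%:R <= N%:R :> R by rewrite ler_nat ltnW.
  by rewrite ler_pdivrMr ?mulr_gt0//; lra.
have AU j : (j < N)%N -> A j `<=` U.
  move=> /sN /andP[s0 s1] x /row_ballE[_ xz]; move: s0 s1 xz; rewrite /z.
  set s := _ / _ => s0 s1 xz.
  have s1' : 0 < 1 - s by lra.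
  pose q : 'rV[R]_n := \row_i ((x 0 i - s * y 0 i) / (1 - s)).
  have -> : x = homothety q s y.
    apply/rowP => k; rewrite homothety_coord mxE.
    by field; rewrite gt_eqF.
  apply: cU => //; last by rewrite s0 (le_trans s1)// ler_pdivrMr// mul1r ler1n.
  apply: prU; apply/row_ballE; split => // k.
  have := xz k; rewrite homothety_coord mxE.
  have -> : p 0 k - (x 0 k - s * y 0 k) / (1 - s) =
      (p 0 k + s * (y 0 k - p 0 k) - x 0 k) / (1 - s).
    by field; rewrite gt_eqF.
  rewrite normrM normfV (gtr0_norm s1') ltr_pdivrMr// => /lt_le_trans; apply.
  by rewrite ler_pM2l//; lra.
have tA : trivIset `I_N A.
  apply/trivIsetP => j k; wlog jk : j k / (j < k)%N => [H jN kN jk|].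
    move: jk; rewrite neq_ltn => /orP[jk|kj]; first by apply: H => //; rewrite neq_ltn jk.
    by rewrite setIC; apply: H => //; rewrite neq_ltn kj.
  move=> jN kN _; apply/seteqP; split => // x [/row_ballE[_ /(_ i)] + /row_ballE[_ /(_ i)]].
  rewrite !homothety_coord; set d := y 0 i - p 0 i in big *.
  set a := _ / _; set b := _ / _.
  rewrite ltr_distlC => /andP[h1 h2]; rewrite ltr_distlC => /andP[h3 h4].
  have : `|(b - a) * d| < r by rewrite ltr_norml; apply/andP; split; lra.
  apply/negP; rewrite -leNgt normrM /a /b -mulrBl -natrB ?(ltnW jk)//.
  rewrite normrM normfV normrM !normr_nat.
  have kj : 1 <= (k - j)%:R :> R by rewrite ler1n subn_gt0.
  rewrite mulrAC ler_pdivlMr ?mulr_gt0//.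
  apply: le_trans (ler_peMl (normr_ge0 d) kj).
  by rewrite mulrC.
have := @measure_semi_additive_ord_I _ _ _ (borel_lebesgue n) A N
  (fun k _ => measurable_row_ball _ _) tA _.
have mUA : measurable (\big[setU/set0]_(k < N) A k).
  by apply: bigsetU_measurable => k _; exact: measurable_row_ball.
move=> /(_ mUA) AE.
have : (borel_lebesgue n (\big[setU/set0]_(k < N) A k) <= borel_lebesgue n U)%E.
  apply: le_measure; rewrite ?inE// -bigcup_mkord => x [j /= jN].
  exact: AU.
rewrite AE -(fineK Uf) -/u.
rewrite (eq_bigr (fun=> (r ^+ n)%:E)) => [|j _]; last first.
  apply: (eq_trans (borel_lebesgue_ball (z j) (divr_gt0 r0 (ltr0Sn R 1)))).
  by rewrite mulr2n -splitr.
by rewrite sumEFin lee_fin sumr_const card_ord -mulr_natl leNgt NE.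
Qed.

End convex_row.

(** * Null sets of the outer measure *)

Section null_sets.
Context {R : realType}.

Lemma lebesgueE n (A : set 'rV[R]_n) : measurable A ->
  lebesgue n A = borel_lebesgue n A.
Proof. by move=> mA; exact: measurable_mu_extE. Qed.

Lemma le_lebesgue n (A B : set 'rV[R]_n) : A `<=` B -> (lebesgue n A <= lebesgue n B)%E.
Proof. exact: le_mu_ext. Qed.

Lemma lebesgue_null_bigcup n (L : set 'rV[R]_n) (F : 'rV[R]_n -> set 'rV[R]_n) :
  countable L -> (forall l, L l -> lebesgue n (F l) = 0%E) ->
  lebesgue n (\bigcup_(l in L) F l) = 0%E.
Proof.
move=> /countable_injP[f finj] F0.
pose G k := \bigcup_(l in L `&` f @^-1` [set k]) F l.
have G0 k : lebesgue n (G k) = 0%E.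
  have [[l Ll <-]|nk] := pselect (exists2 l, L l & f l = k).
    rewrite (_ : G (f l) = F l) ?F0//; apply/seteqP; split => x.
      by move=> [l' [Ll' /= /finj <-]] //; rewrite inE.
    by move=> Fx; exists l.
  rewrite (_ : G k = set0); first exact: mu_ext0.
  by apply/seteqP; split => // x [l [Ll lk] _]; apply: nk; exists l.
apply/eqP; rewrite eq_le; apply/andP; split; last exact: mu_ext_ge0.
have -> : \bigcup_(l in L) F l = \bigcup_k G k.
  apply/seteqP; split => x; first by move=> [l Ll Fx]; exists (f l) => //; exists l.
  by move=> [k _ [l [Ll _] Fx]]; exists l.
have <- : (\sum_(k <oo) lebesgue n (G k) = 0)%E by rewrite eseries0.
exact: (outer_measure_sigma_subadditive (mu_ext (borel_lebesgue n)) G).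
Qed.

Lemma lebesgue_null_setU n (A B : set 'rV[R]_n) :
  lebesgue n A = 0%E -> lebesgue n B = 0%E -> lebesgue n (A `|` B) = 0%E.
Proof.
move=> A0 B0; apply/eqP; rewrite eq_le; apply/andP; split; last exact: mu_ext_ge0.
apply: le_trans (outer_measureU2 (mu_ext (borel_lebesgue n)) A B) _.
by rewrite [X in (X + _)%E]A0 [X in (_ + X)%E]B0 adde0.
Qed.

Lemma lebesgue_null_sub n (A B : set 'rV[R]_n) : A `<=` B ->
  lebesgue n B = 0%E -> lebesgue n A = 0%E.
Proof.
move=> AB B0; apply/eqP; rewrite eq_le; apply/andP; split; last exact: mu_ext_ge0.
by rewrite -B0; exact: le_lebesgue.
Qed.

Lemma measurable_affine_hyperplane n (w : 'cV[R]_n) (c : 'M[R]_1) :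
  measurable [set x : 'rV[R]_n | x *m w = c].
Proof.
rewrite (_ : [set x | _] = (fun x : 'rV[R]_n => (x *m w) 0 0) @^-1` [set c 0 0]).
  rewrite -[X in measurable X]setTI.
  apply: (measurableT_comp (@measurable_coord R 1 0) (@measurable_mulmxr R _ _ w)) => //.
apply/seteqP; split => x /=; first by move=> ->.
by move=> xc; apply/matrixP => i j; rewrite !ord1.
Qed.

(** Slices along the first coordinate: either the remaining coefficients give a hyperplane in every
    slice, or they all vanish and only the slice at height [c / w_0] is nonempty. *)
Lemma borel_lebesgue_hyperplane n (w : 'cV[R]_n) (c : 'M[R]_1) : w != 0 ->
  borel_lebesgue n [set x : 'rV[R]_n | x *m w = c] = 0%E.
Proof.
elim: n w c => [w|n IHn w c w0].
  by move=> c /eqP; case; apply/colP => -[].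
pose w' : 'cV[R]_n := \col_k w (lift ord0 k) 0.
have wE t y : (row_cons (t, y) *m w) = (t * w ord0 0)%:M + y *m w' :> 'M[R]_1.
  apply/matrixP => i j; rewrite !ord1 !mxE big_ord_recl eqxx mulr1n mxE unlift_none.
  by congr (_ + _); apply: eq_bigr => k _; rewrite !mxE liftK.
rewrite borel_lebesgueS.
have [w'0|w'0] := eqVneq w' 0; last first.
  rewrite integral0_eq// => t _; rewrite -[RHS](IHn w' (c - (t * w ord0 0)%:M) w'0).
  congr (borel_lebesgue n _); apply/seteqP; split => y; rewrite /slice/= wE.
    by move=> <-; rewrite addrC addKr.
  by move=> ->; rewrite addrC subrK.
have wn0 : w ord0 0 != 0.
  apply: contraNneq w0 => w00; apply/eqP/colP => i; rewrite mxE.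
  case: (unliftP ord0 i) => [k|] -> //.
  by have /colP/(_ k) := w'0; rewrite !mxE.
have mH := @measurable_affine_hyperplane n.+1 w c.
pose N : set (measurableTypeR R) := [set c 0 0 / w ord0 0].
rewrite (ge0_negligible_integral (N := N) (measurable_set1 _) measurableT
  (measurable_fun_slice mH) _ (lebesgue_measure_set1 _))//.
rewrite integral0_eq// => t [_ /= tc].
rewrite (_ : slice _ t = set0) ?measure0//; apply/seteqP; split => // y.
rewrite /slice /= wE w'0 mulmx0 addr0 => cE; apply: tc.
by rewrite /N /= -cE mxE eqxx mulr1n mulfK.
Qed.

End null_sets.

(** * Convex sets that lie in no affine hyperplane *)

Section nonempty_interior.
Context {R : realType}.

(** The missing weight sits at [x0]. The last point is split off and the other weights are divided
    by [1 - z m]; if [z m = 1] this is impossible, but then the other weights vanish. *)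
Lemma convex_comb n (K : set 'rV[R]_n) x0 (y : nat -> 'rV[R]_n) m (z : nat -> R) :
  convex_row K -> K x0 -> (forall i, K (y i)) -> (forall i, 0 <= z i) ->
  \sum_(i < m) z i <= 1 -> K (x0 + \sum_(i < m) z i *: (y i - x0)).
Proof.
move=> cK Kx0 Ky; elim: m z => [|m IHm] z z0; first by rewrite !big_ord0 addr0.
rewrite !big_ord_recr /= => z1.
have S0 : 0 <= \sum_(i < m) z i by exact: sumr_ge0.
have [zm1|zm1] := leP 1 (z m).
  have zE : z m = 1 by apply/eqP; rewrite eq_le zm1 andbT; lra.
  have Sz : \sum_(i < m) z i = 0 by apply/eqP; rewrite eq_le S0 andbT; lra.
  have zi0 (i : 'I_m) : z i = 0 by exact: (psumr_eq0P _ Sz).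
  by rewrite big1 ?add0r ?zE ?scale1r ?subrKC// => i _; rewrite zi0 scale0r.
have zm1' : 0 < 1 - z m by rewrite subr_gt0.
have := IHm (fun i => z i / (1 - z m)) _ _.
rewrite -mulr_suml ler_pdivrMr// mul1r => /(_ _ _)/(cK _ _ (z m) ^~ (Ky m)) H.
set q := x0 + _ in H.
suff -> : x0 + (\sum_(i < m) z i *: (y i - x0) + z m *: (y m - x0)) = homothety q (z m) (y m).
  apply: H; [by move=> i; rewrite divr_ge0// ltW|lra|].
  by rewrite z0 ltW.
have -> : \sum_(i < m) z i *: (y i - x0) = (1 - z m) *: (q - x0).
  rewrite /q addrAC subrr add0r scaler_sumr; apply: eq_bigr => i _.
  by rewrite scalerA mulrCA mulfV ?mulr1// gt_eqF.
rewrite /homothety; move: q {H} => q; apply/rowP => i; rewrite !mxE; ring.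
Qed.

(** The rank is raised one row at a time. A nonzero column of the cokernel is a linear form
    vanishing on the rows found so far, and some point of [K] has another value of it than [x0]. *)
Lemma convex_row_spans n (K : set 'rV[R]_n) x0 : K x0 ->
  (forall (w : 'cV[R]_n) c, w != 0 -> exists2 x, K x & x *m w != c) ->
  exists2 A : 'M[R]_n, A \in unitmx & forall i, K (row i A + x0).
Proof.
move=> Kx0 Kw.
have H k : (k <= n)%N -> exists2 A : 'M[R]_(k, n), \rank A = k & forall i, K (row i A + x0).
  elim: k => [|k IHk] kn; first by exists 0; [rewrite mxrank0|case].
  have [A rA KA] := IHk (ltnW kn).
  have cA : cokermx A != 0 by rewrite -mxrank_eq0 mxrank_coker subn_eq0 -ltnNge rA.
  have [j cj] : exists j, col j (cokermx A) != 0.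
    apply/existsP; apply: contra_neqT cA => /existsPn c0; apply/matrixP => i j.
    by have := c0 j; rewrite negbK => /eqP/colP/(_ i); rewrite !mxE.
  have [x Kx xw] := Kw _ (x0 *m col j (cokermx A)) cj.
  have nsub : ~~ (x - x0 <= A)%MS.
    apply: contra xw => /submxP[D xD]; rewrite -subr_eq0 -mulmxBl xD -mulmxA.
    by rewrite colE (mulmxA A) mulmx_coker mul0mx mulmx0.
  rewrite -addn1; exists (col_mx A (x - x0)).
    apply/eqP; rewrite eqn_leq rank_leq_row -{1}rA addn1 /=.
    rewrite -addsmxE; apply: rank_ltmx; rewrite ltmxE addsmxSl /=.
    by apply: contra nsub; apply: submx_trans; exact: addsmxSr.
  move=> i; case: (split_ordP i) => j' ->.
    by rewrite rowKu.
  by rewrite rowKd (ord1 j') row_id subrK.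
have [A rA KA] := H n (leqnn n).
by exists A => //; rewrite -row_full_unit /row_full rA.
Qed.

(** [K] contains a nondegenerate simplex, and the interior point is its centroid, with all
    coordinates [e = 1 / (n + 1)]. Moving each coordinate by at most [e ^+ 2 <= e] keeps it
    nonnegative and the sum at most [n (e + e ^+ 2) = 1 - e ^+ 2]. *)
Lemma convex_row_interior n (K : set 'rV[R]_n) : convex_row K -> K !=set0 ->
  (forall (w : 'cV[R]_n) c, w != 0 -> exists2 x, K x & x *m w != c) ->
  K° !=set0.
Proof.
move=> cK [x0 Kx0] Kw; have [A uA KA] := convex_row_spans Kx0 Kw.
pose e : R := n.+1%:R^-1.
have n0 : 0 < n.+1%:R :> R by rewrite ltr0n.
have e0 : 0 < e by rewrite invr_gt0.
have l0 := mx_l1_gt0 (invmx A).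
exists (x0 + const_mx e *m A); apply/nbhs_ballP.
exists (e ^+ 2 / mx_l1 (invmx A)); first by rewrite /= divr_gt0// exprn_gt0.
move=> x /row_ballE[r0 xr].
pose z := (x - x0) *m invmx A.
have zE i : `|z 0 i - e| <= e ^+ 2.
  have -> : z 0 i - e = ((x - (x0 + const_mx e *m A)) *m invmx A) 0 i.
    rewrite opprD addrA mulmxBl (mulmxK uA) [RHS]mxE.
    by congr (_ + _); rewrite !mxE.
  apply: le_trans (mulmx_coord_le _ (r := e ^+ 2 / mx_l1 (invmx A)) _ (ltW r0) i) _.
    move=> k; have /ltW := xr k; rewrite distrC; congr (`|_| <= _).
    by rewrite [RHS]mxE; congr (_ + _); rewrite [RHS]mxE.
  by rewrite mulrCA mulfV ?mulr1// gt_eqF.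
have zi i : 0 <= z 0 i <= e + e ^+ 2.
  have := zE i; rewrite ler_norml => /andP[h1 h2].
  have e1 : e ^+ 2 <= e by rewrite expr2 ler_piMl ?(ltW e0)// invf_le1// ler1n.
  by apply/andP; split; lra.
(* [convex_comb] takes families indexed by all natural numbers; beyond [n] the point is [x0] and the
   weight 0. *)
pose y (i : nat) := if insub i is Some j then row j A + x0 else x0.
pose zz (i : nat) := if insub i is Some j then z 0 j else 0.
have -> : x = x0 + \sum_(i < n) zz i *: (y i - x0).
  rewrite (eq_bigr (fun i => z 0 i *: row i A)); last first.
    by move=> i _; rewrite /zz /y valK addrK.
  by rewrite -mulmx_sum_row /z (mulmxKV uA) subrKC.
apply: convex_comb => //.
- by move=> i; rewrite /y; case: insubP => [j _ _|_].
- by move=> i; rewrite /zz; case: insubP => [j _ _|_] //; case/andP: (zi j).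
apply: (@le_trans _ _ (\sum_(i < n) (e + e ^+ 2))).
  by apply: ler_sum => i _; rewrite /zz valK; case/andP: (zi i).
rewrite sumr_const card_ord -mulr_natl.
have -> : n%:R = e^-1 - 1 by rewrite /e invrK -natr1 addrK.
have -> : (e^-1 - 1) * (e + e ^+ 2) = 1 - e ^+ 2 by field; rewrite gt_eqF.
by rewrite gerBl sqr_ge0.
Qed.

End nonempty_interior.

(** * Lattices and fundamental domains *)

Section lattice.
Context {R : realType} {n : nat}.
Implicit Types (L : set 'rV[R]_n).

Lemma lattice_countable L : full_rank_lattice L -> countable L.
Proof.
move=> [B _ ->]; apply: card_le_trans (card_image_le _ _) _.
exact: countableP.
Qed.

Lemma lattice0 L : full_rank_lattice L -> L 0.
Proof. by move=> [B _ ->]; exists 0 => //; rewrite map_mx0 mul0mx. Qed.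

Lemma latticeD L l l' : full_rank_lattice L -> L l -> L l' -> L (l + l').
Proof.
move=> [B _ ->] [z _ <-] [z' _ <-]; exists (z + z') => //.
by rewrite map_mxD mulmxDl.
Qed.

Lemma latticeN L l : full_rank_lattice L -> L l -> L (- l).
Proof.
move=> [B _ ->] [z _ <-]; exists (- z) => //.
by rewrite map_mxN mulNmx.
Qed.

(** Rounding down the coordinates in a basis leaves a remainder with coordinates between 0 and 1. *)
Lemma lattice_ball_cover L : full_rank_lattice L ->
  exists r : R, forall x, exists2 l, L l & ball 0 r (x - l).
Proof.
move=> [B uB ->]; exists (mx_l1 B + 1) => x.
pose z : 'rV[int]_n := \row_i Num.floor ((x *m invmx B) 0 i).
exists (map_mx intr z *m B); first by exists z.
have l0 := mx_l1_gt0 B.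
apply/row_ballE; split => [|i]; first by rewrite addr_gt0.
rewrite mxE sub0r normrN.
have -> : x - map_mx intr z *m B = (x *m invmx B - map_mx intr z) *m B.
  by rewrite mulmxBl (mulmxKV uB).
apply: le_lt_trans (mulmx_coord_le B (r := 1) _ ler01 i) _; last first.
  by rewrite mulr1 ltrDl.
move=> k; set a := (x *m invmx B) 0 k.
have -> : (x *m invmx B - map_mx intr z) 0 k = a - (Num.floor a)%:~R.
  by rewrite [LHS]mxE; congr (_ + _); rewrite [LHS]mxE; congr (- _); rewrite mxE mxE.
have /andP[h1 h2] := floor_itv a.
by rewrite ger0_norm ?subr_ge0// lerBlDl -intrD1 ltW.
Qed.

End lattice.

(** Disjointness is exact here, whereas a fundamental domain has it up to null sets only. Open sets
    that meet do so in positive measure, so the interior has the exact property. *)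
Definition packing {R : realType} n (L D : set 'rV[R]_n) : Prop :=
  forall x l l', L l -> L l' -> D (x + l) -> D (x + l') -> l = l'.

Definition covering {R : realType} n (L D : set 'rV[R]_n) : Prop :=
  borel_lebesgue n [set x | forall l, L l -> ~ D (x - l)] = 0%E.

Section fundamental.
Context {R : realType} {n : nat}.
Implicit Types (L K : set 'rV[R]_n).

Lemma translateE l K x : translate l K x <-> K (x - l).
Proof.
split; first by move=> [y Ky <-]; rewrite addrK.
by move=> Kx; exists (x - l); rewrite ?subrK.
Qed.

Lemma measurable_uncovered L K : countable L -> measurable K ->
  measurable [set x | forall l, L l -> ~ K (x - l)].
Proof.
move=> /countable_injP[f finj] mK.
rewrite (_ : [set x | _] = \bigcap_k ~` [set x | exists l, [/\ L l, f l = k & K (x - l)]]).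
  apply: bigcapT_measurable => k; apply: measurableC.
  have [[l Ll <-]|nk] := pselect (exists2 l, L l & f l = k).
    rewrite (_ : [set x | _] = [set x | K (x - l)]); first exact: measurable_translate.
    apply/seteqP; split => x /=; last by exists l.
    by move=> [l' [Ll' /finj ->]] //; rewrite inE.
  rewrite (_ : [set x | _] = set0)//.
  by apply/seteqP; split => // x [l [Ll lk _]]; apply: nk; exists l.
apply/seteqP; split => x /= H; first by move=> k _ [l [Ll _]]; exact: H.
by move=> l Ll Kx; apply: (H (f l) I); exists l.
Qed.

Lemma open_translate (l : 'rV[R]_n) (A : set 'rV[R]_n) :
  open A -> open [set y : 'rV[R]_n | A (y + l)].
Proof.
move=> oA; apply: (@open_comp _ _ (fun y : 'rV[R]_n => y + l) A _ oA) => y _.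
have h1 : {for y, continuous (fun x : 'rV[R]_n => x)} by exact: cvg_id.
have h2 : {for y, continuous (fun x : 'rV[R]_n => l)} by exact: cst_continuous.
exact: (continuousD h1 h2).
Qed.

Lemma lebesgue_setT_neq0 : lebesgue n [set: 'rV[R]_n] <> 0%E.
Proof.
rewrite lebesgueE// => T0.
have := @borel_lebesgue_open_gt0 R n setT openT (ex_intro _ 0 Logic.I).
by rewrite T0 ltxx.
Qed.

Section with_domain.
Variables (L K : set 'rV[R]_n).
Hypotheses (latL : full_rank_lattice L) (cK : convex_row K)
  (fundK : fundamental_domain L K).

Let uncovered0 : lebesgue n [set x | forall l, L l -> ~ K (x - l)] = 0%E.
Proof.
have [_ [T0 _]] := fundK; move: T0; congr (lebesgue n _ = _).
apply/seteqP; split => x /=.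
  by move=> [_ nx] l Ll Kx; apply: nx; exists l => //; apply/translateE.
by move=> nx; split => // -[l Ll /translateE]; exact: nx.
Qed.

(** Otherwise [K] would be empty or lie in an affine hyperplane; the null set left uncovered and
    countably many null translates would then exhaust the space. *)
Lemma fundamental_interior_nonempty : K° !=set0.
Proof.
apply: convex_row_interior => //.
  apply: contrapT => K0; apply: lebesgue_setT_neq0.
  apply: lebesgue_null_sub uncovered0 => x _ l _ Kx.
  by apply: K0; exists (x - l).
move=> w c w0; apply: contrapT => Kw; apply: lebesgue_setT_neq0.
have Kc x : K x -> x *m w = c.
  by move=> Kx; apply: contrapT => /eqP xc; apply: Kw; exists x.
apply: (@lebesgue_null_sub _ _ _ ([set x | forall l, L l -> ~ K (x - l)] `|`
   \bigcup_(l in L) [set x | x *m w = c + l *m w])).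
  move=> x _; have [[l Ll Kx]|nx] := pselect (exists2 l, L l & K (x - l)).
    by right; exists l => //=; rewrite -(Kc _ Kx) mulmxBl subrK.
  by left => l Ll Kx; apply: nx; exists l.
apply: lebesgue_null_setU => //.
apply: lebesgue_null_bigcup; first exact: lattice_countable.
move=> l Ll; rewrite lebesgueE; last exact: measurable_affine_hyperplane.
exact: borel_lebesgue_hyperplane.
Qed.

Lemma fundamental_interior_packing : packing L K°.
Proof.
move=> x l l' Ll Ll' Ux Ux'; apply: contrapT => ll'.
pose W : set 'rV[R]_n := [set y : 'rV[R]_n | K° (y + l)] `&` [set y : 'rV[R]_n | K° (y + l')].
have oW : open W.
  by apply: openI; apply: open_translate; exact: open_interior.
have : (0 < borel_lebesgue n W)%E.
  by apply: borel_lebesgue_open_gt0 oW _; exists x; split.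
rewrite -lebesgueE; last exact: open_measurable_row.
suff -> : lebesgue n W = 0%E by rewrite ltxx.
have [_ [_ T0]] := fundK.
have nll' : - l != - l' by apply/eqP => /oppr_inj.
apply: lebesgue_null_sub (T0 _ _ (latticeN latL Ll) (latticeN latL Ll') nll').
move=> y [/interior_subset y1 /interior_subset y2].
by split; apply/translateE; rewrite opprK.
Qed.

(** A packing has at most the measure of any covering, and some cube covers. *)
Lemma lattice_packing_finite (D : set 'rV[R]_n) : measurable D ->
  packing L D -> (borel_lebesgue n D < +oo)%E.
Proof.
move=> mD pD; have [r rP] := lattice_ball_cover latL.
apply: (@le_lt_trans _ _ (borel_lebesgue n (ball (0 : 'rV[R]_n) r))).
  apply: (packing_le_covering_measure (lattice_countable latL)) => //.
    exact: measurable_row_ball.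
  rewrite (_ : [set x | _] = set0) ?measure0//; apply/seteqP; split => // x nx.
  by have [l Ll xl] := rP x; exact: nx xl.
by apply: borel_lebesgue_bounded; [exact: measurable_row_ball|exists r].
Qed.

Lemma fundamental_interior_finite : (borel_lebesgue n K° < +oo)%E.
Proof.
apply: lattice_packing_finite; last exact: fundamental_interior_packing.
apply: open_measurable_row; exact: open_interior.
Qed.

Lemma fundamental_interior_bounded : bounded_row K°.
Proof.
apply: convex_row_bounded; [exact: open_interior|exact: convex_interior|].
exact: fundamental_interior_finite.
Qed.

(** The part of [K] outside its interior may not be Borel; the radial hull of the interior about an
    interior point provides a Borel null set around it. *)
Lemma fundamental_boundary_null : exists Z : set 'rV[R]_n,
  [/\ measurable Z, borel_lebesgue n Z = 0%E & K `\` K° `<=` Z].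
Proof.
have [p Up] := fundamental_interior_nonempty.
have mU : measurable (K° : set 'rV[R]_n) by apply: open_measurable_row; exact: open_interior.
exists (radial_hull p K° `\` K°); split.
- by apply: measurableD => //; exact: measurable_radial_hull.
- apply: radial_hull_null => //; first exact: convex_interior.
  exact: fundamental_interior_finite.
- move=> x [Kx nUx]; split => //; apply: (sub_radial_hull (K := K)) => //.
  by move=> y s Ky s01; exact: homothety_interior.
Qed.

Lemma fundamental_interior_covering : covering L K°.
Proof.
have mU : measurable (K° : set 'rV[R]_n) by apply: open_measurable_row; exact: open_interior.
have [Z [mZ Z0 KZ]] := fundamental_boundary_null.
rewrite /covering -lebesgueE; last first.
  by apply: measurable_uncovered => //; exact: lattice_countable.
apply: (@lebesgue_null_sub _ _ _ ([set x | forall l, L l -> ~ K (x - l)] `|`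
   \bigcup_(l in L) [set x | Z (x - l)])).
  move=> x nU; have [[l Ll Kx]|nx] := pselect (exists2 l, L l & K (x - l)).
    by right; exists l => //=; apply: KZ; split => //; exact: nU.
  by left => l Ll Kx; apply: nx; exists l.
apply: lebesgue_null_setU => //.
apply: lebesgue_null_bigcup; first exact: lattice_countable.
move=> l Ll; rewrite lebesgueE; last exact: measurable_translate.
by rewrite -Z0; exact: borel_lebesgue_translate.
Qed.

End with_domain.

(** A translate of [U] packs and covers as [U] does, so [packing_le_covering] applies in both
    directions. *)
Lemma ge0_integral_periodic_translate (L U : set 'rV[R]_n) (g : 'rV[R]_n -> \bar R) v :
  full_rank_lattice L -> measurable U -> packing L U -> covering L U ->
  measurable_fun setT g -> (forall x, 0 <= g x)%E ->
  (forall x l, L l -> g (x + l) = g x) ->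
  (\int[borel_lebesgue n]_(x in U) g (x + v)%R = \int[borel_lebesgue n]_(x in U) g x)%E.
Proof.
move=> latL mU pU cU mg g0 gper.
have cL := lattice_countable latL.
pose V := [set x | U (x - v)].
have mV : measurable V by exact: measurable_translate.
have -> : (\int[borel_lebesgue n]_(x in U) g (x + v)%R =
           \int[borel_lebesgue n]_(x in V) g x)%E.
  rewrite -(ge0_integral_translate_set v mV mg g0).
  by congr (integral _ _ _); apply/seteqP; split => x; rewrite /V/= addrK.
apply/eqP; rewrite eq_le; apply/andP; split.
  apply: (packing_le_covering cL) => // x l l' Ll Ll' V1 V2.
  by apply: (pU (x - v)) => //; rewrite addrAC.
apply: (packing_le_covering cL) => //.
rewrite -[RHS]cU -[RHS](borel_lebesgue_translate (- v)); last exact: measurable_uncovered.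
congr (borel_lebesgue n _); apply/seteqP; split => x /= H l Ll; rewrite /V/=.
  by rewrite addrAC; exact: H.
by rewrite addrAC; exact: H.
Qed.

End fundamental.

(** * From the completed measure to the Borel measure *)

Section lebesgue_integral.
Context {R : realType} {n : nat}.
Implicit Types (K U : set 'rV[R]_n).

Lemma borel_lebesgue_measurable (A : set 'rV[R]_n) : measurable A ->
  lebesgue_measurable A.
Proof. exact: caratheodory_measurable_mu_ext. Qed.

Let cT := caratheodory_type (mu_ext (@borel_lebesgue R n)).

(** The pushforward of the completed measure by this map is the Borel measure, which is how
    integrals pass from one to the other. *)
Lemma measurable_lebesgue_id :
  measurable_fun setT (id : cT -> 'rV[R]_n).
Proof. by move=> _ A mA; rewrite setTI; exact: borel_lebesgue_measurable. Qed.

Lemma ge0_integral_lebesgue U (f : 'rV[R]_n -> \bar R) :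
  measurable U -> measurable_fun setT f -> (forall x, 0 <= f x)%E ->
  (\int[lebesgue n]_(x in U) f x = \int[borel_lebesgue n]_(x in U) f x)%E.
Proof.
move=> mU mf f0.
have mid := measurable_lebesgue_id.
transitivity (\int[pushforward (lebesgue n) (id : cT -> 'rV[R]_n)]_(x in U) f x)%E.
  rewrite [RHS]ge0_integral_pushforward//; exact: measurable_funTS.
by apply: eq_measure_integral => A mA _; exact: lebesgueE.
Qed.

Lemma ge0_integral_lebesgue_sub K U (f : 'rV[R]_n -> \bar R) :
  lebesgue_measurable K -> measurable U -> U `<=` K -> lebesgue n (K `\` U) = 0%E ->
  measurable_fun setT f -> (forall x, 0 <= f x)%E ->
  (\int[lebesgue n]_(x in K) f x = \int[borel_lebesgue n]_(x in U) f x)%E.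
Proof.
move=> mK mU UK KU0 mf f0.
have mU' := borel_lebesgue_measurable mU.
have mf' : measurable_fun setT (f : cT -> \bar R).
  exact: (measurableT_comp mf measurable_lebesgue_id).
rewrite -ge0_integral_lebesgue//.
rewrite (@ge0_negligible_integral _ cT _ (lebesgue n) K (K `\` U)) //.
- by rewrite setDD setIidr.
- exact: (@measurableD _ cT).
- exact: measurable_funTS.
Qed.

Lemma integral_lebesgue_sub K U (f : 'rV[R]_n -> \bar R) :
  lebesgue_measurable K -> measurable U -> U `<=` K -> lebesgue n (K `\` U) = 0%E ->
  measurable_fun setT f ->
  (\int[lebesgue n]_(x in K) f x = \int[borel_lebesgue n]_(x in U) f x)%E.
Proof.
move=> mK mU UK KU0 mf; rewrite integralE [RHS]integralE.
congr (_ - _)%E; apply: ge0_integral_lebesgue_sub => //.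
- exact: measurable_funepos.
- exact: measurable_funeneg.
Qed.

Lemma continuous_bounded_row U (f : 'rV[R]_n -> R) :
  bounded_row U -> continuous f -> exists M, forall x, U x -> `|f x| <= M.
Proof.
move=> [r Ur] cf.
pose C : set 'rV[R]_n := [set x | forall i, `[- r, r]%classic (x 0 i)].
have cC : compact C.
  by apply: (@rV_compact R n (fun=> `[- r, r]%classic)) => i; exact: segment_compact.
have : compact (f @` C).
  by apply: continuous_compact => //; exact: continuous_subspaceT.
move=> /compact_bounded[M [_ HM]]; exists (M + 1) => x Ux.
apply: (HM (M + 1)); first by rewrite ltrDl.
exists x => // i /=; rewrite in_itv/= -ler_norml.
by have /row_ballE[_ /(_ i)] := Ur _ Ux; rewrite mxE sub0r normrN => /ltW.
Qed.

Lemma bounded_continuous_integrable U (f : 'rV[R]_n -> R) :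
  measurable U -> bounded_row U -> continuous f ->
  (borel_lebesgue n).-integrable U (EFin \o f).
Proof.
move=> mU bU cf; have [M HM] := continuous_bounded_row bU cf.
apply: measurable_bounded_integrable => //.
- by apply: borel_lebesgue_bounded.
- by apply: measurable_funTS; exact: continuous_measurable_row.
- exists M; split; first exact: num_real.
  by move=> y My x Ux; apply: le_trans (HM _ Ux) (ltW My).
Qed.

Lemma Rintegral_sum_continuous U (I : finType) (F : I -> 'rV[R]_n -> R) :
  measurable U -> bounded_row U -> (forall i, continuous (F i)) ->
  \int[borel_lebesgue n]_(x in U) (\sum_i F i x) =
  \sum_i \int[borel_lebesgue n]_(x in U) F i x.
Proof.
move=> mU bU cF.
have iU := bounded_continuous_integrable mU bU.
have H (s : seq I) : (borel_lebesgue n).-integrable U (EFin \o (fun x => \sum_(i <- s) F i x)) /\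
   \int[borel_lebesgue n]_(x in U) (\sum_(i <- s) F i x) =
   \sum_(i <- s) \int[borel_lebesgue n]_(x in U) F i x.
  elim: s => [|i s [IH1 IH2]].
    rewrite big_nil; under [X in EFin \o X]eq_fun do rewrite big_nil.
    split; first by apply: iU; exact: cst_continuous.
    under eq_Rintegral do rewrite big_nil.
    by rewrite Rintegral_cst// mul0r.
  under [X in EFin \o X]eq_fun do rewrite big_cons.
  split.
    have := integrableD mU (iU _ (cF i)) IH1.
    by apply: eq_integrable.
  rewrite big_cons -IH2 -RintegralD//; last exact: iU.
  by apply: eq_Rintegral => x _; rewrite big_cons.
by have [_ ->] := H (index_enum I).
Qed.

End lebesgue_integral.

(** * The lower bound on the variance *)

Section dotv_theory.
Context {R : realType} {n : nat}.
Implicit Types x y z : 'rV[R]_n.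

Lemma dotvC x y : dotv x y = dotv y x.
Proof. by apply: eq_bigr => i _; rewrite mulrC. Qed.

Lemma dotvDl x y z : dotv (x + y) z = dotv x z + dotv y z.
Proof. by rewrite /dotv -big_split; apply: eq_bigr => i _; rewrite mxE mulrDl. Qed.

Lemma dotvZl a x z : dotv (a *: x) z = a * dotv x z.
Proof. by rewrite /dotv mulr_sumr; apply: eq_bigr => i _; rewrite mxE mulrA. Qed.

Lemma dotvNl x z : dotv (- x) z = - dotv x z.
Proof. by rewrite -scaleN1r dotvZl mulN1r. Qed.

Lemma dotvDr x y z : dotv x (y + z) = dotv x y + dotv x z.
Proof. by rewrite dotvC dotvDl !(dotvC x). Qed.

Lemma dotvZr a x z : dotv x (a *: z) = a * dotv x z.
Proof. by rewrite dotvC dotvZl dotvC. Qed.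

Lemma dotvNr x z : dotv x (- z) = - dotv x z.
Proof. by rewrite dotvC dotvNl dotvC. Qed.

Lemma dotvE x y : dotv x y = (x *m y^T) 0 0.
Proof. by rewrite /dotv mxE; apply: eq_bigr => i _; rewrite mxE. Qed.

Lemma dotv0l x : dotv 0 x = 0.
Proof. by rewrite -(scale0r x) dotvZl mul0r. Qed.

Lemma dotv_delta x i : dotv (delta_mx 0 i) x = x 0 i.
Proof.
rewrite /dotv (bigD1 i)//= big1 ?addr0 ?mxE ?eqxx ?mul1r// => j ji.
by rewrite mxE (negbTE ji) andbF mul0r.
Qed.

Lemma dotv_ge0 x : 0 <= dotv x x.
Proof. by apply: sumr_ge0 => i _; rewrite -expr2 sqr_ge0. Qed.

Lemma dotv_eq0 x : (dotv x x == 0) = (x == 0).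
Proof.
apply/idP/eqP => [|->]; last by rewrite dotvE mul0mx mxE.
rewrite psumr_eq0 => [/allP x0|i _]; last by rewrite -expr2 sqr_ge0.
apply/rowP => i; have := x0 i; rewrite mem_index_enum => /(_ isT).
by rewrite mxE mulf_eq0 orbb => /eqP.
Qed.

Lemma dotv_gt0 x : x != 0 -> 0 < dotv x x.
Proof. by move=> x0; rewrite lt_def dotv_eq0 x0 dotv_ge0. Qed.

Lemma enorm_sqr x : enorm x ^+ 2 = dotv x x.
Proof. by rewrite /enorm sqr_sqrtr// dotv_ge0. Qed.

Lemma enorm_ge0 x : 0 <= enorm x.
Proof. exact: sqrtr_ge0. Qed.

Lemma enorm_gt0 x : x != 0 -> 0 < enorm x.
Proof. by move=> x0; rewrite sqrtr_gt0 dotv_gt0. Qed.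

Lemma dotv_CauchySchwarz x y : dotv x y ^+ 2 <= dotv x x * dotv y y.
Proof.
have [->|y0] := eqVneq y 0.
  by rewrite dotvE trmx0 mulmx0 mxE expr0n/= mulr_ge0 ?dotv_ge0.
have yy := dotv_gt0 y0.
have := dotv_ge0 (dotv y y *: x - dotv x y *: y).
rewrite dotvDl !dotvDr !dotvNr !dotvNl !dotvZl !dotvZr (dotvC y x).
set a := dotv x x; set b := dotv x y; set c := dotv y y.
rewrite (_ : _ + _ = c * (a * c - b ^+ 2)); last by ring.
by rewrite pmulr_rge0// subr_ge0.
Qed.

Lemma continuous_dotv y : continuous (fun x => dotv x y).
Proof.
move=> x; have -> : (fun x => dotv x y) = (fun x => (x *m y^T) 0 0).
  by apply/funext => z; rewrite dotvE.
apply: (@continuous_comp _ _ _ (fun x => x *m y^T) (fun M : 'M[R]_1 => M 0 0)).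
  exact: continuous_mulmxr.
exact: coord_continuous.
Qed.

End dotv_theory.

(** * The squared distance to the nearest integer *)

Section sawtooth.
Context {R : realType}.
Implicit Types u : R.

Definition sqdist_int u : R := (u - (Num.floor (u + 1 / 2))%:~R) ^+ 2.

Lemma sqdist_int_unique u (k : int) : - (1 / 2) <= u - k%:~R < 1 / 2 ->
  sqdist_int u = (u - k%:~R) ^+ 2.
Proof.
move=> /andP[h1 h2]; rewrite /sqdist_int (@floor_def _ _ k)//.
by rewrite intrD1; apply/andP; split; lra.
Qed.

Lemma sqdist_int_ge0 u : 0 <= sqdist_int u.
Proof. exact: sqr_ge0. Qed.

Lemma nearest_int u : exists k : int, - (1 / 2) <= u - k%:~R < 1 / 2.
Proof.
exists (Num.floor (u + 1 / 2)); have /andP[] := floor_itv (u + 1 / 2).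
by rewrite intrD1 => h1 h2; apply/andP; split; lra.
Qed.

Lemma sqdist_int_le u : sqdist_int u <= 1 / 4.
Proof.
have [k ku] := nearest_int u; rewrite (sqdist_int_unique ku).
by case/andP: ku => h1 h2; nra.
Qed.

Lemma sqdist_int_period u (k : int) : sqdist_int (u + k%:~R) = sqdist_int u.
Proof.
have [m mu] := nearest_int u; rewrite (sqdist_int_unique mu).
rewrite (@sqdist_int_unique _ (m + k)) intrD ?opprD.
  by congr (_ ^+ 2); ring.
by move: mu => /andP[h1 h2]; apply/andP; split; lra.
Qed.

Lemma sqdist_int_le_sqr u : sqdist_int u <= u ^+ 2.
Proof.
have [k ku] := nearest_int u; rewrite (sqdist_int_unique ku).
move: ku => /andP[h1 h2].
have [k0|k0|->] := ltgtP k 0; last by rewrite subr0.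
- have : k%:~R <= (-1)%:~R :> R by rewrite ler_int -ltzD1 addNr.
  rewrite intrN.
  by move=> k1; nra.
- have : 1 <= k%:~R :> R by rewrite ler1z -gtz0_ge1.
  by move=> k1; nra.
Qed.

(** Let [d] be the distance from [u] to the integers. Then [1 / 2 - d] is that of [u + 1 / 2], and
    twice the distance from [d] to [1 / 4] is that of [2 u + 1 / 2]. The identity is [d^2 + (1 / 2 -
    d)^2 = 2 (d - 1 / 4)^2 + 1 / 8]. *)
Lemma sqdist_int_double u :
  sqdist_int u + sqdist_int (u + 1 / 2) = sqdist_int (2 * u + 1 / 2) / 2 + 1 / 8.
Proof.
have [k ku] := nearest_int u; rewrite (sqdist_int_unique ku).
move: ku => /andP[h1 h2].
have [r0|r0] := leP 0 (u - k%:~R).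
  rewrite (@sqdist_int_unique _ (k + 1)) ?intrD1; last by apply/andP; split; lra.
  rewrite (@sqdist_int_unique _ (2 * k + 1)) ?intrD1 ?intrM; last by apply/andP; split; lra.
  by rewrite (_ : 2%:~R = 2 :> R)//; field.
rewrite (@sqdist_int_unique _ k); last by apply/andP; split; lra.
rewrite (@sqdist_int_unique _ (2 * k)) ?intrM; last by apply/andP; split; lra.
by rewrite (_ : 2%:~R = 2 :> R)//; field.
Qed.

Lemma measurable_sqdist_int : measurable_fun setT (sqdist_int : R -> R).
Proof.
apply: measurable_funX; apply: measurable_funB => //.
apply: nondecreasing_measurable => // u v uv.
by rewrite ler_int; apply: le_floor; rewrite lerD2r.
Qed.

End sawtooth.

(** * Equidistribution modulo 1 along a dual vector *)

Section period_domain.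
Context {R : realType} {n : nat} (L U : set 'rV[R]_n).
Hypotheses (latL : full_rank_lattice L) (mU : measurable U)
  (bU : bounded_row U) (pU : packing L U) (cU : covering L U).

Lemma integral_periodic_translate (g : 'rV[R]_n -> \bar R) v :
  measurable_fun setT g -> (forall x l, L l -> g (x + l) = g x) ->
  (\int[borel_lebesgue n]_(x in U) g (x + v)%R = \int[borel_lebesgue n]_(x in U) g x)%E.
Proof.
move=> mg gper; rewrite integralE [RHS]integralE; congr (_ - _)%E.
  transitivity (\int[borel_lebesgue n]_(x in U) (g^\+ (x + v)%R))%E.
    by apply: eq_integral => x _; rewrite !funeposE.
  apply: (ge0_integral_periodic_translate v latL mU pU cU).
  - exact: measurable_funepos.
  - by move=> x; exact: funepos_ge0.
  - by move=> x l Ll; rewrite !funeposE gper.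
transitivity (\int[borel_lebesgue n]_(x in U) (g^\- (x + v)%R))%E.
  by apply: eq_integral => x _; rewrite !funenegE.
apply: (ge0_integral_periodic_translate v latL mU pU cU).
- exact: measurable_funeneg.
- by move=> x; exact: funeneg_ge0.
- by move=> x l Ll; rewrite !funenegE gper.
Qed.

Lemma Rintegral_periodic_translate (g : 'rV[R]_n -> R) v :
  measurable_fun setT g -> (forall x l, L l -> g (x + l) = g x) ->
  \int[borel_lebesgue n]_(x in U) g (x + v) = \int[borel_lebesgue n]_(x in U) g x.
Proof.
move=> mg gper; congr fine.
apply: (integral_periodic_translate (g := EFin \o g)).
  exact/measurable_EFinP.
by move=> x l Ll /=; rewrite gper.
Qed.

Lemma period_domain_finite : (borel_lebesgue n U < +oo)%E.
Proof. exact: borel_lebesgue_bounded. Qed.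

Let c := fine (borel_lebesgue n U).

Lemma bounded_integrable (f : 'rV[R]_n -> R) M : measurable_fun setT f ->
  (forall x, `|f x| <= M) -> (borel_lebesgue n).-integrable U (EFin \o f).
Proof.
move=> mf fM; apply: measurable_bounded_integrable => //.
- exact: period_domain_finite.
- exact: measurable_funTS.
- exists M; split; first exact: num_real.
  by move=> y My x Ux; apply: le_trans (fM _) (ltW My).
Qed.

Section dual_vector.
Variable xi : 'rV[R]_n.
Hypotheses (Lxi : dual_lattice L xi) (xi0 : xi != 0).

Let q (k : nat) (a : R) (x : 'rV[R]_n) := sqdist_int (k%:R * dotv x xi + a).
Let E k a := \int[borel_lebesgue n]_(x in U) q k a x.

Let mq k a : measurable_fun setT (q k a).
Proof.
apply: (measurableT_comp measurable_sqdist_int); apply: measurable_funD => //.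
apply: measurable_funM => //; apply: continuous_measurable_row.
exact: continuous_dotv.
Qed.

Let iq k a : (borel_lebesgue n).-integrable U (EFin \o q k a).
Proof.
apply: (bounded_integrable (M := 1 / 4) (mq k a)) => x.
by rewrite ger0_norm ?sqdist_int_ge0 ?sqdist_int_le.
Qed.

Let qper k a x l : L l -> q k a (x + l) = q k a x.
Proof.
move=> Ll; have /intrP[z zE] := Lxi Ll.
rewrite /q dotvDl (dotvC l) zE mulrDr addrAC.
have -> : k%:R * z%:~R = (k%:Z * z)%:~R :> R by rewrite intrM.
exact: sqdist_int_period.
Qed.

(** A translation along [xi] changes the phase by any prescribed amount, and does not change the
    integral of a periodic function over [U]. *)
Let Eshift k a : (0 < k)%N -> E k a = E k 0.
Proof.
move=> k0; rewrite /E -[RHS](Rintegral_periodic_translate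
  ((a / (k%:R * dotv xi xi)) *: xi) (mq k 0) (@qper k 0)).
apply: eq_Rintegral => x _; rewrite /q dotvDl dotvZl addr0 mulrDr; congr sqdist_int.
congr (_ + _); field; rewrite pnatr_eq0 -lt0n k0/=.
by rewrite gt_eqF// dotv_gt0.
Qed.

(* Equidistribution of [k * dotv x xi] under translations makes both phases of
   [sqdist_int_double] contribute equally. *)
Let Edouble k : (0 < k)%N -> E k 0 = E (2 * k) 0 / 4 + c / 16.
Proof.
move=> k0.
have : E k 0 + E k (1 / 2) = E (2 * k) (1 / 2) / 2 + c / 8.
  have iq2 : (borel_lebesgue n).-integrable U (EFin \o (fun x => q (2 * k) (1 / 2) x / 2)).
    apply: (bounded_integrable (M := 1 / 4)); first by apply: measurable_funM.
    move=> x; have := sqdist_int_le ((2 * k)%:R * dotv x xi + 1 / 2).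
    have := sqdist_int_ge0 ((2 * k)%:R * dotv x xi + 1 / 2).
    by rewrite /q => ? ?; rewrite ger0_norm; lra.
  have ic : (borel_lebesgue n).-integrable U (EFin \o (fun=> 1 / 8 : R)).
    by apply: (bounded_integrable (M := 1 / 8)) => // x; rewrite ger0_norm//; lra.
  rewrite /E -RintegralD// -RintegralZr// -[c / 8]mulrC.
  rewrite (_ : 8^-1 * c = \int[borel_lebesgue n]_(x in U) (1 / 8)); last first.
    by rewrite Rintegral_cst// div1r.
  rewrite -RintegralD//; apply: eq_Rintegral => x _.
  rewrite /q addr0 natrM sqdist_int_double.
  by rewrite [2 * (_ * _)]mulrA.
rewrite (Eshift _ k0) Eshift ?muln_gt0// => h.
lra.
Qed.

(* By [Edouble] the defect [E k 0 - c / 12] is divided by [4] when [k] is halved,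
   while [E k 0] stays bounded; hence [E 1 0 = c / 12]. *)
Lemma variance_dual_ge :
  c / 12 <= \int[borel_lebesgue n]_(x in U) (dotv x xi ^+ 2).
Proof.
have E0 k : 0 <= E k 0 by apply: Rintegral_ge0 => x _; exact: sqdist_int_ge0.
apply: (@le_trans _ _ (E 1 0)).
  rewrite leNgt; apply/negP => lt.
  have H m : E 1 0 - c / 12 = (E (2 ^ m) 0 - c / 12) / 4 ^+ m.
    elim: m => [|m ->]; first by rewrite expn0 expr0 divr1.
    rewrite (Edouble (k := 2 ^ m)) ?expn_gt0// -expnS exprS.
    by field; rewrite expf_neq0.
  have d0 : 0 < c / 12 - E 1 0 by lra.
  have B m : m%:R * (c / 12 - E 1 0) <= c / 12.
    have := H m; have := E0 (2 ^ m)%N => Em Hm.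
    have p0 : 0 < 4 ^+ m :> R by rewrite exprn_gt0.
    have m4 : m%:R <= 4 ^+ m :> R.
      by rewrite -natrX ler_nat ltnW// ltn_expl.
    have : 4 ^+ m * (c / 12 - E 1 0) <= c / 12.
      rewrite -opprB Hm mulrN mulrCA mulfV ?gt_eqF// mulr1; lra.
    apply: le_trans; rewrite ler_wpM2r// ltW//.
  have := B (Num.truncn (c / 12 / (c / 12 - E 1 0))).+1.
  rewrite leNgt -ltr_pdivrMr// => /negP; apply.
  exact: truncnS_gt.
apply: le_Rintegral => //.
- apply: bounded_continuous_integrable => //.
  move=> x; apply: (@continuous_comp _ _ _ (fun x => dotv x xi) (fun u => u ^+ 2)).
    exact: continuous_dotv.
  exact: exprn_continuous.
- by move=> x _; rewrite /q mul1r addr0 sqdist_int_le_sqr.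
Qed.

End dual_vector.
End period_domain.

(** * The Brunn-Minkowski inequality *)

Section brunn_minkowski_1d.
Context {R : realType}.
Local Notation mu := (@lebesgue_measure R).

Lemma measurable_affine_preimage (k c : R) (A : set (measurableTypeR R)) :
  measurable A -> measurable [set x : measurableTypeR R | A (k * x + c)].
Proof.
move=> mA; have mf : measurable_fun setT (fun x : measurableTypeR R => k * x + c : measurableTypeR R).
  by apply: measurable_funD => //; exact: measurable_funM.
by rewrite -[X in measurable X]setTI; exact: mf.
Qed.

Lemma lebesgue_measure_affine (k c : R) (A : set (measurableTypeR R)) :
  0 < k -> measurable A ->
  (lebesgue_measure A = k%:E * lebesgue_measure [set x : measurableTypeR R | A (k * x + c)%R])%E.
Proof.
move=> k0 mA; pose f (x : measurableTypeR R) : measurableTypeR R := k * x + c.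
have mf : measurable_fun setT f.
  by apply: measurable_funD => //; exact: measurable_funM.
pose m := mscale (NngNum (ltW k0)) (pushforward lebesgue_measure f).
transitivity (m mf A); last by [].
apply: (@lebesgue_measure_unique R (m mf)) => // _ [[a b]] _ <-.
pose I : set (measurableTypeR R) := `](a - c) / k, (b - c) / k]%classic.
rewrite [RHS](_ : _ = (k%:E * lebesgue_measure I)%E); last first.
  rewrite /m /mscale /pushforward; congr (_ * lebesgue_measure _)%E.
  by apply/seteqP; split => x; rewrite /I /f /= !in_itv/= ltr_pdivrMr// ler_pdivlMr// mulrC ltrBlDr lerBrDr.
rewrite /I !lebesgue_measure_itv/= !lte_fin ltr_pM2r ?invr_gt0// ltrD2r.
case: ifP => _; last by rewrite mule0.
by rewrite -!EFinB -EFinM; congr EFin; field; rewrite gt_eqF.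
Qed.

(* Split [A] near its supremum and [B] near its infimum: up to null overlap the
   interpolation then contains a translate of [(1 - s) A] followed by one of
   [s B]. *)
Lemma brunn_minkowski_1d (A B C : set (measurableTypeR R)) M s :
  measurable A -> measurable B -> measurable C ->
  A !=set0 -> B !=set0 ->
  (forall x, A x -> `|x| <= M) -> (forall x, B x -> `|x| <= M) ->
  0 < s < 1 -> (forall a b, A a -> B b -> C ((1 - s) * a + s * b)) ->
  ((1 - s)%:E * mu A + s%:E * mu B <= mu C)%E.
Proof.
move=> mA mB mC A0 B0 AM BM /andP[s0 s1] ABC.
have s1' : 0 < 1 - s by rewrite subr_gt0.
apply/lee_addgt0Pr => e e0.
have supA : has_sup A by split => //; exists M => x /AM; rewrite ler_norml => /andP[].
have infB : has_inf B by split => //; exists (- M) => x /BM; rewrite ler_norml => /andP[].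
have [a0 Aa0 a0s] := sup_adherent e0 supA.
have [b0 Bb0 b0i] := inf_adherent e0 infB.
(* Each truncation loses measure at most [e], and the weights [1 - s] and [s] make the total loss at
   most [e]. The open end at [b0] makes the images [S1] and [S2] disjoint: they lie on either side
   of [(1 - s) a0 + s b0]. *)
pose A' : set (measurableTypeR R) := A `&` [set` `]-oo, a0]].
pose B' : set (measurableTypeR R) := B `&` [set` `]b0, +oo[].
have mA' : measurable A' by exact: measurableI.
have mB' : measurable B' by exact: measurableI.
have AA' : (mu A <= mu A' + e%:E)%E.
  apply: (@le_trans _ _ (mu (A' `|` `]a0, a0 + e]%classic))).
    apply: le_measure; rewrite ?inE//; first exact: measurableU.
    move=> x Ax; have [xa|xa] := leP x a0; first by left; split => //=; rewrite in_itv.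
    right; rewrite /= in_itv/= xa/=.
    have := ub_le_sup supA.2 Ax; lra.
  apply: le_trans; first by apply: measureU2.
  apply: leeD => //.
  have le1 : (mu `]a0, (a0 + e)%R]%classic <= e%:E)%E.
    by rewrite lebesgue_measure_itv/= lte_fin ltrDl e0 -EFinB addrAC subrr add0r.
  exact: le1.
have BB' : (mu B <= mu B' + e%:E)%E.
  apply: (@le_trans _ _ (mu (B' `|` `[b0 - e, b0]%classic))).
    apply: le_measure; rewrite ?inE//; first exact: measurableU.
    move=> x Bx; have [xb|xb] := ltP b0 x; first by left; split => //=; rewrite in_itv/= xb.
    right; rewrite /= in_itv/= xb andbT.
    have := ge_inf infB.2 Bx; lra.
  apply: le_trans; first by apply: measureU2.
  apply: leeD => //.
  have le1 : (mu `[(b0 - e)%R, b0]%classic <= e%:E)%E.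
    by rewrite lebesgue_measure_itv/= lte_fin gtrBl e0 -EFinB opprB addrC subrK.
  exact: le1.
pose S1 : set (measurableTypeR R) := [set x | A' ((1 - s)^-1 * x - s * b0 / (1 - s))].
pose S2 : set (measurableTypeR R) := [set x | B' (s^-1 * x - (1 - s) * a0 / s)].
have mS1 : measurable S1 by exact: measurable_affine_preimage.
have mS2 : measurable S2 by exact: measurable_affine_preimage.
have muS1 : (mu S1 = (1 - s)%:E * mu A')%E.
  rewrite (@lebesgue_measure_affine (1 - s)^-1 (- (s * b0 / (1 - s))) A') ?invr_gt0//.
  by rewrite muleA -EFinM mulfV ?gt_eqF// mul1e.
have muS2 : (mu S2 = s%:E * mu B')%E.
  rewrite (@lebesgue_measure_affine s^-1 (- ((1 - s) * a0 / s)) B') ?invr_gt0//.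
  by rewrite muleA -EFinM mulfV ?gt_eqF// mul1e.
have S1x x : S1 x -> exists2 a, A a & (a <= a0) /\ x = (1 - s) * a + s * b0.
  move=> [/= Aa]; rewrite in_itv/= => le; eexists; first exact: Aa.
  by split => //; field; rewrite gt_eqF.
have S2x x : S2 x -> exists2 b, B b & (b0 < b) /\ x = (1 - s) * a0 + s * b.
  move=> [/= Bb]; rewrite in_itv/= andbT => le; eexists; first exact: Bb.
  by split => //; field; rewrite gt_eqF.
have S12 : (mu S1 + mu S2 <= mu C)%E.
  rewrite -measureU//.
    apply: le_measure; rewrite ?inE//; first exact: measurableU.
    move=> x [/S1x[a Aa [_ ->]]|/S2x[b Bb [_ ->]]]; exact: ABC.
  apply/seteqP; split => // x [/S1x[a _ [h1 ->]] /S2x[b _ [h2 /eqP]]].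
  rewrite lt_eqF//; nra.
apply: (@le_trans _ _ ((1 - s)%:E * (mu A' + e%:E) + s%:E * (mu B' + e%:E))%E).
  by apply: leeD; rewrite lee_wpmul2l// lee_fin ltW.
rewrite !ge0_muleDr ?lee_fin ?(ltW e0)//.
rewrite addeACA -muS1 -muS2 -!EFinM -EFinD -mulrDl subrK mul1r.
exact: leeD.
Qed.

Definition hypograph (F : measurableTypeR R -> R) :
    set (measurableTypeR R * measurableTypeR R) :=
  [set p | (0 <= p.2) && (p.2 < F p.1)].

Lemma measurable_hypograph (F : measurableTypeR R -> R) :
  measurable_fun setT F -> measurable (hypograph F).
Proof.
move=> mF.
have mf1 : measurable_fun setT (fun p : measurableTypeR R * measurableTypeR R => 0 <= p.2).
  by apply: measurable_fun_ler => //; exact: measurable_snd.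
have mf2 : measurable_fun setT (fun p : measurableTypeR R * measurableTypeR R => p.2 < F p.1).
  apply: measurable_fun_ltr; first exact: measurable_snd.
  exact: (measurableT_comp mF measurable_fst).
have := measurable_and mf1 mf2 => /(_ measurableT [set true] _).
by rewrite setTI; apply.
Qed.

Lemma hypograph_ysection (F : measurableTypeR R -> R) (r : R) :
  [set x | (0 <= r) && (r < F x)] = ysection (hypograph F) r.
Proof. by apply/seteqP; split => x; rewrite /ysection/= inE. Qed.

Lemma measurable_superlevel (F : measurableTypeR R -> R) (r : R) :
  measurable_fun setT F -> measurable [set x | (0 <= r) && (r < F x)].
Proof.
move=> /measurable_hypograph mD; rewrite hypograph_ysection.
exact: measurable_ysection.
Qed.

Lemma measurable_fun_superlevel (F : measurableTypeR R -> R) :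
  measurable_fun setT F ->
  measurable_fun setT (fun r : measurableTypeR R => mu [set x | (0 <= r) && (r < F x)]).
Proof.
move=> /measurable_hypograph mD; have := measurable_fun_ysection mu mD.
by apply: eq_measurable_fun => r _ /=; rewrite hypograph_ysection.
Qed.

(** Tonelli for the indicator of the hypograph, measured by vertical and by horizontal sections. *)
Lemma layer_cake (F : measurableTypeR R -> R) : measurable_fun setT F ->
  (forall x, 0 <= F x) ->
  (\int[mu]_x (F x)%:E = \int[mu]_r mu [set x | (0 <= r) && (r < F x)]%R)%E.
Proof.
move=> mF F0; pose D := hypograph F.
have mD : measurable D by exact: measurable_hypograph.
have D0 p : (0 <= (\1_D p)%:E :> \bar R)%E by rewrite lee_fin.
have mi : measurable_fun setT (fun p => (\1_D p)%:E : \bar R).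
  by apply/measurable_EFinP.
have := fubini_tonelli (m1 := mu) (m2 := mu) _ mi D0.
have -> : (\int[mu]_x \int[mu]_y (\1_D (x, y))%:E = \int[mu]_x (F x)%:E)%E.
  apply: eq_integral => x _.
  transitivity (mu `[0, F x[%classic).
    rewrite -integral_indicT//; apply: eq_integral => y _.
  rewrite lebesgue_measure_itv/= lte_fin; case: ltP => [_|h].
    by rewrite -EFinB subr0.
  by congr EFin; apply/eqP; rewrite eq_le F0 h.
move=> ->; apply: eq_integral => r _.
have mDr := measurable_superlevel r mF.
rewrite -integral_indicT//; apply: eq_integral => y _.
Qed.

(** As both suprema are 1, the superlevel sets of [F] and [G] are nonempty at the same levels. There
    the one-dimensional inequality applies, and the layer cake formula sums over levels. The bound
    is by the arithmetic mean of the integrals, which dominates the geometric one. *)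
Lemma prekopa_leindler_normalized (F G H : measurableTypeR R -> R) M s :
  measurable_fun setT F -> measurable_fun setT G -> measurable_fun setT H ->
  (forall x, 0 <= F x <= 1) -> (forall x, 0 <= G x <= 1) -> (forall x, 0 <= H x) ->
  (forall x, F x != 0 -> `|x| <= M) -> (forall x, G x != 0 -> `|x| <= M) ->
  (forall r, 0 <= r < 1 -> exists x, r < F x) ->
  (forall r, 0 <= r < 1 -> exists x, r < G x) ->
  0 < s < 1 ->
  (forall r x y, 0 <= r < 1 -> r < F x -> r < G y -> r < H ((1 - s) * x + s * y)) ->
  ((1 - s)%:E * \int[mu]_x (F x)%:E + s%:E * \int[mu]_x (G x)%:E <= \int[mu]_x (H x)%:E)%E.
Proof.
move=> mF mG mH F01 G01 H0 FM GM Fr Gr s01 FGH.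
have mS := measurable_superlevel.
have mT := measurable_fun_superlevel.
have F0 x : 0 <= F x by case/andP: (F01 x).
have G0 x : 0 <= G x by case/andP: (G01 x).
rewrite !layer_cake//.
have /andP[s0 s1] := s01.
rewrite -!ge0_integralZl_EFin ?subr_ge0 ?(ltW s0) ?(ltW s1)//; try exact: mT.
rewrite -ge0_integralD//; first last.
- by apply: emeasurable_funM => //; exact: mT.
- by move=> r _; rewrite mule_ge0// lee_fin ltW.
- by apply: emeasurable_funM => //; exact: mT.
- by move=> r _; rewrite mule_ge0// lee_fin subr_ge0 ltW.
apply: ge0_le_integral => //.
- by move=> r _; rewrite adde_ge0// mule_ge0// lee_fin ?subr_ge0 ltW.
- by apply: emeasurable_funD; apply: emeasurable_funM => //; exact: mT.
- exact: mT.
move=> r _.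
have [r0|] := boolP (r < 0); last rewrite -leNgt => r0.
  have e0 (f : measurableTypeR R -> R) :
      mu [set x | (0 <= r) && (r < f x)] = 0%E.
    by rewrite (_ : [set x | _] = set0) ?measure0//; apply/seteqP; split => // x /=; rewrite leNgt r0.
  by rewrite [X in (_ * X + _)%E](e0 F) [X in (_ + _ * X)%E](e0 G) !mule0 adde0.
have [r1|r1] := leP 1 r.
  have e0 (f : measurableTypeR R -> R) : (forall x, 0 <= f x <= 1) ->
      mu [set x | (0 <= r) && (r < f x)] = 0%E.
    move=> f01; rewrite (_ : [set x | _] = set0) ?measure0//.
    apply/seteqP; split => // x /= /andP[_]; apply/negP; rewrite -leNgt.
    by apply: le_trans r1; case/andP: (f01 x).
  by rewrite [X in (_ * X + _)%E](e0 F)// [X in (_ + _ * X)%E](e0 G)// !mule0 adde0.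
have r01 : 0 <= r < 1 by rewrite r0.
apply: (@brunn_minkowski_1d _ _ _ M) => //; try exact: mS.
- by have [x Fx] := Fr _ r01; exists x => /=; rewrite r0.
- by have [x Gx] := Gr _ r01; exists x => /=; rewrite r0.
- by move=> x /andP[_ rF]; apply: FM; rewrite gt_eqF// (le_lt_trans r0).
- by move=> x /andP[_ rF]; apply: GM; rewrite gt_eqF// (le_lt_trans r0).
- by move=> a b /andP[_ aF] /andP[_ bG] /=; rewrite r0/=; exact: FGH.
Qed.

End brunn_minkowski_1d.

Section brunn_minkowski.
Context {R : realType}.

(** Young's inequality for the conjugate exponents [1 / (1 - s)] and [1 / s]. *)
Lemma powR_amgm (a b s : R) : 0 <= a -> 0 <= b -> 0 < s < 1 ->
  a `^ (1 - s) * b `^ s <= (1 - s) * a + s * b.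
Proof.
move=> a0 b0 /andP[s0 s1]; have s1' : 0 < 1 - s by rewrite subr_gt0.
have := @conjugate_powR R (a `^ (1 - s)) (b `^ s) (1 - s)^-1 s^-1
  (powR_ge0 _ _) (powR_ge0 _ _).
rewrite !invr_gt0 !invrK subrK => /(_ s1' s0 erefl).
rewrite -!powRrM !mulfV ?gt_eqF// !powRr1//.
by rewrite (mulrC a) (mulrC b).
Qed.

Lemma slice_row_cons n (A : set 'rV[R]_n.+1) t y : slice A t y = A (row_cons (t, y)).
Proof. by []. Qed.

Lemma slice_ball n (A : set 'rV[R]_n.+1) r t :
  A `<=` ball 0 r -> slice A t `<=` ball 0 r.
Proof.
move=> Ar y Ay; have /row_ballE[r0 Ayr] := Ar _ Ay.
apply/row_ballE; split => // i; have := Ayr (lift ord0 i).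
by rewrite !mxE liftK.
Qed.

Lemma slice_bounded_arg n (A : set 'rV[R]_n.+1) r t :
  A `<=` ball 0 r -> slice A t !=set0 -> `|t| <= r.
Proof.
move=> Ar [y Ay]; have /row_ballE[r0 /(_ ord0)] := Ar _ Ay.
by rewrite !mxE unlift_none sub0r normrN => /ltW.
Qed.

Lemma homothety_row_cons n (a b : R) (x y : 'rV[R]_n) s :
  homothety (row_cons (a, x)) s (row_cons (b, y)) =
  row_cons ((1 - s) * a + s * b, homothety x s y) :> 'rV[R]_n.+1.
Proof.
apply/rowP => i; rewrite homothety_coord !mxE; case: unliftP => [k _|_] /=.
  by rewrite homothety_coord.
by ring.
Qed.

Definition vol n (A : set 'rV[R]_n) : R := fine (borel_lebesgue n A).

Lemma volE n (A : set 'rV[R]_n) : measurable A -> bounded_row A ->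
  borel_lebesgue n A = (vol A)%:E.
Proof.
move=> mA bA; rewrite fineK// ge0_fin_numE ?measure_ge0//.
exact: borel_lebesgue_bounded.
Qed.

Lemma vol_ge0 n (A : set 'rV[R]_n) : 0 <= vol A.
Proof. by apply: fine_ge0; exact: measure_ge0. Qed.

Lemma vol_slice_measurable n (A : set 'rV[R]_n.+1) : measurable A ->
  measurable_fun setT (fun t : measurableTypeR R => vol (slice A t)).
Proof.
move=> mA; apply: (measurableT_comp (f := fine)) => //.
exact: measurable_fun_slice.
Qed.

Lemma vol_slice_integral n (A : set 'rV[R]_n.+1) : measurable A -> bounded_row A ->
  ((vol A)%:E = \int[lebesgue_measure]_t (vol (slice A t))%:E)%E.
Proof.
move=> mA bA; rewrite -volE// borel_lebesgueS; apply: eq_integral => t _.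
rewrite volE//; first exact: measurable_slice.
by have [r Ar] := bA; exists r; exact: slice_ball.
Qed.

(* Induction on the dimension: the section volumes satisfy the hypothesis of the
   one-dimensional Prekopa-Leindler inequality. *)
Lemma brunn_minkowski n (A B C : set 'rV[R]_n) s :
  measurable A -> measurable B -> measurable C ->
  bounded_row A -> bounded_row B -> bounded_row C -> 0 < s < 1 ->
  (forall a b, A a -> B b -> C (homothety a s b)) ->
  vol A `^ (1 - s) * vol B `^ s <= vol C.
Proof.
elim: n A B C => [|n IHn] A B C mA mB mC bA bB bC s01 ABC; have /andP[s0 s1] := s01.
all: have s1' : 0 < 1 - s by rewrite subr_gt0.
  have v0 (X : set 'rV[R]_0) : vol X = (0 \in X)%:R.
    by rewrite /vol (_ : borel_lebesgue 0 X = (0 \in X)%:R%:E)//; exact: diracE.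
  have [A0|A0] := boolP ((0 : 'rV[R]_0) \in A); last first.
    by rewrite (v0 A) (negbTE A0) powR0 ?gt_eqF// mul0r vol_ge0.
  have [B0|B0] := boolP ((0 : 'rV[R]_0) \in B); last first.
    by rewrite (v0 B) (negbTE B0) powR0 ?gt_eqF// mulr0 vol_ge0.
  rewrite !v0 A0 B0 !powR1 mulr1 (_ : 0 \in C)//.
  move: A0 B0; rewrite !inE => A0 B0; have := ABC _ _ A0 B0; congr C.
  by apply/rowP => -[].
have [r rA] := bA; have [r' rB] := bB; have [r'' rC] := bC.
pose F (t : measurableTypeR R) := vol (slice A t).
pose G (t : measurableTypeR R) := vol (slice B t).
pose H (t : measurableTypeR R) := vol (slice C t).
have mF : measurable_fun setT F by exact: vol_slice_measurable.
have mG : measurable_fun setT G by exact: vol_slice_measurable.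
have mH : measurable_fun setT H by exact: vol_slice_measurable.
have bslice (X : set 'rV[R]_n.+1) t : bounded_row X -> bounded_row (slice X t).
  by move=> [q Xq]; exists q; exact: slice_ball.
have FGH x y : F x `^ (1 - s) * G y `^ s <= H ((1 - s) * x + s * y).
  apply: IHn => //; try exact: measurable_slice; try exact: bslice.
  by move=> a b Aa Bb; rewrite slice_row_cons -homothety_row_cons; exact: ABC.
have bound (X : set 'rV[R]_n.+1) : measurable X -> bounded_row X ->
    exists M, forall t, vol (slice X t) <= M.
  move=> mX [q Xq]; exists (vol (ball (0 : 'rV[R]_n) (Num.max q 1))) => t.
  have q0 : 0 < Num.max q 1 by rewrite lt_max ltr01 orbT.
  have bX : bounded_row (slice X t) by apply: bslice; exists q.
  have bq : bounded_row (ball (0 : 'rV[R]_n) (Num.max q 1)) by exists (Num.max q 1).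
  rewrite -lee_fin -(volE (measurable_slice t mX) bX) -(volE (measurable_row_ball _ _) bq).
  apply: le_measure; rewrite ?inE; [exact: measurable_slice|exact: measurable_row_ball|].
  by apply: subset_trans (slice_ball Xq) _; apply: le_ball; rewrite le_max lexx.
(* The suprema of the section volumes are the normalising constants of [F] and [G]; they are
   positive when the volumes are. *)
have supP (X : set 'rV[R]_n.+1) : measurable X -> bounded_row X -> vol X != 0 ->
    exists2 a, 0 < a & (forall t, vol (slice X t) <= a) /\
      (forall u, u < a -> exists t, u < vol (slice X t)).
  move=> mX bX X0; have [M HM] := bound _ mX bX.
  pose S := range (fun t => vol (slice X t)).
  have supS : has_sup S by split; [exists (vol (slice X 0)); exists 0|exists M => _ [t _ <-]].
  exists (sup S).
    rewrite lt_neqAle; apply/andP; split; last first.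
      by apply: le_trans (vol_ge0 (slice X 0)) _; apply: ub_le_sup supS.2 _ _; exists 0.
    apply: contra_neq X0 => S0; apply: EFin_inj.
    rewrite vol_slice_integral// integral0_eq// => t _; congr EFin.
    apply/eqP; rewrite eq_le vol_ge0 andbT S0.
    by apply: ub_le_sup supS.2 _ _; exists t.
  split=> [t|u us]; first by apply: ub_le_sup supS.2 _ _; exists t.
  have e0 : 0 < sup S - u by rewrite subr_gt0.
  have [_ [t _ <-]] := sup_adherent e0 supS.
  by rewrite opprB addrC subrK; exists t.
have [vA0|vA0] := eqVneq (vol A) 0.
  by rewrite vA0 powR0 ?gt_eqF// mul0r vol_ge0.
have [vB0|vB0] := eqVneq (vol B) 0.
  by rewrite vB0 powR0 ?gt_eqF// mulr0 vol_ge0.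
have [a a0 [Fa Fsup]] := supP A mA bA vA0.
have [b b0 [Gb Gsup]] := supP B mB bB vB0.
(* The scale for [H] is the geometric mean of those for [F] and [G]: by homogeneity, [F > u a] and
   [G > u b] then force [H > u c]. *)
pose c := a `^ (1 - s) * b `^ s.
have c0 : 0 < c by rewrite mulr_gt0// powR_gt0.
have scale (f : measurableTypeR R -> R) (k : R) : 0 < k -> measurable_fun setT f ->
    (forall x, 0 <= f x) ->
    (\int[lebesgue_measure]_t (f t / k)%:E = (k^-1)%:E * \int[lebesgue_measure]_t (f t)%:E)%E.
  move=> k0 mf f0; rewrite -ge0_integralZl_EFin//.
  - by apply: eq_integral => t _; rewrite -EFinM mulrC.
  - by move=> t _; rewrite lee_fin.
  - exact/measurable_EFinP.
  - by rewrite invr_ge0 ltW.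
have FGM : (forall x, F x / a != 0 -> `|x| <= Num.max r r') /\
           (forall x, G x / b != 0 -> `|x| <= Num.max r r').
  split=> x X0; rewrite le_max; apply/orP.
    left; apply: (slice_bounded_arg rA); apply/set0P; apply: contraNneq X0.
    by rewrite /F => ->; rewrite /vol measure0 mul0r.
  right; apply: (slice_bounded_arg rB); apply/set0P; apply: contraNneq X0.
  by rewrite /G => ->; rewrite /vol measure0 mul0r.
have key := @prekopa_leindler_normalized R (fun t => F t / a) (fun t => G t / b)
  (fun t => H t / c) (Num.max r r') s.
have {}key : ((1 - s)%:E * \int[lebesgue_measure]_x (F x / a)%:E +
     s%:E * \int[lebesgue_measure]_x (G x / b)%:E <= \int[lebesgue_measure]_x (H x / c)%:E)%E.
  apply: key => //.
  - exact: measurable_funM.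
  - exact: measurable_funM.
  - exact: measurable_funM.
  - by move=> x; rewrite divr_ge0 ?vol_ge0 ?(ltW a0)// ler_pdivrMr// mul1r Fa.
  - by move=> x; rewrite divr_ge0 ?vol_ge0 ?(ltW b0)// ler_pdivrMr// mul1r Gb.
  - by move=> x; rewrite divr_ge0 ?vol_ge0 ?(ltW c0).
  - exact: FGM.1.
  - exact: FGM.2.
  - move=> u /andP[u0 u1]; have [t ut] := Fsup (u * a) (ltac:(by rewrite gtr_pMl)).
    by exists t; rewrite ltr_pdivlMr.
  - move=> u /andP[u0 u1]; have [t ut] := Gsup (u * b) (ltac:(by rewrite gtr_pMl)).
    by exists t; rewrite ltr_pdivlMr.
  move=> u x y /andP[u0 u1]; rewrite !ltr_pdivlMr// => uF uG.
  apply: lt_le_trans (FGH x y).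
  have ua0 : 0 <= u * a by rewrite mulr_ge0// ltW.
  have ub0 : 0 <= u * b by rewrite mulr_ge0// ltW.
  have -> : u * c = (u * a) `^ (1 - s) * (u * b) `^ s.
    rewrite !powRM ?(ltW a0) ?(ltW b0)// mulrACA -powRD; last by rewrite subrK oner_eq0.
    by rewrite subrK powRr1.
  by apply: ltr_pM; rewrite ?powR_ge0//; apply: gt0_ltr_powR; rewrite ?nnegrE ?vol_ge0.
move: key; rewrite !scale//; try by move=> ?; exact: vol_ge0.
rewrite -!vol_slice_integral// -!EFinM -EFinD lee_fin => key.
(* Undo the normalisation: [key] bounds the arithmetic mean of [vol A / a] and [vol B / b], hence
   their geometric mean. *)
have -> : vol A = a * (a^-1 * vol A) by rewrite mulrA mulfV ?mul1r// gt_eqF.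
have -> : vol B = b * (b^-1 * vol B) by rewrite mulrA mulfV ?mul1r// gt_eqF.
have a1 : 0 <= a^-1 * vol A by rewrite mulr_ge0 ?vol_ge0// invr_ge0 ltW.
have b1 : 0 <= b^-1 * vol B by rewrite mulr_ge0 ?vol_ge0// invr_ge0 ltW.
rewrite (powRM _ (ltW a0) a1) (powRM _ (ltW b0) b1) mulrACA -/c.
rewrite -ler_pdivlMl//; apply: le_trans key.
exact: powR_amgm.
Qed.

End brunn_minkowski.

Lemma row_unconsK {R : realType} n (z : 'rV[R]_n.+1) : row_cons (row_uncons z) = z.
Proof. by apply/rowP => i; rewrite mxE; case: unliftP => [k|] ->; rewrite ?mxE. Qed.

(** * Sections parallel to the hyperplane *)

Section frame.
Context {R : realType} {n : nat}.
Implicit Types nu : 'rV[R]_n.+1.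

(* A Householder reflection exchanges the first basis vector and [nu]. *)
Lemma orthogonal_first_row nu : enorm nu = 1 ->
  exists2 P : 'M[R]_n.+1, P *m P^T = 1%:M & delta_mx 0 0 *m P = nu.
Proof.
move=> nu1; have nunu : dotv nu nu = 1 by rewrite -enorm_sqr nu1 expr1n.
pose e : 'rV[R]_n.+1 := delta_mx 0 0.
have [->|nue] := eqVneq nu e.
  by exists 1%:M; [rewrite trmx1 mulmx1|rewrite mulmx1].
pose w := nu - e.
have w0 : w != 0 by rewrite subr_eq0.
have ee : dotv e e = 1.
  rewrite /dotv (bigD1 ord0)//= big1 ?addr0 ?mxE ?eqxx ?mulr1// => i i0.
  by rewrite !mxE (negbTE i0) mulr0.
pose d := dotv w w.
have d0 : d != 0 by rewrite dotv_eq0.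
have dE : d = 2 - 2 * dotv e nu.
  rewrite /d /w dotvDl !dotvDr !dotvNl !dotvNr nunu ee (dotvC nu e); ring.
have we : dotv e w = - d / 2.
  rewrite dE /w dotvDr dotvNr ee; lra.
have wwT : w *m w^T = d%:M.
  by apply/matrixP => i j; rewrite !ord1 -dotvE mxE eqxx mulr1n.
pose P : 'M[R]_n.+1 := 1%:M - (2 / d) *: (w^T *m w).
have symm (v : 'rV[R]_n.+1) (c : R) :
    (1%:M - c *: (v^T *m v))^T = 1%:M - c *: (v^T *m v).
  by apply/matrixP => i j; rewrite !mxE !big_ord1 !mxE eq_sym (mulrC (v 0 j)).
have PT : P^T = P by exact: symm.
have XX : (w^T *m w) *m (w^T *m w) = d *: (w^T *m w).
  by rewrite mulmxA -(mulmxA w^T) wwT mul_mx_scalar -scalemxAl.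
exists P.
  rewrite PT /P; move: (w^T *m w) XX => X XX.
  rewrite mulmxBr mulmx1 mulmxBl mul1mx -scalemxAl -scalemxAr XX !scalerA.
  apply/matrixP => i j; rewrite !mxE; move: (X i j) (_ == _)%:R => u v.
  by field.
rewrite /P mulmxBr mulmx1 -scalemxAr mulmxA -/e.
have -> : e *m w^T = (dotv e w)%:M.
  by apply/matrixP => i j; rewrite !ord1 -dotvE mxE eqxx mulr1n.
rewrite mul_scalar_mx scalerA we.
have -> : 2 / d * (- d / 2) = -1 by field; rewrite d0.
by rewrite scaleN1r opprK /w addrC subrK.
Qed.

(** [hyperplane_frame] chooses from a set that must be shown nonempty: take an orthogonal matrix
    with first row [nu] and remove that row. *)
Lemma hyperplane_frame_exists nu : enorm nu = 1 ->
  exists Q : 'M[R]_(n, n.+1), Q *m Q^T = 1%:M /\ Q *m nu^T = 0.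
Proof.
move=> /orthogonal_first_row[P PP <-].
pose S : 'M[R]_(n, n.+1) := \matrix_(i, j) (lift ord0 i == j)%:R.
have SS : S *m S^T = 1%:M.
  apply/matrixP => i j; rewrite !mxE (bigD1 (lift ord0 i))//= big1 ?addr0.
    by rewrite !mxE eqxx mul1r (inj_eq lift_inj) eq_sym.
  by move=> k ki; rewrite !mxE eq_sym (negbTE ki) mul0r.
have Se : S *m (delta_mx 0 0 : 'rV[R]_n.+1)^T = 0.
  apply/matrixP => i j; rewrite !mxE big1// => k _; rewrite !mxE ord1 eqxx/=.
  have [->|] := eqVneq k 0; last by rewrite mulr0.
  by rewrite (_ : lift _ _ == _ = false) ?mul0r//; exact/negbTE.
exists (S *m P); split.
  by rewrite trmx_mul mulmxA -(mulmxA S) PP mulmx1 SS.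
by rewrite trmx_mul mulmxA -(mulmxA S) PP mulmx1 Se.
Qed.

Lemma hyperplane_frameP nu : enorm nu = 1 ->
  hyperplane_frame nu *m (hyperplane_frame nu)^T = 1%:M /\
  hyperplane_frame nu *m nu^T = 0.
Proof.
move=> /hyperplane_frame_exists[Q HQ].
have /getPex : exists Q : 'M[R]_(n.+1.-1, n.+1),
    [set Q | Q *m Q^T = 1%:M /\ Q *m nu^T = 0] Q by exists Q.
exact.
Qed.

End frame.

(** With [k] minimal such that [S] has an element [h] in the interval from 0 to [(k + 1) r], that
    [h] generates. A nonzero remainder [t < h] would be at least [r] below [h], since [h - t] is in
    [S], hence below [k r], against the minimality of [k]. *)
Lemma discrete_subgroup {R : realType} (S : set R) (r : R) :
  (forall s t, S s -> S t -> S (s - t)) -> 0 < r ->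
  (forall s, S s -> s != 0 -> r <= `|s|) -> (exists2 s, S s & s != 0) ->
  exists2 h, S h /\ 0 < h & forall s, S s -> exists k : int, s = k%:~R * h.
Proof.
move=> SB r0 Sr [s0 Ss0 s00].
have S0 : S 0 by rewrite -(subrr s0); exact: SB.
have SN s : S s -> S (- s) by move=> Ss; rewrite -(sub0r s); exact: SB.
have SMn s (k : nat) : S s -> S (k%:R * s).
  move=> Ss; elim: k => [|k IHk]; first by rewrite mul0r.
  by rewrite -natr1 mulrDl mul1r -[X in _ + X]opprK; apply: SB => //; exact: SN.
have SMz s (k : int) : S s -> S (k%:~R * s).
  move=> Ss; case: k => k; first exact: SMn.
  by rewrite NegzE intrN mulNr; exact/SN/SMn.
pose P k := `[< exists2 s, S s & 0 < s < k.+1%:R * r >].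
have exP : exists k, P k.
  have s0' : 0 < `|s0| by rewrite normr_gt0.
  exists (Num.truncn (`|s0| / r)); apply/asboolP; exists `|s0|.
    by case: (ger0P s0) => _ //; exact: SN.
  by rewrite s0' -ltr_pdivrMr// truncnS_gt.
have := ex_minnP exP => -[k /asboolP[h Sh /andP[h0 hk]] kmin].
exists h => // s Ss; exists (Num.floor (s / h)).
have /andP[f1 f2] := floor_itv (s / h).
rewrite ler_pdivlMr// in f1; rewrite ltr_pdivrMr// intrD1 mulrDl mul1r in f2.
pose t := s - (Num.floor (s / h))%:~R * h.
suff : t = 0 by move=> /eqP; rewrite subr_eq0 => /eqP.
have St : S t by apply: SB => //; exact: SMz.
have t0 : 0 <= t by rewrite subr_ge0.
have th : t < h by rewrite ltrBlDl.
apply/eqP; apply: contraT => tn0.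
have rt : r <= t by have := Sr _ St tn0; rewrite ger0_norm.
have rht : r <= h - t.
  have htn0 : h - t != 0 by rewrite subr_eq0 gt_eqF.
  by have := Sr _ (SB _ _ Sh St) htn0; rewrite ger0_norm// subr_ge0 ltW.
case: k hk kmin => [|k] hk kmin.
  by exfalso; move: hk; lra.
have : P k.
  apply/asboolP; exists t => //; rewrite lt_neqAle eq_sym tn0 t0/=.
  by move: hk; rewrite -natr1 mulrDl mul1r; lra.
by move=> /kmin; rewrite ltnn.
Qed.

Section sections.
Context {R : realType} {n : nat} (L U : set 'rV[R]_n.+1) (nu : 'rV[R]_n.+1).
Variable Q : 'M[R]_(n, n.+1).
Hypotheses (latL : full_rank_lattice L) (oU : open U) (convU : convex_row U)
  (bU : bounded_row U) (pU : packing L U).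
Hypotheses (nu1 : enorm nu = 1) (QQ : Q *m Q^T = 1%:M) (Qnu : Q *m nu^T = 0).

Definition frame_mx : 'M[R]_n.+1 :=
  \matrix_(i, j) (if unlift ord0 i is Some k then Q k j else nu 0 j).

Lemma row_cons_frame t y : row_cons (t, y) *m frame_mx = t *: nu + y *m Q.
Proof.
apply/rowP => j; rewrite !mxE big_ord_recl !mxE unlift_none; congr (_ + _).
by apply: eq_bigr => i _; rewrite !mxE liftK.
Qed.

Lemma dotv_nu : dotv nu nu = 1.
Proof. by rewrite -enorm_sqr nu1 expr1n. Qed.

Lemma dotv_frame t y : dotv (t *: nu + y *m Q) nu = t.
Proof.
rewrite dotvDl dotvZl dotv_nu mulr1 dotvE -mulmxA Qnu mulmx0.
by rewrite mxE addr0.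
Qed.

Lemma frame_orthogonal : frame_mx *m frame_mx^T = 1%:M.
Proof.
apply/matrixP => i j; rewrite [LHS]mxE.
have -> : \sum_k frame_mx i k * frame_mx^T k j =
   dotv (row i frame_mx) (row j frame_mx).
  by apply: eq_bigr => k _; rewrite !mxE.
have rE a : row a frame_mx = if unlift ord0 a is Some k then row k Q else nu.
  by apply/rowP => b; rewrite !mxE; case: unliftP => [k _|_]; rewrite ?mxE.
rewrite !rE mxE; case: (unliftP ord0 i) => [k|] ->; case: (unliftP ord0 j) => [l|] ->.
- rewrite dotvE tr_row -[in RHS](inj_eq (@lift_inj _ ord0)).
  rewrite (inj_eq (@lift_inj _ ord0)).
  have /matrixP/(_ k l) := QQ; rewrite !mxE => <-.
  by apply: eq_bigr => b _; rewrite !mxE.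
- have /matrixP/(_ k 0) := Qnu; rewrite !mxE => e.
  rewrite (_ : _ == _ = false)//; rewrite /dotv -[RHS]e.
  by apply: eq_bigr => b _; rewrite !mxE.
- have /matrixP/(_ l 0) := Qnu; rewrite !mxE => e.
  rewrite (_ : _ == _ = false)// dotvC /dotv -[RHS]e.
  by apply: eq_bigr => b _; rewrite !mxE.
- by rewrite eqxx dotv_nu.
Qed.

Lemma frame_unit : frame_mx \in unitmx.
Proof. by have [] := mulmx1_unit frame_orthogonal. Qed.

Lemma frame_decomp x : exists y, x = dotv x nu *: nu + y *m Q.
Proof.
pose z := x *m invmx frame_mx.
have xE : x = z *m frame_mx by rewrite (mulmxKV frame_unit).
have zE := row_unconsK z.
exists (row_uncons z).2.
have {}xE : x = (row_uncons z).1 *: nu + (row_uncons z).2 *m Q.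
  by rewrite -row_cons_frame -surjective_pairing zE -xE.
by rewrite [in RHS]xE dotv_frame -xE.
Qed.

Lemma mulQ_inj : injective (fun y : 'rV[R]_n => y *m Q).
Proof.
by move=> y z /(congr1 (mulmx^~ Q^T)); rewrite -!mulmxA QQ !mulmx1.
Qed.

Definition section_set t : set 'rV[R]_n := [set y | U (t *: nu + y *m Q)].

Lemma open_section t : open (section_set t).
Proof.
apply: (@open_comp _ _ (fun y : 'rV[R]_n => t *: nu + y *m Q) U _ oU) => y _.
have h1 : {for y, continuous (fun y : 'rV[R]_n => y *m Q)} by exact: continuous_mulmxr.
have h2 : {for y, continuous (fun _ : 'rV[R]_n => t *: nu)} by exact: cst_continuous.
exact: (continuousD h2 h1).
Qed.

Lemma measurable_section t : measurable (section_set t).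
Proof. by apply: open_measurable_row; exact: open_section. Qed.

Definition section_lattice : set 'rV[R]_n := [set y | L (y *m Q)].

Lemma countable_section_lattice : countable section_lattice.
Proof.
have /countable_injP[f finj] := lattice_countable latL.
apply/countable_injP; exists (fun y => f (y *m Q)) => y z; rewrite !inE => Ly Lz.
by move=> /finj; rewrite !inE => /(_ Ly Lz)/mulQ_inj.
Qed.

Lemma section_packing t : packing section_lattice (section_set t).
Proof.
move=> y a b La Lb; rewrite /section_set/= !mulmxDl !addrA => Ua Ub.
by apply: mulQ_inj; exact: pU Ua Ub.
Qed.

Hypothesis covH : covering section_lattice (section_set 0).
Hypothesis nonempty0 : section_set 0 !=set0.

Lemma bounded_section t : bounded_row (section_set t).
Proof.
have [r Ur] := bU; have q0 := mx_l1_gt0 Q^T.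
exists (mx_l1 Q^T * (Num.max r 1 + `|t|) + 1) => y Uy; apply/row_ballE.
have r0 : 0 <= Num.max r 1 + `|t| by rewrite addr_ge0// le_max ler01 orbT.
split=> [|i]; first by rewrite ltr_wpDl// mulr_ge0// ltW.
rewrite mxE sub0r normrN.
have -> : y = (y *m Q) *m Q^T by rewrite -mulmxA QQ mulmx1.
apply: le_lt_trans (mulmx_coord_le Q^T _ r0 i) _; last by rewrite ltrDl.
move=> k; have /row_ballE[_ /(_ k)] := Ur _ Uy.
rewrite mxE sub0r normrN mxE [X in X + _]mxE => /ltW h.
have nuk : `|nu 0 k| <= 1.
  rewrite -(@ler_pXn2r _ 2)// ?nnegrE// expr1n -dotv_nu /dotv (bigD1 k)//=.
  rewrite -normrX ger0_norm ?sqr_ge0// expr2 lerDl sumr_ge0// => j _.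
  by rewrite -expr2 sqr_ge0.
rewrite -(addrK (t * nu 0 k) ((y *m Q) 0 k)) (le_trans (ler_normB _ _))//.
apply: lerD; last by rewrite normrM ler_piMr.
by rewrite addrC le_max h.
Qed.

Let f t := vol (section_set t).

Lemma section_le t : f t <= f 0.
Proof.
rewrite -lee_fin /f -!volE//; try exact: measurable_section; try exact: bounded_section.
apply: (packing_le_covering_measure countable_section_lattice) => //.
- exact: measurable_section.
- exact: measurable_section.
- exact: section_packing.
Qed.

(* Over the lattice of the hyperplane, the central section and the section at
   height [dotv l nu], moved down by [l], still form a packing; the central one
   already covers, so the other has measure zero and, being open, is empty. *)
Lemma section_lattice_height_empty l : L l -> dotv l nu != 0 ->
  section_set (dotv l nu) = set0.
Proof.
move=> Ll l0; have [y0 ly0] := frame_decomp l.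
set s := dotv l nu in l0 ly0 *.
pose E : set 'rV[R]_n := [set y | section_set s (y + y0)].
have mE : measurable E by apply: measurable_translate; exact: measurable_section.
have EU y b : E (y + b) -> U (y *m Q + (b *m Q + l)).
  rewrite {1}ly0 /E /section_set/=; congr U.
  by rewrite !mulmxDl -/s addrCA -!addrA.
have DU y a : section_set 0 (y + a) -> U (y *m Q + a *m Q).
  by rewrite /section_set/= scale0r add0r mulmxDl.
have m0 := measurable_section 0.
have neq a b : a *m Q = b *m Q + l -> False.
  move=> /(congr1 (dotv^~ nu)); rewrite dotvDl !dotvE -!mulmxA Qnu !mulmx0 mxE add0r -dotvE.
  by move=> /esym/eqP; rewrite -/s (negbTE l0).
have h : (borel_lebesgue n (section_set 0 `|` E) <= borel_lebesgue n (section_set 0))%E.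
  apply: (packing_le_covering_measure countable_section_lattice) => //.
    exact: measurableU.
  move=> y a b La Lb [Ua|Ua] [Ub|Ub].
  - exact: section_packing La Lb Ua Ub.
  - by have /neq := pU La (latticeD latL Lb Ll) (DU _ _ Ua) (EU _ _ Ub).
  - by have /esym/neq := pU (latticeD latL La Ll) Lb (EU _ _ Ua) (DU _ _ Ub).
  - have := pU (latticeD latL La Ll) (latticeD latL Lb Ll) (EU _ _ Ua) (EU _ _ Ub).
    by move=> /addIr/mulQ_inj.
have DE0 : section_set 0 `&` E = set0.
  apply/seteqP; split => // y []; rewrite -[X in section_set 0 X]addr0 -[X in E X]addr0.
  move=> /DU U1 /EU U2; have := pU _ _ U1 U2; rewrite mul0mx => /(_ (lattice0 latL)).
  by rewrite add0r => /(_ Ll) l00; move: l0; rewrite /s -l00 dotvE mul0mx mxE eqxx.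
have E0 : borel_lebesgue n E = 0%E.
  have m0f : borel_lebesgue n (section_set 0) \is a fin_num.
    by rewrite volE//; exact: bounded_section.
  apply/eqP; rewrite eq_le measure_ge0 andbT.
  have : (borel_lebesgue n (section_set 0) + borel_lebesgue n E <=
          borel_lebesgue n (section_set 0) + 0)%E.
    by rewrite adde0 -measureU.
  by rewrite leeD2lE.
apply/seteqP; split => // y Uy.
have oE : open E by apply: open_translate; exact: open_section.
have : (0 < borel_lebesgue n E)%E.
  apply: borel_lebesgue_open_gt0 oE _; exists (y - y0).
  by rewrite /E /= subrK.
by rewrite E0 ltxx.
Qed.

(** If [t] were at least as far from 0 as [dotv l nu], up to replacing [l] by [- l] that height
    would lie between 0 and [t]. By convexity its section would contain a point of the segment from
    the central section to height [t], but it is empty. *)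
Lemma section_arg_lt l t y : L l -> dotv l nu != 0 -> section_set t y ->
  `|t| < `|dotv l nu|.
Proof.
move=> Ll l0 Uty; rewrite ltNge; apply/negP => lt.
wlog ts : l Ll l0 lt / 0 <= t / dotv l nu.
  move=> H; have [ts|ts] := leP 0 (t / dotv l nu); first exact: (H l).
  apply: (H (- l)); rewrite ?dotvNl ?oppr_eq0 ?normrN//; first exact: latticeN.
  by rewrite invrN mulrN oppr_ge0 ltW.
have t0 : t != 0.
  by apply: contraTneq lt => ->; rewrite normr0 -ltNge normr_gt0.
pose c := dotv l nu / t.
have c01 : 0 <= c <= 1.
  have c0 : 0 <= c by rewrite /c -invr_ge0 invfM invrK mulrC.
  by rewrite c0 /= -(ger0_norm c0) normrM normfV ler_pdivrMr ?normr_gt0// mul1r.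
have [p Up] := nonempty0.
have := section_lattice_height_empty Ll l0 => /seteqP[/(_ (homothety p c y))].
move=> + _; apply; rewrite /section_set/=.
have := convU Up Uty c01; congr U.
apply/rowP => i; rewrite homothety_coord.
have e a z : (a *: nu + z *m Q) 0 i = a * nu 0 i + (z *m Q) 0 i.
  by rewrite [LHS]mxE [X in X + _]mxE.
rewrite !e.
have -> : homothety p c y *m Q = homothety (p *m Q) c (y *m Q).
  by rewrite /homothety mulmxDl -scalemxAl mulmxBl.
rewrite homothety_coord.
rewrite (_ : dotv l nu = c * t); last by rewrite /c mulfVK.
ring.
Qed.

(* The gap between consecutive heights of the lattice is the [h] of the
   statement: the heights form a subgroup of the reals which avoids the heights
   of the points of [U]. *)
Lemma section_height : exists2 h : R, 0 < h &
  dual_lattice L (h^-1 *: nu) /\ forall t y, section_set t y -> `|t| < h.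
Proof.
have [p Up] := nonempty0.
have /nbhs_ballP[r /= r0 prU] : nbhs (p *m Q) U.
  by apply: open_nbhs_nbhs; split => //; move: Up; rewrite /section_set/= scale0r add0r.
pose S := [set s | exists2 l, L l & s = dotv l nu].
have SB s t : S s -> S t -> S (s - t).
  move=> [l Ll ->] [l' Ll' ->]; exists (l - l'); last by rewrite dotvDl dotvNl.
  by apply: latticeD => //; exact: latticeN.
have nu_le1 i : `|nu 0 i| <= 1.
  rewrite -(@ler_pXn2r _ 2)// ?nnegrE// expr1n -dotv_nu /dotv (bigD1 i)//=.
  rewrite -normrX ger0_norm ?sqr_ge0// expr2 lerDl sumr_ge0// => j _.
  by rewrite -expr2 sqr_ge0.
(* [U] contains a cube of radius [r] about a point of the hyperplane, so its section at height
   [r / 2] is nonempty. *)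
have gap s : S s -> s != 0 -> r / 2 <= `|s|.
  move=> [l Ll ->] l0.
  have r20 : 0 < r / 2 by rewrite divr_gt0.
  rewrite -(gtr0_norm r20) ltW//; apply: (@section_arg_lt l (r / 2) p) => //.
  apply: prU; apply/row_ballE; split => // i.
  rewrite [X in _ - X]mxE opprD addrCA subrr addr0 normrN mxE normrM (gtr0_norm r20).
  apply: le_lt_trans (ler_piMr (ltW r20) (nu_le1 i)) _.
  by rewrite gtr_pMr// invf_lt1// ltr1n.
have nz : exists2 s, S s & s != 0.
  have [B uB LE] := latL.
  have Bnu : B *m nu^T != 0.
    apply/eqP => B0; have : invmx B *m (B *m nu^T) = 0 by rewrite B0 mulmx0.
    rewrite (mulKmx uB) => /(congr1 trmx); rewrite trmxK trmx0 => nu0.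
    by have := dotv_nu; rewrite nu0 dotvE mul0mx mxE => /eqP; rewrite eq_sym oner_eq0.
  have [i Bi] : exists i, (B *m nu^T) i 0 != 0.
    apply/existsP; apply: contra_neqT Bnu => /existsPn B0; apply/colP => i.
    by have := B0 i; rewrite negbK => /eqP ->; rewrite mxE.
  exists ((B *m nu^T) i 0) => //; exists (row i B).
    by rewrite LE; exists (delta_mx 0 i) => //; rewrite map_delta_mx -rowE.
  by rewrite dotvE -row_mul [RHS]mxE.
have r20 : 0 < r / 2 by rewrite divr_gt0.
have [h [[l0 Ll0 hE] h0] hS] := discrete_subgroup SB r20 gap nz.
exists h => //; split.
  move=> l Ll; have [k kE] := hS (dotv l nu) (ex_intro2 _ _ l Ll erefl).
  by rewrite dotvZl dotvC kE mulrCA mulVf ?mulr1 ?gt_eqF// intr_int.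
move=> t y Uty; rewrite -[h]gtr0_norm// hE; apply: section_arg_lt Uty => //.
by rewrite -hE gt_eqF.
Qed.

(** By convexity and Brunn-Minkowski, [f (c t)] is at least the geometric mean of [f 0] and [f t]
    with weights [1 - c] and [c], and [f 0] dominates [f t]. *)
Lemma section_homothety c t : 0 < c < 1 -> f t <= f (c * t).
Proof.
move=> c01; have /andP[c0 c1] := c01.
have := @brunn_minkowski R n (section_set 0) (section_set t) (section_set (c * t)) c
  (measurable_section _) (measurable_section _) (measurable_section _)
  (bounded_section _) (bounded_section _) (bounded_section _) c01.
rewrite -/(f 0) -/(f t) -/(f (c * t)) => BM.
have {}BM : f 0 `^ (1 - c) * f t `^ c <= f (c * t).
  apply: BM => a b Ua Ub; rewrite /section_set/=.
  have c01' : 0 <= c <= 1 by rewrite !ltW.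
  have := convU Ua Ub c01'; congr U.
  rewrite scale0r add0r /homothety mulmxDl -scalemxAl mulmxBl -scalerA.
  by rewrite -addrA scalerDr addrCA.
apply: le_trans BM.
have ft0 : 0 <= f t by exact: vol_ge0.
apply: (@le_trans _ _ (f t `^ (1 - c) * f t `^ c)).
  by rewrite -powRD subrK ?powRr1// oner_eq0.
rewrite ler_wpM2r ?powR_ge0//.
by apply: ge0_ler_powR; rewrite ?nnegrE ?subr_ge0 ?(ltW c1)//; [exact: vol_ge0|exact: section_le].
Qed.

Lemma measurable_vol_section : measurable_fun setT (fun t : measurableTypeR R => f t).
Proof.
pose V := (fun x => x *m frame_mx) @^-1` U.
have mV : measurable V.
  rewrite -[X in measurable X]setTI; apply: measurable_mulmxr => //.
  exact: open_measurable_row.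
have := vol_slice_measurable mV.
apply: eq_measurable_fun => t _; rewrite /f; congr vol.
by apply/seteqP; split => y; rewrite /slice /V /section_set/= row_cons_frame.
Qed.

(** Fubini in the coordinates of the orthogonal frame. The constant is the same for all [phi], so it
    cancels when a second moment is compared with a volume. *)
Lemma section_integral : exists2 k : R, 0 < k & forall phi : R -> R,
  measurable_fun setT phi -> (forall t, 0 <= phi t) ->
  (k%:E * \int[borel_lebesgue n.+1]_(x in U) (phi (dotv x nu))%:E =
   \int[lebesgue_measure]_t (phi t * f t)%:E)%E.
Proof.
have [k k0 kE] := ge0_integral_mulmx frame_unit.
exists k => // phi mphi phi0.
have mU : measurable U by exact: open_measurable_row.
pose h x : \bar R := (phi (dotv x nu))%:E.
have mh : measurable_fun setT h.
  apply/measurable_EFinP; apply: (measurableT_comp mphi).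
  by apply: continuous_measurable_row; exact: continuous_dotv.
have mhU : measurable_fun setT (h \_ U).
  by apply/(measurable_restrictT _ mU); exact: measurable_funTS.
have hU0 x : (0 <= (h \_ U) x)%E by rewrite patchE; case: ifP; rewrite ?lee_fin.
rewrite integral_mkcond -(kE _ mhU hU0) ge0_integral_borel_lebesgueS//; last first.
  by apply: (measurableT_comp mhU); exact: measurable_mulmxr.
apply: eq_integral => t _.
transitivity (\int[borel_lebesgue n]_(y in section_set t) (phi t)%:E)%E.
  rewrite [RHS]integral_mkcond; apply: eq_integral => y _.
  rewrite row_cons_frame !patchE /h dotv_frame.
  by congr (if _ then _ else _); apply/idP/idP; rewrite !inE.
rewrite integral_cst//; last exact: measurable_section.
by rewrite EFinM -volE//; [exact: measurable_section|exact: bounded_section].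
Qed.

End sections.

(** * Second moments of unimodal densities *)

Section moment.
Context {R : realType}.
Local Notation mu := (@lebesgue_measure R).

Lemma ge0_integral_preimage d (T : measurableType d)
    (m : {measure set T -> \bar R}) (phi : T -> T) (D : set T) (g : T -> \bar R) :
  measurable_fun setT phi ->
  (forall A, measurable A -> m (phi @^-1` A) = m A) -> measurable D ->
  measurable_fun setT g -> (forall x, 0 <= g x)%E ->
  (\int[m]_(x in phi @^-1` D) g (phi x) = \int[m]_(x in D) g x)%E.
Proof.
move=> mphi phiE mD mg g0; rewrite integral_mkcond [RHS]integral_mkcond.
rewrite -[RHS](ge0_integral_comp_preserving mphi phiE).
- by apply: eq_integral => x _; rewrite !patchE; congr (if _ then _ else _); rewrite !inE.
- by apply/(measurable_restrictT _ mD); exact: measurable_funTS.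
- by move=> x; rewrite patchE; case: ifP.
Qed.

Lemma lebesgue_measure_reflect (a : R) (A : set (measurableTypeR R)) :
  measurable A -> mu [set x : measurableTypeR R | A (a - x)] = mu A.
Proof.
move=> mA.
have mB : measurable [set x : measurableTypeR R | A (x + a)].
  have := measurable_affine_preimage 1 a mA.
  by congr measurable; apply/seteqP; split => x /=; rewrite mul1r.
rewrite -[RHS](lebesgue_measure_translate a mA) -[RHS](lebesgue_measureN mB).
by congr (mu _); apply/seteqP; split => x /=; rewrite addrC.
Qed.

Lemma ge0_integral_reflect (a : R) (D : set (measurableTypeR R)) (g : R -> R) :
  measurable D -> measurable_fun setT g -> (forall x, 0 <= g x) ->
  (\int[mu]_(x in [set x | D (a - x)%R]) (g (a - x))%:E = \int[mu]_(x in D) (g x)%:E)%E.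
Proof.
move=> mD mg g0.
apply: (@ge0_integral_preimage _ _ mu (fun x : measurableTypeR R => a - x : measurableTypeR R)
   D (EFin \o g)) => //.
- by apply: measurable_funB.
- by move=> A mA; exact: lebesgue_measure_reflect.
- exact/measurable_EFinP.
Qed.

(* Chebyshev's inequality for the pairing of [t] with [h - t]. *)
Lemma decreasing_second_moment (F : R -> R) (h : R) : 0 < h ->
  measurable_fun setT F -> (forall t, 0 <= F t) ->
  (forall t u, 0 < t -> t <= u -> u < h -> F u <= F t) ->
  (\int[mu]_(t in `]0%R, h[) (t ^+ 2 * F t)%:E <=
   (h ^+ 2 / 2)%:E * \int[mu]_(t in `]0%R, h[) (F t)%:E)%E.
Proof.
move=> h0 mF F0 Fdec.
pose D : set (measurableTypeR R) := `]0, h[%classic.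
have mD : measurable D by exact: measurable_itv.
have Dr : [set x | D (h - x)] = D.
  by apply/seteqP; split => x; rewrite /D/= !in_itv/= => /andP[? ?]; apply/andP; split; lra.
pose g t := t ^+ 2 * F t.
have mg : measurable_fun setT g by apply: measurable_funM => //; exact: measurable_funX.
have g0 t : 0 <= g t by rewrite mulr_ge0// sqr_ge0.
have rF := ge0_integral_reflect h mD mF F0; rewrite Dr in rF.
have rg := ge0_integral_reflect h mD mg g0; rewrite Dr in rg.
have mr (G : R -> R) : measurable_fun setT G -> measurable_fun setT (fun t : R => G (h - t)).
  by move=> mG; apply: (measurableT_comp mG); exact: measurable_funB.
have mE (G : R -> R) : measurable_fun setT G -> measurable_fun D (fun t => (G t)%:E).
  by move=> mG; apply: measurable_funTS; exact/measurable_EFinP.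
have c0 : 0 <= h ^+ 2 / 2 by rewrite divr_ge0// sqr_ge0.
set I := (\int[mu]_(t in _) (t ^+ 2 * F t)%:E)%E; set J := (\int[mu]_(t in _) (F t)%:E)%E.
have E0 (G : R -> R) : (forall t, 0 <= G t) -> forall t, D t -> (0 <= (G t)%:E)%E.
  by move=> G0 t _; rewrite lee_fin.
have mS (G : R -> R) : measurable_fun setT G ->
    measurable_fun D (fun t => (G t)%:E + (G (h - t)%R)%:E)%E.
  by move=> mG; apply: emeasurable_funD; apply: mE => //; exact: mr.
have S0 (G : R -> R) : (forall t, 0 <= G t) ->
    forall t, D t -> (0 <= (G t)%:E + (G (h - t)%R)%:E)%E.
  by move=> G0 t _; rewrite adde_ge0// lee_fin.
have I2 : (I + I = \int[mu]_(t in D) ((g t)%:E + (g (h - t)%R)%:E))%E.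
  rewrite (ge0_integralD _ mD (E0 _ g0) (mE _ mg) (E0 _ (fun t => g0 (h - t))) (mE _ (mr _ mg))).
  by rewrite rg.
have J2 : (J + J = \int[mu]_(t in D) ((F t)%:E + (F (h - t)%R)%:E))%E.
  rewrite (ge0_integralD _ mD (E0 _ F0) (mE _ mF) (E0 _ (fun t => F0 (h - t))) (mE _ (mr _ mF))).
  by rewrite rF.
have J0 : (0 <= J)%E by apply: integral_ge0 => t _; rewrite lee_fin.
have key : (I + I <= (h ^+ 2 / 2)%:E * J + (h ^+ 2 / 2)%:E * J)%E.
  rewrite -ge0_muleDr// I2 J2.
  rewrite -(ge0_integralZl_EFin _ mD (S0 _ F0) (mS _ mF) c0).
  apply: ge0_le_integral => //.
  - exact: S0.
  - exact: mS.
  - by apply: emeasurable_funM => //; exact: mS.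
  move=> t; rewrite /D/= in_itv/= => /andP[t0 th].
  rewrite -!EFinD -EFinM lee_fin /g.
  have Ft := F0 t; have Fht := F0 (h - t).
  have ht0 : 0 < h - t by rewrite subr_gt0.
  have uv : 0 <= (F t - F (h - t)) * (h - 2 * t).
    have [tt|tt] := leP t (h - t).
      rewrite mulr_ge0//; last lra.
      by rewrite subr_ge0; apply: Fdec => //; rewrite ltrBlDr ltrDl.
    rewrite mulr_le0//; last lra.
    by rewrite subr_le0; apply: Fdec => //; exact: ltW.
  have pos : 0 <= (F t + F (h - t)) * (t * (h - t)).
    by rewrite mulr_ge0 ?addr_ge0// mulr_ge0 ?ltW.
  move: (F t) (F (h - t)) pos uv => u v pos uv.
  (* The first summand is nonnegative since [t] lies between 0 and [h], the second because [F]
     decreases; this is where the constant [h ^+ 2 / 2] comes from. *)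
  rewrite -subr_ge0 (_ : _ - _ = (u + v) * (t * (h - t)) + h / 2 * ((u - v) * (h - 2 * t))).
    by rewrite addr_ge0// mulr_ge0// divr_ge0// ltW.
  by field.
rewrite leNgt; apply/negP => lt.
by have := lteD lt lt; rewrite ltNge key.
Qed.

(** Each half-line is treated by [decreasing_second_moment], the negative one after reflection. The
    origin contributes nothing to the left side, as [t ^+ 2] vanishes there. *)
Lemma unimodal_second_moment (F : R -> R) (h : R) : 0 < h ->
  measurable_fun setT F -> (forall t, 0 <= F t) -> (forall t, F t != 0 -> `|t| < h) ->
  (forall c t, 0 < c < 1 -> F t <= F (c * t)) ->
  (\int[mu]_t (t ^+ 2 * F t)%:E <= (h ^+ 2 / 2)%:E * \int[mu]_t (F t)%:E)%E.
Proof.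
move=> h0 mF F0 Fh Fc.
have Fdec (G : R -> R) : (forall c t, 0 < c < 1 -> G t <= G (c * t)) ->
    forall t u, 0 < t -> t <= u -> u < h -> G u <= G t.
  move=> Gc t u t0; rewrite le_eqVlt => /orP[/eqP ->//|tu] _.
  have u0 : 0 < u by exact: lt_trans tu.
  have tu01 : 0 < t / u < 1 by rewrite divr_gt0//= ltr_pdivrMr// mul1r.
  by have := Gc (t / u) u tu01; rewrite mulfVK// gt_eqF.
pose A : set (measurableTypeR R) := `]0, h[%classic.
pose B : set (measurableTypeR R) := [set x | A (0 - x)].
have mA : measurable A by exact: measurable_itv.
have mB : measurable B.
  have mf : measurable_fun setT (fun x : measurableTypeR R => 0 - x : measurableTypeR R).
    exact: measurable_funB.
  by rewrite -[X in measurable X]setTI; exact: mf.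
have AB : [disjoint A & B].
  apply/disj_setPS => x [] ; rewrite /B /A/= !in_itv/= => /andP[x0 _] /andP[x1 _].
  by exfalso; move: x0 x1; lra.
pose F' t := F (0 - t).
have mF' : measurable_fun setT F' by apply: (measurableT_comp mF); exact: measurable_funB.
have F'c c t : 0 < c < 1 -> F' t <= F' (c * t).
  by move=> c01; rewrite /F' !sub0r -mulrN; exact: Fc.
have mE (G : R -> R) D : measurable_fun setT G -> measurable_fun D (fun t : measurableTypeR R => (G t)%:E).
  by move=> mG; apply: measurable_funTS; exact/measurable_EFinP.
pose g t := t ^+ 2 * F t.
have mg : measurable_fun setT g by apply: measurable_funM => //; exact: measurable_funX.
have g0 t : 0 <= g t by rewrite mulr_ge0// sqr_ge0.
have -> : (\int[mu]_t (t ^+ 2 * F t)%:E = \int[mu]_(t in A `|` B) (g t)%:E)%E.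
  rewrite [RHS]integral_mkcond; apply: eq_integral => t _; rewrite patchE.
  case: ifPn => //; rewrite notin_setE => nAB; congr EFin.
  have [->|t0] := eqVneq t 0; first by rewrite expr0n mul0r.
  have [->|Ft0] := eqVneq (F t) 0; first by rewrite mulr0.
  exfalso; apply: nAB; have := Fh _ Ft0; rewrite ltr_norml => /andP[h1 h2].
  move: t0; rewrite neq_lt => /orP[t0|t0]; [right|left]; rewrite /B /A/= in_itv/=.
    by apply/andP; split; lra.
  by rewrite t0.
rewrite ge0_integral_setU//; [|exact: mE|by move=> t _; rewrite lee_fin].
apply: (@le_trans _ _ ((h ^+ 2 / 2)%:E * \int[mu]_(t in A `|` B) (F t)%:E)%E); last first.
  apply: lee_wpmul2l; first by rewrite lee_fin divr_ge0// sqr_ge0.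
  apply: ge0_subset_integral => //; [exact: measurableU|exact: mE|].
  by move=> t _; rewrite lee_fin.
rewrite ge0_integral_setU//; [|exact: mE|by move=> t _; rewrite lee_fin].
rewrite ge0_muleDr; try by apply: integral_ge0 => t _; rewrite lee_fin.
apply: leeD; first by apply: decreasing_second_moment => //; exact: Fdec.
have Br : [set x | B (0 - x)] = A.
  by apply/seteqP; split => x; rewrite /B/= opprB add0r subr0.
have := ge0_integral_reflect 0 mB mg g0; rewrite Br => <-.
have := ge0_integral_reflect 0 mB mF F0; rewrite Br => <-.
rewrite (_ : (\int[mu]_(x in A) (g (0 - x)%R)%:E)%E = (\int[mu]_(x in A) (x ^+ 2 * F' x)%:E)%E).
  apply: (decreasing_second_moment (F := F')) => //; first by move=> t; exact: F0.
  exact: (Fdec F' F'c).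
by apply: eq_integral => t _; rewrite /g /F' sub0r sqrrN.
Qed.

End moment.

Section normal_moment.
Context {R : realType} {n : nat} (L U : set 'rV[R]_n.+1) (nu : 'rV[R]_n.+1).
Variable Q : 'M[R]_(n, n.+1).
Hypotheses (latL : full_rank_lattice L) (oU : open U) (convU : convex_row U)
  (bU : bounded_row U) (pU : packing L U).
Hypotheses (nu1 : enorm nu = 1) (QQ : Q *m Q^T = 1%:M) (Qnu : Q *m nu^T = 0).
Hypothesis covH : covering (section_lattice L Q) (section_set U nu Q 0).
Hypothesis nonempty0 : section_set U nu Q 0 !=set0.

Lemma section_second_moment : exists2 h : R, 0 < h &
  dual_lattice L (h^-1 *: nu) /\
  \int[borel_lebesgue n.+1]_(x in U) (dotv x nu ^+ 2) <= h ^+ 2 / 2 * vol U.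
Proof.
have [h h0 [Lh Uh]] := section_height latL oU convU bU pU nu1 QQ Qnu covH nonempty0.
exists h => //; split => //.
have [k k0 kE] := section_integral oU bU nu1 QQ Qnu.
have mU : measurable U by exact: open_measurable_row.
have f0 t : 0 <= vol (section_set U nu Q t) by exact: vol_ge0.
have mf : measurable_fun setT (fun t : measurableTypeR R => vol (section_set U nu Q t)).
  exact: measurable_vol_section.
have fh t : vol (section_set U nu Q t) != 0 -> `|t| < h.
  move=> vt; have [s0|/set0P[y]] := eqVneq (section_set U nu Q t) set0; last exact: Uh.
  by move: vt; rewrite s0 /vol measure0 eqxx.
have fc c t : 0 < c < 1 ->
    vol (section_set U nu Q t) <= vol (section_set U nu Q (c * t)).
  exact: section_homothety covH _ _.
have := unimodal_second_moment h0 mf f0 fh fc.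
have m2 : measurable_fun setT (fun t : R => t ^+ 2) by exact: measurable_funX.
rewrite -(kE (fun t => t ^+ 2) m2 (fun t => sqr_ge0 t)).
have -> : (\int[lebesgue_measure]_t (vol (section_set U nu Q t))%:E =
    k%:E * (vol U)%:E)%E.
  rewrite -volE// -[X in (_ * X)%E]mul1e -integral_cst//.
  rewrite (kE (fun=> 1) (measurable_cst _) (fun=> ler01)).
  by apply: eq_integral => t _; rewrite mul1r.
have iU : (borel_lebesgue n.+1).-integrable U (EFin \o (fun x => dotv x nu ^+ 2)).
  apply: bounded_continuous_integrable => // x.
  apply: (@continuous_comp _ _ _ (fun x => dotv x nu) (fun u => u ^+ 2)).
    exact: continuous_dotv.
  exact: exprn_continuous.
have If : (\int[borel_lebesgue n.+1]_(x in U) (dotv x nu ^+ 2)%:E)%E \is a fin_num.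
  exact: integrable_fin_num iU.
rewrite /Rintegral -(fineK If) -!EFinM lee_fin.
by rewrite mulrCA ler_pM2l.
Qed.

End normal_moment.

(** * Covariance of a convex fundamental domain *)

Section fundamental_domain_moments.
Context {R : realType} {n : nat} (L K : set 'rV[R]_n.+1) (nu : 'rV[R]_n.+1).
Hypotheses (latL : full_rank_lattice L) (convK : convex_row K)
  (fundK : fundamental_domain L K) (nu1 : enorm nu = 1).

Let U : set 'rV[R]_n.+1 := K°.

Let oU : open U. Proof. exact: open_interior. Qed.
Let mU : measurable U. Proof. by apply: open_measurable_row. Qed.
Let UK : U `<=` K. Proof. exact: interior_subset. Qed.
Let cU : convex_row U. Proof. exact: convex_interior. Qed.
Let bU : bounded_row U. Proof. exact: fundamental_interior_bounded latL convK fundK. Qed.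

Lemma lebesgue_boundary0 : lebesgue n.+1 (K `\` U) = 0%E.
Proof.
have [Z [mZ Z0 KZ]] := fundamental_boundary_null latL convK fundK.
by apply: lebesgue_null_sub KZ _; rewrite lebesgueE.
Qed.

Lemma vol_interior_gt0 : 0 < vol U.
Proof.
rewrite -lte_fin -volE//; apply: borel_lebesgue_open_gt0 => //.
exact: fundamental_interior_nonempty latL convK fundK.
Qed.

Lemma volume_interior : volume K = vol U.
Proof.
rewrite /volume /vol; congr fine; apply/eqP; rewrite eq_le; apply/andP; split.
  have -> : K = U `|` (K `\` U) by rewrite setDUK.
  apply: le_trans (outer_measureU2 (mu_ext (borel_lebesgue n.+1)) _ _) _.
  rewrite [X in (_ + X)%E]lebesgue_boundary0 adde0.
  by rewrite [X in (X <= _)%E](lebesgueE mU).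
by rewrite -(lebesgueE mU); exact: le_lebesgue.
Qed.

Lemma Rintegral_interior (f : 'rV[R]_n.+1 -> R) : measurable_fun setT f ->
  \int[lebesgue n.+1]_(x in K) f x = \int[borel_lebesgue n.+1]_(x in U) f x.
Proof.
move=> mf; congr fine.
apply: (@integral_lebesgue_sub R n.+1 K U (EFin \o f)) => //.
- by case: fundK.
- exact: lebesgue_boundary0.
- exact/measurable_EFinP.
Qed.

Hypothesis baryK : barycenter K = 0.

Lemma continuous_integrable (f : 'rV[R]_n.+1 -> R) : continuous f ->
  (borel_lebesgue n.+1).-integrable U (EFin \o f).
Proof. exact: bounded_continuous_integrable. Qed.

Lemma integral_coord0 i : \int[borel_lebesgue n.+1]_(x in U) x 0 i = 0.
Proof.
move: baryK => /rowP/(_ i); rewrite !mxE volume_interior Rintegral_interior; last first.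
  exact: measurable_coord.
by move=> /eqP; rewrite mulf_eq0 invr_eq0 gt_eqF ?vol_interior_gt0//= => /eqP.
Qed.

Lemma integral_dotv0 w : \int[borel_lebesgue n.+1]_(x in U) dotv x w = 0.
Proof.
rewrite (Rintegral_sum_continuous mU bU).
  rewrite big1// => i _; rewrite RintegralZr//.
    by rewrite integral_coord0 mul0r.
  by apply: continuous_integrable => x; exact: coord_continuous.
move=> i x; apply: (@continuousM _ _ (fun x : 'rV[R]_n.+1 => x 0 i) (cst (w 0 i))).
  exact: coord_continuous.
exact: cst_continuous.
Qed.

Lemma Cov_dotv w :
  dotv (w *m Cov K) w = (vol U)^-1 * \int[borel_lebesgue n.+1]_(x in U) (dotv x w ^+ 2).
Proof.
have cc (i j : 'I_n.+1) : continuous (fun x : 'rV[R]_n.+1 => x 0 i * x 0 j).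
  by move=> x; apply: (@continuousM _ _ (fun x : 'rV[R]_n.+1 => x 0 i) (fun x : 'rV[R]_n.+1 => x 0 j)); exact: coord_continuous.
have CE i j : Cov K i j = (vol U)^-1 * \int[borel_lebesgue n.+1]_(x in U) (x 0 i * x 0 j).
  rewrite mxE volume_interior baryK; congr (_ * _).
  under eq_Rintegral do rewrite subr0.
  apply: (Rintegral_interior (f := fun x => x 0 i * x 0 j)).
  by apply: continuous_measurable_row; exact: cc.
have ccc (i j : 'I_n.+1) : continuous (fun x : 'rV[R]_n.+1 => x 0 i * x 0 j * (w 0 i * w 0 j)).
  move=> x; apply: (@continuousM _ _ (fun x : 'rV[R]_n.+1 => x 0 i * x 0 j) (cst (w 0 i * w 0 j))).
    exact: cc.
  exact: cst_continuous.
have -> : \int[borel_lebesgue n.+1]_(x in U) (dotv x w ^+ 2) =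
    \int[borel_lebesgue n.+1]_(x in U) (\sum_(p : 'I_n.+1 * 'I_n.+1)
      x 0 p.1 * x 0 p.2 * (w 0 p.1 * w 0 p.2)).
  apply: eq_Rintegral => x _.
  rewrite expr2 /dotv mulr_suml.
  under eq_bigr do rewrite mulr_sumr.
  by rewrite pair_bigA /=; apply: eq_bigr => p _; ring.
rewrite (Rintegral_sum_continuous mU bU) => [|p]; last exact: ccc.
rewrite mulr_sumr dotvE mxE.
under eq_bigr do rewrite mxE mulr_suml.
rewrite exchange_big pair_bigA /=; apply: eq_bigr => -[i j] _ /=.
rewrite RintegralZr//; last by apply: continuous_integrable; exact: cc.
by rewrite CE mxE; ring.
Qed.

Hypothesis tileH : hyperplane_fundamental_domain nu
  (L `&` hyperplane nu) (K `&` hyperplane nu).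

Let Q : 'M[R]_(n, n.+1) := hyperplane_frame nu.

Let QQ : Q *m Q^T = 1%:M. Proof. by case: (hyperplane_frameP nu1). Qed.
Let Qnu : Q *m nu^T = 0. Proof. by case: (hyperplane_frameP nu1). Qed.

(** A linear form has mean zero over [U], so it cannot be positive throughout. Applied to [nu] and
    [- nu], this gives points of [U] on both closed sides of the hyperplane, and the segment between
    them crosses it. *)
Lemma section0_nonempty : section_set U nu Q 0 !=set0.
Proof.
suff [x Ux x0] : exists2 x, U x & dotv x nu = 0.
  have [y xE] := frame_decomp nu1 QQ Qnu x.
  by exists y; rewrite /section_set/= -x0 -xE.
have neg (w : 'rV[R]_n.+1) : exists2 x, U x & dotv x w <= 0.
  apply: contrapT => noneg.
  have pos x : U x -> 0 < dotv x w.
    by move=> Ux; rewrite ltNge; apply/negP => xw; apply: noneg; exists x.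
  have iw : (borel_lebesgue n.+1).-integrable U (EFin \o (fun x => dotv x w)).
    by apply: continuous_integrable; exact: continuous_dotv.
  have mw : measurable_fun U (fun x => (dotv x w)%:E) by exact: measurable_int iw.
  have w0 : (\int[borel_lebesgue n.+1]_(x in U) `|(dotv x w)%:E| = 0)%E.
    transitivity (\int[borel_lebesgue n.+1]_(x in U) (dotv x w)%:E)%E.
      by apply: eq_integral => x /set_mem/pos/ltW; rewrite -lee_fin => /gee0_abs.
    by rewrite -(fineK (integrable_fin_num mU iw)) [X in X%:E](integral_dotv0 w).
  have [N [mN N0 UN]] := (ae_eq_integral_abs _ mU mw).1 w0.
  have : (borel_lebesgue n.+1 U <= 0)%E.
    rewrite -N0; apply: le_measure; rewrite ?inE// => x Ux; apply: UN => /= /(_ Ux) [] x0.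
    by have := pos _ Ux; rewrite x0 ltxx.
  by rewrite volE// lee_fin leNgt vol_interior_gt0.
have [x Ux xnu] := neg nu; have [y Uy] := neg (- nu).
rewrite dotvNr oppr_le0 => ynu.
have [x0|x0] := eqVneq (dotv x nu) 0; first by exists x.
have xlt0 : dotv x nu < 0 by rewrite lt_neqAle x0.
pose s := - dotv x nu / (dotv y nu - dotv x nu).
have d0 : 0 < dotv y nu - dotv x nu by lra.
exists (homothety x s y).
  apply: cU => //; rewrite /s; apply/andP; split; first by rewrite divr_ge0 ?ltW//; lra.
  by rewrite ler_pdivrMr// mul1r; lra.
by rewrite /homothety dotvDl dotvZl dotvDl dotvNl /s mulfVK ?subrr ?gt_eqF.
Qed.

(** The tiling hypothesis covers the hyperplane by translates of the section of [K]. Dilations about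
    a point [p] of the central section of [U] send the section of [K] into that of [U], so the two
    differ by a subset of the null set [Z] of dimension [n]. *)
Lemma section0_covering : covering (section_lattice L Q) (section_set U nu Q 0).
Proof.
have [p Up] := section0_nonempty.
pose U0 := section_set U nu Q 0.
have U0E y : U0 y <-> U (y *m Q) by rewrite /U0 /section_set/= scale0r add0r.
pose Z := radial_hull p U0 `\` U0.
have mU0 : measurable U0 by exact: measurable_section.
have hQ a s b : homothety a s b *m Q = homothety (a *m Q) s (b *m Q).
  by rewrite /homothety mulmxDl -scalemxAl mulmxBl.
have cU0 : convex_row U0.
  move=> a b s /U0E Ua /U0E Ub s01; apply/U0E; rewrite hQ; exact: cU.
have mZ : measurable Z by apply: measurableD => //; exact: measurable_radial_hull.
have Z0 : borel_lebesgue n Z = 0%E.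
  apply: radial_hull_null => //.
  apply: borel_lebesgue_bounded => //.
  exact: bounded_section.
pose K0 : set 'rV[R]_n := [set y : 'rV[R]_n | K (y *m Q)].
have K0h : K0 `<=` radial_hull p U0.
  apply: sub_radial_hull; move=> z s Kz s01.
  apply/U0E; rewrite hQ; apply: homothety_interior; [exact: convK| |exact: Kz|exact: s01].
  exact/U0E.
have KZ y : K (y *m Q) -> ~ U0 y -> Z y.
  by move=> Ky nUy; exact: (conj (K0h y Ky) nUy).
have cL := countable_section_lattice latL QQ.
rewrite /covering -lebesgueE; last exact: measurable_uncovered.
have [_ [T0 _]] := tileH.
apply: (@lebesgue_null_sub _ _ _ (hyperplane_pull nu (hyperplane nu `\`
    \bigcup_(l in L `&` hyperplane nu) translate l (K `&` hyperplane nu)) `|`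
   \bigcup_(l in section_lattice L Q) [set x | Z (x - l)])).
  move=> y nU.
  have [[l Ll Ky]|nK] := pselect (exists2 l, section_lattice L Q l & K ((y - l) *m Q)).
    by right; exists l => //=; apply: KZ => //; exact: nU.
  left; split=> /=.
    by rewrite /hyperplane/= dotvE -mulmxA -/Q Qnu mulmx0 mxE.
  move=> [l [Ll lnu] /translateE[Kl _]]; apply: nK.
  have [a lE] := frame_decomp nu1 QQ Qnu l.
  move: lE; rewrite lnu scale0r add0r => lE.
  by exists a; [rewrite /section_lattice/= -lE|rewrite mulmxBl -lE].
apply: lebesgue_null_setU; first exact: T0.
apply: lebesgue_null_bigcup => // l Ll.
rewrite lebesgueE; last exact: measurable_translate.
by rewrite -Z0; exact: borel_lebesgue_translate.
Qed.

Lemma normal_second_moment : exists2 h : R, 0 < h &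
  dual_lattice L (h^-1 *: nu) /\ dotv (nu *m Cov K) nu <= h ^+ 2 / 2.
Proof.
have pU := fundamental_interior_packing latL fundK.
have [h h0 [Lh hU]] := section_second_moment latL oU cU bU pU nu1 QQ Qnu
  section0_covering section0_nonempty.
exists h => //; split => //.
by rewrite Cov_dotv mulrC ler_pdivrMr ?vol_interior_gt0.
Qed.

End fundamental_domain_moments.

(** * Characters and the spectrum of the torus *)

Section directional_derivative.
Context {R : realType} {n : nat}.
Implicit Types (f g : 'rV[R]_n -> R) (x v : 'rV[R]_n).

Lemma line_quotient f x v (t0 : R) :
  (fun h : R => h^-1 *: (((fun t : R => f (x + t *: v)) \o shift t0) (h *: (1 : R)) - f (x + t0 *: v))) =
  (fun h : R => h^-1 *: ((f \o shift (x + t0 *: v)) (h *: v) - f (x + t0 *: v))).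
Proof.
apply/funext => h /=; congr (_ *: (f _ - _)).
by rewrite scaler1 scalerDl addrCA addrA [in RHS]addrC [h *: v + x]addrC -addrA [t0 *: v + _]addrC addrA.
Qed.

(** Reduces directional derivatives to one variable: both sides have the same difference
    quotient. *)
Lemma is_derive_line f x v (t0 df : R) :
  is_derive t0 1 (fun t : R => f (x + t *: v)) df <->
  is_derive (x + t0 *: v) v f df.
Proof.
by split=> -[h1 h2]; split; move: h1 h2; rewrite /derivable /derive line_quotient.
Qed.

Lemma is_derive_at f x v (df : R) :
  is_derive (0 : R) 1 (fun t : R => f (x + t *: v)) df -> is_derive x v f df.
Proof. by move/is_derive_line; rewrite scale0r addr0. Qed.

Lemma derive_translate f v l : (forall x, f (x + l) = f x) ->
  forall x, 'D_v f (x + l) = 'D_v f x.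
Proof.
move=> fl x; rewrite /derive.
rewrite (_ : (fun h => h^-1 *: ((f \o shift (x + l)) (h *: v) - f (x + l))) =
             (fun h => h^-1 *: ((f \o shift x) (h *: v) - f x)))//.
by apply/funext => h /=; rewrite addrA !fl.
Qed.

Lemma mean_value_line f x v (t : R) : 0 < t ->
  (forall y, derivable f y v) ->
  exists2 c, 0 < c < t & f (x + t *: v) - f x = 'D_v f (x + c *: v) * t.
Proof.
move=> t0 df.
pose phi s := f (x + s *: v); pose dphi s := 'D_v f (x + s *: v).
have dP s : is_derive (s : R) 1 phi (dphi s).
  by apply/is_derive_line; exact: (DeriveDef (df _) erefl).
have cphi : {within `[0, t], continuous phi}.
  apply: continuous_subspaceT => s; apply: differentiable_continuous.
  by apply/derivable1_diffP; case: (dP s).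
have [c cI cE] := MVT t0 (fun s _ => dP s) cphi.
exists c; first by move: cI; rewrite in_itv.
by move: cE; rewrite /phi scale0r addr0 subr0.
Qed.

End directional_derivative.

Section character.
Context {R : realType} {n : nat}.
Implicit Types (xi x v : 'rV[R]_n) (th : R).

(** The real form of a character. The phase gives the sine too, so the family is stable under
    derivation, which adds [pi / 2] to the phase, and products are half sums of its members. *)
Definition chi xi th x : R := cos (2 * pi * dotv x xi + th).

Lemma is_derive_chi xi th x v :
  is_derive x v (chi xi th) (2 * pi * dotv v xi * chi xi (th + pi / 2) x).
Proof.
apply: is_derive_at.
have -> : (fun t : R => chi xi th (x + t *: v)) =
    cos \o (fun t : R => t * (2 * pi * dotv v xi) + (2 * pi * dotv x xi + th)).
  by apply/funext => t; rewrite /chi /= dotvDl dotvZl; congr cos; ring.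
set c := 2 * pi * dotv v xi; set d := 2 * pi * dotv x xi + th.
have h1 : is_derive (0 : R) 1 (fun t : R => t * c + d) c.
  have := is_deriveD (is_deriveZ c (is_derive_id (0 : R) (1 : R))) (is_derive_cst d (0 : R) (1 : R)).
  rewrite addr0 scaler1; congr is_derive.
  by apply/funext => t; rewrite [RHS]addrC [LHS]addrC mulrC.
apply: (is_derive_eq (is_derive1_comp (is_derive_cos _) h1)).
rewrite mul0r add0r /chi addrA cosDpihalf.
by rewrite mulrC.
Qed.

Lemma continuous_chi xi th : continuous (chi xi th).
Proof.
move=> x; apply: (@continuous_comp _ _ _ (fun x => 2 * pi * dotv x xi + th) cos); last first.
  exact: continuous_cos.
have h1 : {for x, continuous (fun x => 2 * pi * dotv x xi)}.
  apply: (@continuousM _ _ (cst (2 * pi)) (fun x => dotv x xi)); first exact: cst_continuous.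
  exact: continuous_dotv.
have h2 : {for x, continuous (fun _ : 'rV[R]_n => th)} by exact: cst_continuous.
exact: (continuousD h1 h2).
Qed.

Lemma cosD2pi_int (a : R) (k : int) : cos (a + 2 * pi * k%:~R) = cos a.
Proof.
have N (b : R) (m : nat) : cos (b + 2 * pi * m%:R) = cos b.
  elim: m => [|m IHm]; first by rewrite mulr0 addr0.
  have -> : b + 2 * pi * m.+1%:R = b + 2 * pi * m%:R + pi *+ 2.
    by rewrite -[m.+1%:R]natr1 mulr2n; ring.
  by rewrite cosD2pi.
case: k => k; first exact: N.
by rewrite NegzE intrN mulrN -[LHS](N _ k.+1) subrK.
Qed.

Lemma chi_periodic L xi th : dual_lattice L xi -> forall x l, L l ->
  chi xi th (x + l) = chi xi th x.
Proof.
move=> Lxi x l Ll; have /intrP[k kE] := Lxi l Ll.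
rewrite /chi dotvDl (dotvC l) kE mulrDr addrAC; exact: cosD2pi_int.
Qed.

Lemma chi_mul xi th eta ph x : chi xi th x * chi eta ph x =
  (chi (xi + eta) (th + ph) x + chi (xi - eta) (th - ph) x) / 2.
Proof.
rewrite /chi dotvDr dotvDr dotvNr.
set a := dotv x xi; set b := dotv x eta.
set A := 2 * pi * a + th; set B := 2 * pi * b + ph.
rewrite (_ : 2 * pi * (a + b) + (th + ph) = A + B); last by rewrite /A /B; ring.
rewrite (_ : 2 * pi * (a - b) + (th - ph) = A - B); last by rewrite /A /B; ring.
by rewrite (cosD A B) (cosB A B); field.
Qed.

Lemma chi_pi xi th x : chi xi (th + pi) x = - chi xi th x.
Proof. by rewrite /chi addrA cosDpi. Qed.

End character.

Lemma continuous_mul (R : realType) n (f g : 'rV[R]_n -> R) :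
  continuous f -> continuous g -> continuous (fun x => f x * g x).
Proof. by move=> cf cg x; apply: continuousM; [exact: cf|exact: cg]. Qed.

Lemma continuous_add (R : realType) n (f g : 'rV[R]_n -> R) :
  continuous f -> continuous g -> continuous (fun x => f x + g x).
Proof. by move=> cf cg x; exact: (continuousD (cf x) (cg x)). Qed.

Lemma continuous_sub (R : realType) n (f g : 'rV[R]_n -> R) :
  continuous f -> continuous g -> continuous (fun x => f x - g x).
Proof. by move=> cf cg x; exact: (continuousB (cf x) (cg x)). Qed.

(** * Eigenfunctions are orthogonal to characters of another eigenvalue *)

Section fourier.
Context {R : realType} {n : nat} (L U : set 'rV[R]_n).
Hypotheses (latL : full_rank_lattice L) (mU : measurable U)
  (bU : bounded_row U) (pU : packing L U) (cU : covering L U).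

Let I (f : 'rV[R]_n -> R) := \int[borel_lebesgue n]_(x in U) f x.

Let iU (f : 'rV[R]_n -> R) : continuous f ->
  (borel_lebesgue n).-integrable U (EFin \o f).
Proof. exact: bounded_continuous_integrable. Qed.

Lemma periodic_bounded (f : 'rV[R]_n -> R) : continuous f -> Defs.periodic L f ->
  exists M, forall x, `|f x| <= M.
Proof.
move=> cf fper; have [r rP] := lattice_ball_cover latL.
have [M HM] : exists M, forall x, ball 0 r x -> `|f x| <= M.
  by apply: continuous_bounded_row => //; exists r.
exists M => x; have [l Ll xl] := rP x.
by rewrite -(subrK l x) (fper l _ Ll); exact: HM.
Qed.

(* Difference quotients of a periodic function have integral zero. *)
Lemma integral_derive0 (g : 'rV[R]_n -> R) v : continuous g -> Defs.periodic L g ->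
  (forall x, derivable g x v) -> continuous (fun x => 'D_v g x) ->
  I (fun x => 'D_v g x) = 0.
Proof.
move=> cg gper dg cdg.
pose h (k : nat) : R := k.+1%:R^-1.
have h0 k : 0 < h k by rewrite invr_gt0.
pose F (k : nat) x := (g (x + h k *: v) - g x) / h k.
have cgv k : continuous (fun x => g (x + h k *: v)).
  move=> x; apply: (@continuous_comp _ _ _ (fun x => x + h k *: v) g); last exact: cg.
  have h1 : {for x, continuous (fun x : 'rV[R]_n => x)} by exact: cvg_id.
  have h2 : {for x, continuous (fun x : 'rV[R]_n => h k *: v)} by exact: cst_continuous.
  exact: (continuousD h1 h2).
have cgB k : continuous (fun x => g (x + h k *: v) - g x).
  by move=> x; exact: (continuousB (cgv k x) (cg x)).
have IF k : I (F k) = 0.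
  have iB := iU (cgB k).
  rewrite /I /F RintegralZr//.
  rewrite RintegralB//; [|exact: iU|exact: iU].
  rewrite (Rintegral_periodic_translate latL mU pU cU) ?subrr ?mul0r//.
    exact: continuous_measurable_row.
  by move=> x l Ll; exact: gper.
have dper : Defs.periodic L (fun x => 'D_v g x).
  by move=> l x Ll; apply: derive_translate => y; exact: gper.
have [M HM] := periodic_bounded cdg dper.
(* By the mean value theorem a difference quotient is a value of the derivative, which is periodic
   and continuous, hence bounded; this is the domination needed for the limit. *)
have FM k x : `|F k x| <= M.
  have [c _] := mean_value_line x (h0 k) dg; rewrite /F => ->.
  by rewrite mulfK ?gt_eqF.
have mF k : measurable_fun setT (F k).
  by apply: measurable_funM => //; apply: continuous_measurable_row; exact: cgB.
have Fcvg x : F k x @[k --> \oo] --> 'D_v g x.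
  have := dg x; rewrite /derivable => /cvg_ex[d dd].
  have -> : 'D_v g x = d by apply: cvg_lim dd.
  have /cvg_at_rightP/(_ h) := cvg_dnbhs_at_right dd.
  move=> /(_ (conj h0 cvg_harmonic)) H.
  rewrite (_ : (fun k => F k x) = fun k => (h k)^-1 *: ((g \o shift x) (h k *: v) - g x))//.
  by apply/funext => k; rewrite /F /= [x + _]addrC mulrC.
have mEF k : measurable_fun U (fun x => (F k x)%:E).
  by apply/measurable_EFinP; exact: measurable_funTS.
have mED : measurable_fun U (fun x => ('D_v g x)%:E).
  by apply/measurable_EFinP; apply: measurable_funTS; exact: continuous_measurable_row.
have FEcvg x : (F k x)%:E @[k --> \oo] --> ('D_v g x)%:E.
  by apply: cvg_EFin; [exact: nearW|exact: Fcvg].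
have [_ _] := @dominated_convergence _ _ R (borel_lebesgue n) U mU
  (fun k x => (F k x)%:E) (fun x => ('D_v g x)%:E) (fun=> M%:E)
  mEF mED (aeW _ (fun x _ => FEcvg x)) (iU (@cst_continuous _ _ M))
  (aeW _ (fun x k _ => FM k x)).
rewrite (_ : (fun k => _) = fun=> 0%E).
  move=> /cvg_lim => /(_ (@ereal_hausdorff _)); rewrite lim_cst// /I /Rintegral => <-.
  by [].
apply/funext => k; have := IF k; rewrite /I /Rintegral => IFk.
rewrite -[LHS]fineK ?IFk//.
by apply: integrable_fin_num => //; exact: bounded_integrable (mF k) (FM k).
Qed.

(* Green's identity: integrate the derivatives of
   [partial i f * chi - f * partial i chi] and sum over [i]. *)
Lemma orthogonal_eigenfunction (f : 'rV[R]_n -> R) a xi th :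
  Defs.periodic L f -> C2 f -> (forall x, - laplacian f x = a * f x) ->
  dual_lattice L xi -> a != 4 * pi ^+ 2 * dotv xi xi ->
  I (fun x => f x * chi xi th x) = 0.
Proof.
move=> fper [[cf cf1] cf2] fa Lxi axi.
pose e i : 'rV[R]_n := delta_mx 0 i.
have c1 i x : derivable f x (e i) by exact: (cf1 i).1.
have c2 i x : derivable (partial i f) x (e i) by exact: ((cf2 i).2 i).1.
have chi_d b c i x : is_derive x (e i) (chi b c) (2 * pi * b 0 i * chi b (c + pi / 2) x).
  by rewrite -(dotv_delta b i); exact: is_derive_chi.
(* In the derivative of [g i] the products of first derivatives cancel; the second derivative of the
   character returns it with its sign changed, whence [dg i]. *)
pose g i x := partial i f x * chi xi th x - f x * (2 * pi * xi 0 i * chi xi (th + pi / 2) x).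
pose dg i x := partial i (partial i f) x * chi xi th x + 4 * pi ^+ 2 * xi 0 i ^+ 2 * (f x * chi xi th x).
have gd i x : is_derive x (e i) (g i) (dg i x).
  have d1 := is_deriveM (DeriveDef (c2 i x) erefl) (chi_d xi th i x).
  have d2 := is_deriveM (DeriveDef (c1 i x) erefl)
    (is_deriveZ (2 * pi * xi 0 i) (chi_d xi (th + pi / 2) i x)).
  apply: (is_derive_eq (is_deriveB d1 d2)).
  rewrite -(addrA th) -splitr chi_pi /dg /= /partial /GRing.scale /=.
  ring.
have cchi c b : continuous (fun x => c * chi xi b x).
  by apply: continuous_mul; [exact: cst_continuous|exact: continuous_chi].
have cgi i : continuous (g i).
  apply: continuous_sub; apply: continuous_mul => //.
    exact: (cf1 i).2.
  exact: continuous_chi.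
have cfchi : continuous (fun x => f x * chi xi th x).
  by apply: continuous_mul => //; exact: continuous_chi.
have cdg i : continuous (dg i).
  apply: continuous_add; apply: continuous_mul => //.
  - exact: ((cf2 i).2 i).2.
  - exact: continuous_chi.
  - exact: cst_continuous.
have gper i : Defs.periodic L (g i).
  move=> l x Ll; rewrite /g (chi_periodic _ Lxi)// (chi_periodic _ Lxi)// (fper _ _ Ll).
  by rewrite {1}/partial (@derive_translate _ _ f (e i) l)// => y; exact: fper.
have Idg i : I (dg i) = 0.
  rewrite -[RHS](integral_derive0 (cgi i) (gper i) (v := e i)).
  - by apply: eq_Rintegral => x _; case: (gd i x).
  - by move=> x; case: (gd i x).
  - rewrite (_ : (fun x => _) = dg i)//; apply/funext => x; by case: (gd i x).
have : \sum_i I (dg i) = 0 by rewrite big1.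
rewrite /I -(Rintegral_sum_continuous mU bU)//.
have sE x : \sum_i dg i x = (4 * pi ^+ 2 * dotv xi xi - a) * (f x * chi xi th x).
  rewrite /dg big_split/= -!mulr_suml -[X in X * chi _ _ _ + _]opprK.
  rewrite -[\sum_i partial _ _ x]/(laplacian f x) fa -mulr_sumr /dotv.
  under [X in 4 * pi ^+ 2 * X]eq_bigr do rewrite expr2.
  by ring.
under eq_Rintegral do rewrite sE.
rewrite RintegralZl//; last exact: iU.
by move/eqP; rewrite mulf_eq0 subr_eq0 eq_sym (negbTE axi) => /eqP.
Qed.

End fourier.

Lemma cos_near_int (R : realType) (s t : R) : 0 < s <= 1 / 2 ->
  cos (2 * pi * s) < cos (2 * pi * t) -> exists k : int, `|t - k%:~R| < s.
Proof.
move=> /andP[s0 s2] st; have [k kt] := nearest_int t; exists k.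
set u := t - k%:~R in kt *.
have p0 := pi_gt0 R.
have u2 : `|u| <= 1 / 2 by rewrite ler_norml; case/andP: kt => -> /ltW.
have tE : cos (2 * pi * t) = cos (2 * pi * `|u|).
  rewrite -(cosD2pi_int (2 * pi * t) (- k)) -mulrDr rmorphN /= -/u.
  by case: (ler0P u) => // _; rewrite mulrN cosN.
have I0 (r : R) : 0 <= r -> r <= 1 / 2 -> 2 * pi * r \in `[0, pi].
  by move=> r0 r2; rewrite in_itv /=; apply/andP; split; nra.
move: st; rewrite tE ltr_cos ?I0// ?ltW//.
by rewrite ltr_pM2l// mulr_gt0.
Qed.

Lemma continuous_sum_row (R : realType) n (J : finType) (F : J -> 'rV[R]_n -> R) :
  (forall i, continuous (F i)) -> continuous (fun x => \sum_i F i x).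
Proof.
move=> cF.
have H (s : seq J) : continuous (fun x => \sum_(i <- s) F i x).
  elim: s => [|i s IHs].
    rewrite (_ : (fun _ => _) = cst 0); last by apply/funext => x; rewrite big_nil.
    exact: cst_continuous.
  under eq_fun do rewrite big_cons.
  exact: continuous_add.
exact: H.
Qed.

(** By Bernoulli's inequality the powers of [a / d = 1 + t] grow at least linearly. *)
Lemma geometric_domination (R : realType) (a d P Q : R) : 0 < d < a -> 0 < P ->
  ~ (forall m, P * a ^+ m <= Q * d ^+ m).
Proof.
move=> /andP[d0 da] P0 H.
pose t := (a - d) / d.
have t0 : 0 < t by rewrite divr_gt0 ?subr_gt0.
have aE : a = d * (1 + t) by rewrite /t; field; rewrite gt_eqF.
have bern m : 1 + m%:R * t <= (1 + t) ^+ m.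
  elim: m => [|m IHm]; first by rewrite mul0r addr0 expr0.
  rewrite exprS -natr1; have m0 : 0 <= m%:R :> R by [].
  apply: (@le_trans _ _ ((1 + t) * (1 + m%:R * t))); first nra.
  by rewrite ler_pM2l// addr_gt0.
have PQ m : P * (1 + m%:R * t) <= Q.
  have dm : 0 < d ^+ m by rewrite exprn_gt0.
  rewrite -(ler_pM2r dm); apply: le_trans (H m).
  have -> : P * a ^+ m = P * (1 + t) ^+ m * d ^+ m by rewrite [in LHS]aE exprMn; ring.
  by rewrite (ler_pM2r dm) (ler_pM2l P0).
have := PQ (Num.truncn (Q / (P * t))).+1; rewrite leNgt => /negP; apply.
have Pt0 : 0 < P * t := mulr_gt0 P0 t0.
have := truncnS_gt (Q / (P * t)); rewrite (ltr_pdivrMr _ _ Pt0) => h; lra.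
Qed.

Section dual_basis.
Context {R : realType} {n : nat} (B : 'M[R]_n).
Hypothesis uB : B \in unitmx.

Definition dual_basis (i : 'I_n) : 'rV[R]_n := row i (invmx B)^T.

Lemma dotv_dual_basis x i : dotv x (dual_basis i) = (x *m invmx B) 0 i.
Proof. by rewrite mxE; apply: eq_bigr => j _; rewrite !mxE. Qed.

Lemma dual_latticeD (L : set 'rV[R]_n) xi eta : dual_lattice L xi ->
  dual_lattice L eta -> dual_lattice L (xi + eta).
Proof. by move=> h1 h2 l Ll; rewrite dotvDl rpredD ?h1 ?h2. Qed.

Lemma dual_latticeN (L : set 'rV[R]_n) xi : dual_lattice L xi ->
  dual_lattice L (- xi).
Proof. by move=> h1 l Ll; rewrite dotvNl rpredN h1. Qed.

Lemma dual_basis_dual i :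
  dual_lattice (range (fun z : 'rV[int]_n => map_mx intr z *m B)) (dual_basis i).
Proof.
move=> _ [z _ <-]; rewrite dotvC dotv_dual_basis mulmxK// mxE.
exact: intr_int.
Qed.

End dual_basis.

(** * Completeness of the characters *)

Section completeness.
Context {R : realType} {n : nat} (L U : set 'rV[R]_n).
Hypotheses (latL : full_rank_lattice L) (oU : open U) (U0 : U !=set0)
  (bU : bounded_row U) (pU : packing L U) (cU : covering L U).

Let mU : measurable U. Proof. exact: open_measurable_row. Qed.

Let I (f : 'rV[R]_n -> R) := \int[borel_lebesgue n]_(x in U) f x.

Let iU (f : 'rV[R]_n -> R) : continuous f ->
  (borel_lebesgue n).-integrable U (EFin \o f).
Proof. exact: bounded_continuous_integrable. Qed.

(** [G] may miss no period but its given point need not be in [U]: the integral is unchanged by the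
    translation that brings [x0] to a point of [U], and then an open nonempty set is measured. *)
Lemma periodic_open_integral_gt0 (G : set 'rV[R]_n) : open G -> G !=set0 ->
  (forall x l, L l -> G x -> G (x + l)) -> 0 < I \1_G.
Proof.
move=> oG [x0 Gx0] Gper; have [p Up] := U0.
have mG : measurable G by exact: open_measurable_row.
pose v := x0 - p.
have iper x l : L l -> \1_G (x + l) = \1_G x :> R.
  move=> Ll; rewrite !indicE; congr (nat_of_bool _)%:R.
  apply/idP/idP; rewrite !inE => h; last exact: Gper.
  by rewrite -(addrK l x); apply: Gper => //; exact: latticeN.
rewrite /I -(Rintegral_periodic_translate latL mU pU cU v) //; last first.
pose Gv : set 'rV[R]_n := [set y | G (y + v)].
have oGv : open Gv by exact: open_translate.
have mGv : measurable Gv by exact: open_measurable_row.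
have oW : open (Gv `&` U) by exact: openI.
have W0 : Gv `&` U !=set0 by exists p; split => //; rewrite /Gv /= /v addrC subrK.
rewrite /Rintegral -[X in _ < fine X]/(\int[borel_lebesgue n]_(x in U) (\1_Gv x)%:E)%E.
rewrite integral_indic// fine_gt0//; apply/andP; split.
  exact: borel_lebesgue_open_gt0.
apply: le_lt_trans (period_domain_finite mU bU).
by apply: le_measure; rewrite ?inE//; exact: measurableI.
Qed.

(* The powers of the trigonometric polynomial [psi] concentrate at [x0], its only
   maximum modulo [L], while [f * psi ^+ m] keeps integral zero. *)
Lemma periodic_orthogonal_le0 (f : 'rV[R]_n -> R) : continuous f ->
  Defs.periodic L f ->
  (forall xi th, dual_lattice L xi -> I (fun x => f x * chi xi th x) = 0) ->
  forall x0, f x0 <= 0.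
Proof.
move=> cf fper f0 x0; rewrite leNgt; apply/negP => fx0.
have [B uB LE] := latL.
pose b := dual_basis B.
have Lb i : dual_lattice L (b i) by rewrite LE; exact: dual_basis_dual.
(* Each of the [n] terms [1 - cos] is at most 2, so this [c] keeps [psi] between 0 and 1; [n.+1]
   covers the case [n = 0]. *)
pose c : R := (2 * n.+1%:R)^-1.
have c0 : 0 < c by rewrite invr_gt0 mulr_gt0.
pose ph i := - (2 * pi * dotv x0 (b i)).
(* This form, a constant plus characters, serves orthogonality; the form in [psiE] shows that the
   maximum 1 is attained at [x0]. *)
pose psi x := 1 - n%:R * c + \sum_i c * chi (b i) (ph i) x.
have psiE x : psi x = 1 - c * \sum_i (1 - cos (2 * pi * dotv (x - x0) (b i))).
  rewrite /psi sumrB sumr_const card_ord mulrBr opprB addrA -mulr_sumr.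
  rewrite [n%:R * c]mulrC addrAC; congr (_ + _ * _).
  apply: eq_bigr => i _; rewrite /chi /ph; congr cos.
  by rewrite dotvDl dotvNl mulrBr.
have cpsi : continuous psi.
  apply: continuous_add; first exact: cst_continuous.
  apply: continuous_sum_row => i; apply: continuous_mul; first exact: cst_continuous.
  exact: continuous_chi.
have psi_ge0 x : 0 <= psi x.
  rewrite psiE subr_ge0.
  apply: (@le_trans _ _ (c * \sum_(i < n) 2)).
    rewrite ler_pM2l//; apply: ler_sum => i _.
    have := cos_max (2 * pi * dotv (x - x0) (b i)); rewrite ler_norml => /andP[h _]; lra.
  rewrite sumr_const card_ord /c -[2 *+ n]mulr_natr mulrC ler_pdivrMr ?mulr_gt0//.
  by rewrite mul1r ler_pM2l// ler_nat.
have psi_per : Defs.periodic L psi.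
  move=> l x Ll; rewrite /psi; congr (_ + _).
  by apply: eq_bigr => i _; rewrite (chi_periodic _ (Lb i)).
have psi_x0 : psi x0 = 1.
  rewrite psiE subrr big1 ?mulr0 ?subr0// => i _.
  by rewrite dotv0l mulr0 cos0 subrr.
have psi_pow m : continuous (fun x => psi x ^+ m).
  move=> x; apply: (@continuous_comp _ _ _ psi (fun u => u ^+ m)); first exact: cpsi.
  exact: exprn_continuous.
(* One more factor [psi] replaces the character by a combination of characters of the dual vectors
   [xi], [xi + b i] and [xi - b i], so the induction ranges over all [xi] and [th]. *)
have orth m xi th : dual_lattice L xi -> I (fun x => f x * psi x ^+ m * chi xi th x) = 0.
  elim: m xi th => [|m IHm] xi th Lxi.
    by rewrite -[RHS](f0 xi th Lxi); apply: eq_Rintegral => x _; rewrite mulr1.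
  have cm eta h : continuous (fun x => f x * psi x ^+ m * chi eta h x).
    by apply: continuous_mul; [exact: continuous_mul|exact: continuous_chi].
  pose g a eta h x := a * (f x * psi x ^+ m * chi eta h x).
  have cgc a eta h : continuous (g a eta h).
    by apply: continuous_mul; [exact: cst_continuous|exact: cm].
  have Ig a eta h : dual_lattice L eta -> I (g a eta h) = 0.
    move=> Leta; rewrite /I /g RintegralZl//; last exact: iU.
    by rewrite [X in a * X](IHm _ _ Leta) mulr0.
  pose F i x := g (c / 2) (xi + b i) (th + ph i) x + g (c / 2) (xi - b i) (th - ph i) x.
  have cF i : continuous (F i) by exact: continuous_add.
  transitivity (I (fun x => g (1 - n%:R * c) xi th x + \sum_i F i x)).
    apply: eq_Rintegral => x _.
    rewrite exprSr [X in _ * (_ * X)]/psi [X in f x * X * _]mulrDr mulrDr mulrDl.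
    congr (_ + _); first by rewrite /g; ring.
    rewrite mulr_sumr mulr_sumr mulr_suml; apply: eq_bigr => i _.
    rewrite /F /g -mulrDr -[X in _ = c / 2 * X]mulrDr.
    transitivity (c * (f x * psi x ^+ m * (chi xi th x * chi (b i) (ph i) x))); first ring.
    by rewrite chi_mul; field.
  have iS : (borel_lebesgue n).-integrable U (EFin \o (fun x => \sum_i F i x)).
    by apply: iU; exact: continuous_sum_row.
  rewrite /I RintegralD//; last exact: iU.
  rewrite [X in X + _](Ig _ _ _ Lxi) add0r (Rintegral_sum_continuous mU bU)// big1// => i _.
  rewrite /F RintegralD//; try exact: iU.
  have L1 := dual_latticeD Lxi (Lb i).
  have L2 := dual_latticeD Lxi (dual_latticeN (Lb i)).
  by rewrite [X in X + _](Ig _ _ _ L1) add0r; exact: Ig.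
pose e := f x0 / 2.
have e0 : 0 < e by rewrite divr_gt0.
have [eta [eta0 eta1 etaP]] : exists eta, [/\ 0 < eta, eta < 1 & forall x, 1 - eta < psi x -> e <= f x].
  have : nbhs x0 [set y | e < f y].
    apply: (cf x0 [set y | e < y]); apply: open_nbhs_nbhs; split; first exact: open_gt.
    by rewrite /= /e; lra.
  move=> /nbhs_ballP[r /= r0 rP].
  (* If the coordinates of [x - x0] in the basis [B] are within [s] of integers, then [x] is within
     [r] of [x0] modulo [L]; [cos_near_int] asks for [s <= 1 / 2]. *)
  pose s := Num.min (1 / 2) (r / (2 * mx_l1 B)).
  have l0 := mx_l1_gt0 B.
  have s0 : 0 < s by rewrite lt_min divr_gt0//= divr_gt0// mulr_gt0.
  have s2 : s <= 1 / 2 by rewrite ge_min lexx.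
  have sr : mx_l1 B * s < r.
    have : s <= r / (2 * mx_l1 B) by rewrite ge_min lexx orbT.
    rewrite ler_pdivlMr ?mulr_gt0// => h; nra.
  have cs : cos (2 * pi * s) < 1.
    have p0 := pi_gt0 R.
    have I1 : 2 * pi * s \in `[0, pi] by rewrite in_itv /=; apply/andP; split; nra.
    have I2 : (0 : R) \in `[0, pi] by rewrite in_itv /= lexx ltW.
    by rewrite -[X in _ < X]cos0 (ltr_cos I2 I1) mulr_gt0// mulr_gt0.
  have cs1 : -1 <= cos (2 * pi * s).
    by have := cos_max (2 * pi * s); rewrite ler_norml => /andP[].
  have c2 : c <= 1 / 2.
    by rewrite /c div1r lef_pV2 ?posrE ?mulr_gt0// ler_peMr// ler1n.
  (* Since [c <= 1 / 2] and [1 - cos] is at most 2, the division by 2 gives [eta < 1]. *)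
  exists (c * (1 - cos (2 * pi * s)) / 2); split.
  - by rewrite divr_gt0// mulr_gt0// subr_gt0.
  - by nra.
  move=> x; rewrite psiE => hx.
  have hS : \sum_i (1 - cos (2 * pi * dotv (x - x0) (b i))) < 1 - cos (2 * pi * s).
    by rewrite -(ltr_pM2l c0); nra.
  have : forall i, exists k : int, `|dotv (x - x0) (b i) - k%:~R| < s.
    move=> i; apply: cos_near_int; first by rewrite s0.
    have : 1 - cos (2 * pi * dotv (x - x0) (b i)) < 1 - cos (2 * pi * s).
      apply: le_lt_trans hS; rewrite (bigD1 i)//= lerDl; apply: sumr_ge0 => j _.
      by have := cos_max (2 * pi * dotv (x - x0) (b j)); rewrite ler_norml subr_ge0 => /andP[].
    by rewrite ltrD2l ltrN2.
  move=> /choice[k kP].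
  pose l := map_mx intr (\row_i k i) *m B.
  have Ll : L l by rewrite LE; exists (\row_i k i).
  rewrite -(subrK l x) (fper l _ Ll); apply: ltW; apply: rP; apply/row_ballE; split => // j.
  rewrite distrC.
  have -> : (x - l) 0 j - x0 0 j = ((x - x0 - l) *m invmx B *m B) 0 j.
    by rewrite mulmxKV// !mxE; ring.
  apply: le_lt_trans sr; apply: mulmx_coord_le; last exact: ltW.
  move=> i; rewrite mulmxBl mxE -dotv_dual_basis mxE mulmxK// !mxE.
  exact: ltW (kP i).
have [M0 HM0] := periodic_bounded latL cf fper.
pose M := `|M0| + 1.
have M_gt0 : 0 < M by rewrite ltr_wpDl.
have HM x : `|f x| <= M.
  by apply: le_trans (HM0 x) _; rewrite /M (le_trans (ler_norm _))// lerDl.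
pose G : set 'rV[R]_n := [set x | 1 - eta / 2 < psi x].
have oG : open G by apply: (@open_comp _ _ psi [set y | 1 - eta / 2 < y]) => //; exact: open_gt.
have mG : measurable G by exact: open_measurable_row.
have gamma0 : 0 < I \1_G.
  apply: periodic_open_integral_gt0 => //.
    by exists x0; rewrite /G /= psi_x0 ltrBlDr ltrDl divr_gt0.
  by move=> x l Ll; rewrite /G /= psi_per.
pose V := I (cst 1).
(* Where [psi > 1 - eta], [f] is at least [e], and on [G] the power of [psi] is large as well.
   Elsewhere [f] is at least [- M], with a factor of at most [(1 - eta) ^+ m]. *)
have lower m x : e * (1 - eta / 2) ^+ m * \1_G x - M * (1 - eta) ^+ m <= f x * psi x ^+ m.
  have e1 : 0 <= 1 - eta by rewrite subr_ge0 ltW.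
  have [h|h] := ltP (1 - eta) (psi x).
    have fx := etaP _ h.
    rewrite lerBlDr (@le_trans _ _ (f x * psi x ^+ m))//; last first.
      by rewrite lerDl mulr_ge0 ?exprn_ge0// ltW.
    rewrite indicE; case: (boolP (x \in G)) => [|_].
      rewrite inE /G /= => Gx; rewrite mulr1.
      have h2 : 0 <= 1 - eta / 2 by lra.
      by apply: ler_pM => //; [exact: ltW|exact: exprn_ge0|apply: lerXn2r; rewrite ?nnegrE//; exact: ltW].
    by rewrite mulr0 mulr_ge0 ?exprn_ge0// (le_trans (ltW e0)).
  have -> : \1_G x = 0 :> R.
    rewrite indicE memNset// /G /= => Gx; move: (lt_le_trans Gx h); lra.
  rewrite mulr0 sub0r lerNl -mulNr.
  apply: (@le_trans _ _ (M * psi x ^+ m)).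
    by rewrite ler_wpM2r ?exprn_ge0// (le_trans (ler_norm _))// normrN.
  by rewrite ler_pM2l//; apply: lerXn2r; rewrite ?nnegrE.
(* Integrate [lower]: its right side has integral zero by [orth] with [xi = 0], where the character
   is the constant 1. For large [m] this contradicts [1 - eta < 1 - eta / 2]. *)
have key m : e * I \1_G * (1 - eta / 2) ^+ m <= M * V * (1 - eta) ^+ m.
  have i1 : (borel_lebesgue n).-integrable U (EFin \o (\1_G : _ -> R)).
    apply: (bounded_integrable mU bU (M := 1)); first exact: measurable_indic.
    by move=> x; rewrite indicE; case: (_ \in _); rewrite ?normr1 ?normr0.
  have i2 a : (borel_lebesgue n).-integrable U (EFin \o (fun x => a * \1_G x : R)).
    by have := integrableZl mU a i1; apply: eq_integrable.
  have i3 a : (borel_lebesgue n).-integrable U (EFin \o (fun _ => a : R)).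
    by apply: iU; exact: cst_continuous.
  have i4 : (borel_lebesgue n).-integrable U (EFin \o (fun x => e * (1 - eta / 2) ^+ m * \1_G x - M * (1 - eta) ^+ m)).
    by have := integrableB mU (i2 (e * (1 - eta / 2) ^+ m)) (i3 (M * (1 - eta) ^+ m)); apply: eq_integrable.
  have i5 : (borel_lebesgue n).-integrable U (EFin \o (fun x => f x * psi x ^+ m)).
    by apply: iU; exact: continuous_mul.
  have L0 : dual_lattice L (0 : 'rV[R]_n).
    by move=> l _; rewrite dotv0l rpred0.
  have := le_Rintegral mU i4 i5 (fun x _ => lower m x).
  have -> : \int[borel_lebesgue n]_(x in U) (f x * psi x ^+ m) = 0.
    rewrite -[RHS](orth m 0 0 L0); apply: eq_Rintegral => x _.
    by rewrite /chi dotvC dotv0l mulr0 addr0 cos0 mulr1.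
  rewrite RintegralB// RintegralZl// [X in _ - X](_ : _ = M * (1 - eta) ^+ m * V).
    by rewrite subr_le0 => h; rewrite mulrAC [leRHS]mulrAC.
  have VE := RintegralZl (M * (1 - eta) ^+ m) mU (i3 1).
  by apply: etrans VE; apply: eq_Rintegral => x _; rewrite mulr1.
apply: (@geometric_domination R (1 - eta / 2) (1 - eta) (e * I \1_G) (M * V)) => //.
- by apply/andP; split; lra.
- exact: mulr_gt0.
Qed.

Lemma periodic_orthogonal_eq0 (f : 'rV[R]_n -> R) : continuous f ->
  Defs.periodic L f ->
  (forall xi th, dual_lattice L xi -> I (fun x => f x * chi xi th x) = 0) ->
  forall x0, f x0 = 0.
Proof.
move=> cf fper f0 x0; apply/eqP; rewrite eq_le (periodic_orthogonal_le0 cf)//=.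
rewrite -oppr_le0.
apply: (@periodic_orthogonal_le0 (fun x => - f x)).
- by move=> x; apply: continuousN; exact: cf.
- by move=> l x Ll; rewrite fper.
- move=> xi th Lxi; rewrite -[RHS]oppr0 -[in RHS](f0 xi th Lxi) /I -[RHS]mulN1r.
  rewrite -RintegralZl//.
    by apply: eq_Rintegral => x _; rewrite mulN1r mulNr.
  by apply: iU; apply: continuous_mul => //; exact: continuous_chi.
Qed.

End completeness.

Lemma set_minE (R : realType) (A : set R) m : A m -> lbound A m -> set_min A = m.
Proof.
move=> Am lm; rewrite /set_min; case: xgetP => [_ -> [Ax lx]|/(_ m)]; last by case.
by apply/eqP; rewrite eq_le lx// lm.
Qed.

(** * The operator norm bounds the quadratic form *)

Section operator_norm.
Context {R : realType} {n : nat} (A : 'M[R]_n).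

Lemma row_coord_le_enorm (v : 'rV[R]_n) i : `|v 0 i| <= enorm v.
Proof.
rewrite -(ler_pXn2r (n := 2))// ?nnegrE ?enorm_ge0// enorm_sqr real_normK ?num_real//.
rewrite /dotv (bigD1 i)//= expr2 lerDl; apply: sumr_ge0 => j _.
by rewrite -expr2 sqr_ge0.
Qed.

Lemma enorm_mulmx_le_opnorm (v : 'rV[R]_n) : enorm v <= 1 -> enorm (v *m A) <= opnorm A.
Proof.
move=> v1; apply: ub_le_sup; last by exists v.
(* The set must be shown bounded before its [sup] can be used as an upper bound; every coordinate of
   [u *m A] is at most [mx_l1 A] in absolute value. *)
exists (Num.sqrt (\sum_(i < n) mx_l1 A ^+ 2)) => _ [u /= u1 <-].
rewrite /enorm ler_wsqrtr// /dotv; apply: ler_sum => i _.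
rewrite -expr2 -real_normK ?num_real// lerXn2r ?nnegrE//; first by rewrite ltW ?mx_l1_gt0.
rewrite -[leRHS]mulr1; apply: mulmx_coord_le => // j.
exact: le_trans (row_coord_le_enorm u j) u1.
Qed.

Lemma dotv_mulmx_le_opnorm (w : 'rV[R]_n) : dotv (w *m A) w <= opnorm A * dotv w w.
Proof.
have [->|w0] := eqVneq w 0.
  by rewrite mul0mx !dotv0l mulr0.
have e0 := enorm_gt0 w0; set a := enorm w in e0 *.
pose v := a^-1 *: w.
have v1 : enorm v = 1.
  apply/eqP; rewrite -(eqrXn2 (n := 2))// ?enorm_ge0// enorm_sqr dotvZl dotvZr.
  by rewrite -enorm_sqr -/a expr1n; apply/eqP; field; rewrite gt_eqF.
have wE : w = a *: v by rewrite /v scalerA mulfV ?gt_eqF// scale1r.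
have -> : dotv w w = a ^+ 2 by rewrite -enorm_sqr.
rewrite wE -scalemxAl dotvZl dotvZr mulrA -expr2 mulrC ler_pM2r ?exprn_gt0//.
apply: le_trans (enorm_mulmx_le_opnorm (v := v) _); last by rewrite v1.
apply: (le_trans (ler_norm _)).
rewrite -(ler_pXn2r (n := 2))// ?nnegrE ?enorm_ge0// real_normK ?num_real//.
apply: le_trans (dotv_CauchySchwarz _ _) _.
by rewrite -(enorm_sqr v) v1 expr1n mulr1 enorm_sqr.
Qed.

End operator_norm.

(** * Shortest vectors of the dual lattice *)

Section dual_minimum.
Context {R : realType} {n : nat} (L : set 'rV[R]_n.+1).
Hypothesis latL : full_rank_lattice L.

(** A dual vector is determined by its integer products with the rows of [B]. If it is no longer
    than the nonzero dual vector [xi1], Cauchy-Schwarz bounds these products by [N], so the minimum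
    is over a finite set. *)
Lemma dual_lattice_shortest : exists xi0 : 'rV[R]_n.+1,
  [/\ dual_lattice L xi0, xi0 != 0 &
      forall xi, dual_lattice L xi -> xi != 0 -> enorm xi0 <= enorm xi].
Proof.
have [B uB LE] := latL.
have uBT : B^T \in unitmx by rewrite unitmx_tr.
pose D (z : 'rV[int]_n.+1) : 'rV[R]_n.+1 := map_mx intr z *m invmx B^T.
have rowL i : L (row i B).
  rewrite LE; exists (delta_mx 0 i) => //.
  by rewrite map_delta_mx rowE.
have DL z : dual_lattice L (D z).
  rewrite LE => _ [y _ <-]; rewrite dotvE trmx_mul mulmxA mulmxKV// mxE.
  by apply: rpred_sum => i _; rewrite !mxE -rmorphM /= intr_int.
have coordE xi i : (xi *m B^T) 0 i = dotv xi (row i B).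
  by rewrite mxE; apply: eq_bigr => j _; rewrite !mxE.
have Dex xi : dual_lattice L xi -> exists2 z, xi = D z & forall i, (z 0 i)%:~R = dotv xi (row i B).
  move=> Lxi.
  have /choice[k kP] : forall i, exists k : int, dotv xi (row i B) = k%:~R.
    by move=> i; apply/intrP; exact: Lxi.
  exists (\row_i k i) => [|i]; last by rewrite mxE kP.
  rewrite /D; apply: (canRL (mulmxK uBT)).
  by apply/rowP => i; rewrite coordE kP !mxE.
pose xi1 : 'rV[R]_n.+1 := D (delta_mx 0 0).
have xi10 : xi1 != 0.
  apply/eqP => xi1E.
  have : xi1 *m B^T = map_mx intr (delta_mx 0 0) by rewrite /xi1 /D mulmxKV.
  rewrite xi1E mul0mx => /rowP/(_ 0); rewrite !mxE eqxx => /eqP.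
  by rewrite eq_sym oner_eq0.
pose C := \sum_i enorm (row i B).
pose N := (Num.truncn (enorm xi1 * C)).+1.
(* Integers between [- N] and [N], shifted by [N] to become ordinals. *)
pose T := {ffun 'I_n.+1 -> 'I_(2 * N).+1}.
pose v (p : T) := D (\row_i ((p i)%:Z - N%:Z)).
have small xi : dual_lattice L xi -> enorm xi <= enorm xi1 -> exists p, xi = v p.
  move=> Lxi xile; have [z xiE zE] := Dex _ Lxi.
  have zN i : `|z 0 i| <= N%:Z.
    rewrite -(ler_int R) intr_norm zE.
    have CN : enorm xi1 * C <= N%:R by rewrite ltW// truncnS_gt.
    apply: le_trans CN.
    apply: (@le_trans _ _ (enorm xi * enorm (row i B))).
      rewrite -(ler_pXn2r (n := 2))// ?nnegrE ?mulr_ge0 ?enorm_ge0// real_normK ?num_real//.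
      by rewrite exprMn !enorm_sqr dotv_CauchySchwarz.
    apply: ler_pM; rewrite ?enorm_ge0// /C (bigD1 i)//= lerDl.
    by apply: sumr_ge0 => j _; rewrite enorm_ge0.
  exists [ffun i => inord (absz (z 0 i + N%:Z))]; rewrite xiE; congr D.
  apply/rowP => i; rewrite mxE ffunE; have := zN i; rewrite ler_norml => /andP[z1 z2].
  have z0 : 0 <= z 0 i + N%:Z by rewrite -lerBlDr sub0r.
  rewrite inordK; first by rewrite gez0_abs// addrK.
  have NE : (2 * N)%N%:Z = N%:Z + N%:Z by rewrite mul2n -addnn PoszD.
  by rewrite -ltz_nat gez0_abs// intS [1 + _]addrC ltzD1 NE lerD2r.
have [p0 p0E] := small _ (DL _) (lexx _).
have vp0 : v p0 != 0 by rewrite -p0E.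
case: (@Order.TotalTheory.arg_minP _ _ _ p0 (fun p => v p != 0) (fun p => enorm (v p)) vp0) => p vp pmin.
exists (v p); split => //; first exact: DL.
move=> xi Lxi xi0; have [h|h] := leP (enorm xi) (enorm xi1).
  by have [q qE] := small _ Lxi h; rewrite qE; apply: pmin; rewrite -qE.
by apply: le_trans (ltW h); rewrite /xi1 p0E; exact: pmin.
Qed.

Lemma lambda1_dual xi0 : dual_lattice L xi0 -> xi0 != 0 ->
  (forall xi, dual_lattice L xi -> xi != 0 -> enorm xi0 <= enorm xi) ->
  lambda1 (dual_lattice L) = enorm xi0.
Proof.
move=> Lxi0 xi00 xi0min; apply: set_minE.
  by exists xi0 => //; split => //; exact/eqP.
by move=> _ [xi [Lxi /eqP xi_neq0] <-]; exact: xi0min.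
Qed.

End dual_minimum.

(** * The spectrum of the flat torus *)

Section spectrum.
Context {R : realType} {n : nat} (L U : set 'rV[R]_n).
Hypotheses (latL : full_rank_lattice L) (oU : open U) (U0 : U !=set0)
  (bU : bounded_row U) (pU : packing L U) (cU : covering L U).

Lemma is_derive_scaled_chi (c : R) (xi : 'rV[R]_n) th x i :
  is_derive x (delta_mx 0 i) (fun x => c * chi xi th x)
    (c * (2 * pi * xi 0 i) * chi xi (th + pi / 2) x).
Proof.
rewrite -mulrA -(dotv_delta xi i).
exact: (is_deriveZ c (is_derive_chi xi th x (delta_mx 0 i))).
Qed.

Lemma partial_scaled_chi (c : R) (xi : 'rV[R]_n) th i :
  partial i (fun x => c * chi xi th x) =
  (fun x => c * (2 * pi * xi 0 i) * chi xi (th + pi / 2) x).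
Proof. by apply/funext => x; case: (is_derive_scaled_chi c xi th x i). Qed.

Lemma continuous_scaled_chi (c : R) (xi : 'rV[R]_n) th :
  continuous (fun x => c * chi xi th x).
Proof. by apply: continuous_mul; [exact: cst_continuous|exact: continuous_chi]. Qed.

Lemma C1_scaled_chi (c : R) (xi : 'rV[R]_n) th : C1 (fun x => c * chi xi th x).
Proof.
split; first exact: continuous_scaled_chi.
move=> i; split; first by move=> x; case: (is_derive_scaled_chi c xi th x i).
by rewrite partial_scaled_chi; exact: continuous_scaled_chi.
Qed.

Lemma dual_torus_eigenvalue xi : dual_lattice L xi ->
  torus_eigenvalue L (4 * pi ^+ 2 * dotv xi xi).
Proof.
move=> Lxi; exists (fun x => 1 * chi xi 0 x); split.
- by move=> l x Ll; rewrite (chi_periodic _ Lxi).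
- split; first exact: C1_scaled_chi.
  by move=> i; rewrite partial_scaled_chi; exact: C1_scaled_chi.
- exists 0; rewrite /chi dotv0l mulr0 addr0 cos0 mulr1.
  exact: oner_neq0.
- move=> x; rewrite /laplacian -sumrN [dotv xi xi]/dotv mulr_sumr mulr_suml.
  apply: eq_bigr => i _.
  rewrite partial_scaled_chi partial_scaled_chi -addrA -splitr chi_pi.
  ring.
Qed.

Lemma torus_eigenvalue_dual a : torus_eigenvalue L a ->
  exists2 xi, dual_lattice L xi & a = 4 * pi ^+ 2 * dotv xi xi.
Proof.
move=> [f [fper f2 [x0 fx0] fa]]; apply: contrapT => Ha.
move/eqP: fx0; apply.
apply: (periodic_orthogonal_eq0 latL oU U0 bU pU cU _ fper); first by case: f2 => -[].
move=> xi th Lxi.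
apply: (orthogonal_eigenfunction latL (open_measurable_row oU) bU pU cU th fper f2 fa Lxi).
by apply/eqP => aE; apply: Ha; exists xi.
Qed.

Lemma lambdaSG_dual xi0 : dual_lattice L xi0 -> xi0 != 0 ->
  (forall xi, dual_lattice L xi -> xi != 0 -> enorm xi0 <= enorm xi) ->
  lambdaSG L = 4 * pi ^+ 2 * enorm xi0 ^+ 2.
Proof.
move=> Lxi0 xi00 xi0min; have p0 := pi_gt0 R.
rewrite enorm_sqr; apply: set_minE.
  split; first exact: dual_torus_eigenvalue.
  by rewrite gt_eqF// mulr_gt0 ?dotv_gt0// mulr_gt0// exprn_gt0.
move=> a [/torus_eigenvalue_dual[xi Lxi ->]].
have [->|xi_neq0] := eqVneq xi 0.
  by rewrite dotv0l mulr0 eqxx.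
move=> _; rewrite ler_pM2l ?mulr_gt0 ?exprn_gt0// -!enorm_sqr.
by apply: lerXn2r; rewrite ?nnegrE ?enorm_ge0//; exact: xi0min.
Qed.

End spectrum.

Theorem theorem1p5 (R : realType) (n : nat) (L K : set 'rV[R]_n)
    (nu : 'rV[R]_n) (delta : R)
    (latL : full_rank_lattice L)
    (convK : convex_set (K : set (convex_lmodType 'rV[R]_n)))
    (fundK : fundamental_domain L K)
    (baryK : barycenter K = 0)
    (unit_nu : enorm nu = 1)
    (tileH : hyperplane_fundamental_domain nu
               (L `&` hyperplane nu) (K `&` hyperplane nu))
    (delta_gt0 : 0 < delta) (delta_le1 : delta <= 1)
    (cov_nu : delta * opnorm (Cov K) <= dotv (nu *m Cov K) nu) :
  [/\ 1 / 12 <= opnorm (Cov K) * lambda1 (dual_lattice L) ^+ 2,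
      opnorm (Cov K) * lambda1 (dual_lattice L) ^+ 2 =
        1 / (4 * pi ^+ 2) * opnorm (Cov K) * lambdaSG L
    & 1 / (4 * pi ^+ 2) * opnorm (Cov K) * lambdaSG L <= 1 / (2 * delta)].
Proof.
case: n => [|n] in L K nu latL convK fundK baryK unit_nu tileH cov_nu *.
  by move/eqP: unit_nu; rewrite /enorm /dotv big_ord0 sqrtr0 eq_sym oner_eq0.
move/convex_setP in convK.
have oU : open K° by exact: open_interior.
have mU := open_measurable_row oU.
have U0 := fundamental_interior_nonempty latL convK fundK.
have bU := fundamental_interior_bounded latL convK fundK.
have pU := fundamental_interior_packing latL fundK.
have cU := fundamental_interior_covering latL convK fundK.
have [xi0 [Lxi0 xi00 xi0min]] := dual_lattice_shortest latL.
rewrite (lambda1_dual Lxi0 xi00 xi0min) (lambdaSG_dual latL oU U0 bU pU cU Lxi0 xi00 xi0min).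
have p0 := pi_gt0 R.
set O := opnorm (Cov K) in cov_nu *.
have -> : 1 / (4 * pi ^+ 2) * O * (4 * pi ^+ 2 * enorm xi0 ^+ 2) = O * enorm xi0 ^+ 2.
  have : 4 * pi ^+ 2 != 0 :> R by rewrite lt0r_neq0// mulr_gt0 ?exprn_gt0.
  by move: (4 * pi ^+ 2) => q q0; field.
have lower : 1 / 12 <= O * enorm xi0 ^+ 2.
  rewrite enorm_sqr; apply: le_trans (dotv_mulmx_le_opnorm (Cov K) xi0).
  rewrite (Cov_dotv latL convK fundK baryK).
  have V0 := vol_interior_gt0 latL convK fundK.
  rewrite -(ler_pM2l V0) [leRHS]mulrA mulfV ?gt_eqF// [leRHS]mul1r div1r.
  by have := variance_dual_ge latL mU bU pU cU Lxi0 xi00.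
split => //.
have [h h0 [Lh hle]] := normal_second_moment latL convK fundK unit_nu baryK tileH.
have hnu : h^-1 *: nu != 0.
  by rewrite -dotv_eq0 dotvZl dotvZr -enorm_sqr unit_nu expr1n mulr1 mulf_neq0// invr_eq0 gt_eqF.
have xile := xi0min _ Lh hnu.
have hE : enorm (h^-1 *: nu) = h^-1.
  apply/eqP; rewrite -(eqrXn2 (n := 2))// ?enorm_ge0 ?invr_ge0 ?ltW//.
  by rewrite enorm_sqr dotvZl dotvZr -enorm_sqr unit_nu expr1n mulr1 expr2.
rewrite hE in xile.
have e0 := enorm_gt0 xi00.
have O0 : 0 < O.
  rewrite -(pmulr_lgt0 _ (exprn_gt0 2 e0)); apply: lt_le_trans lower.
  by rewrite divr_gt0.
(* [nu / h] is a dual vector of length [1 / h], so [h] times the minimal length is at most 1. This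
   cancels the [h ^+ 2] in the bound [h ^+ 2 / 2] on the variance along [nu] and leaves [1 / 2], to
   be divided by [delta]. *)
have hx : h * enorm xi0 <= 1 by rewrite -(mulfV (lt0r_neq0 h0)) ler_pM2l.
have hx2 : (h * enorm xi0) ^+ 2 <= 1 by rewrite expr_le1// mulr_ge0 ?ltW.
rewrite div1r invfM mulrC ler_pdivlMr//.
have : delta * O * enorm xi0 ^+ 2 <= h ^+ 2 / 2 * enorm xi0 ^+ 2.
  by rewrite ler_pM2r ?exprn_gt0//; exact: le_trans cov_nu hle.
move: hx2; rewrite exprMn; lra.
Qed.
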